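(* The central extension $\hat\theta$ of $\theta$ by $Rc_0$ naturally extends to a central extension of $R$-Lie algebras $\hat\theta_{L,R}$ of $\theta_{L,R}$ by $Rc_0$ (so with $\hat\theta_{L,R}/\hat\theta=\theta_{L,R}/\theta\cong\theta_R$), and the Sugawara representation $T_{\mathfrak g}$ of $\hat\theta$ on $\mathbb F(L\mathfrak g)$ extends to $\hat\theta_{L,R}$ in such a manner that it preserves any $U\widehat{L\mathfrak g}$-submodule of $\mathbb F(L\mathfrak g)$ and for every $D\in\theta_{L,R}$ (with $\hat D\in\hat\theta_{L,R}$ a lift of $D$) the following relations hold in $\operatorname{End}(\mathbb F(L\mathfrak g))$: (i) $[T_{\mathfrak g}(\hat D),Xf]=X(Df)$ for $X\in\mathfrak g$, $f\in L$, and (ii) (Leibniz rule) $[T_{\mathfrak g}(\hat D),r]=Dr$ for $r\in R$. These assertions also hold for the oscillator representation $T$ on $\mathbb F$: $T$ extends to $\hat\theta_{L,R}$, preserves any $U\hat{\mathfrak l}$-submodule of $\mathbb F$, and $[T(\hat D),f]=Df$ for $f\in L=\mathfrak l$, $[T(\hat D),r]=Dr$ for $r\in R$.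
   Context: $k$ is a field of characteristic zero, $R$ a $k$-algebra, $\mathcal O$ an $R$-algebra isomorphic to $R[[t]]$, with $\mathfrak m\subset\mathcal O$ the ideal corresponding to $(t)$; $L\cong R((t))$ is $\mathcal O$ with a generator of $\mathfrak m$ inverted, with its $\mathfrak m$-adic topology. $\theta$ is the Lie algebra of continuous $R$-derivations $L\to L$, $\omega$ its $L$-dual ($\cong R((t))dt$), $\langle\cdot,\cdot\rangle$ the pairing between them, $\operatorname{Res}:\omega\to R$ the residue. Put $D_n=t^{n+1}\frac{d}{dt}$. $\theta_R$ is the module of $k$-derivations $R\to R$; $\theta_{L,R}$ is the module of (continuous) $k$-derivations of $L$ which preserve $R\subset L$; then $\theta\subset\theta_{L,R}$ and $\theta_{L,R}/\theta$ can be identified with $\theta_R$. Oscillator algebra. $\mathfrak l$ is $L$ viewed as an abelian $R$-Lie algebra; $\hat{\mathfrak l}=\mathfrak l\oplus\hbar R$ has $\hbar$ central and bracket $[f,g]=\hbar\operatorname{Res}(g\,df)$. Its enveloping algebra $U\hat{\mathfrak l}$ is completed on the right: $\overline U\hat{\mathfrak l}=\varprojlim_N U\hat{\mathfrak l}/U\hat{\mathfrak l}\circ\mathfrak m^N$ ($\circ$ is the product in enveloping algebras). $\mathbb F=(U\hat{\mathfrak l}/U\hat{\mathfrak l}\circ\mathfrak m)[\hbar^{-1}]$. Virasoro algebra. $\hat\theta$ is a central extension of $\theta$ by $Rc_0$; a choice of $t$ gives an $R$-linear continuous section $D\mapsto\hat D$, and $[\hat D_m,\hat D_n]=(n-m)\hat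 D_{m+n}+\frac{m^3-m}{12}\delta_{m+n,0}c_0$. The oscillator representation is $T(c_0)=1$, $T(\hat D)=-\frac1{2\hbar}\sum_{l\in\mathbb Z}:\langle D,t^{-l-1}dt\rangle\circ t^l:\ \in\overline U\hat{\mathfrak l}[\hbar^{-1}]$, where in a normally ordered product the power of $t$ with the highest exponent is put last (on the right). Sugawara. $\mathfrak g$ is a finite dimensional simple Lie algebra over $k$, $(\cdot|\cdot)$ the invariant symmetric bilinear form taking the value $2$ on the small coroots, $\{X_\kappa\}$ an orthonormal basis, and $\check h$ is defined by $\sum_\kappa[X_\kappa,[X_\kappa,Y]]=2\check hY$. $L\mathfrak g=\mathfrak g\otimes_kL$ with $F^NL\mathfrak g=\mathfrak g\otimes_k\mathfrak m^N$; $\widehat{L\mathfrak g}=L\mathfrak g\oplus Rc$ with $c$ central and $[Xf,Yg]=[X,Y]fg+c\operatorname{Res}(g\,df)(X|Y)$; $\overline U\widehat{L\mathfrak g}=\varprojlim_NU\widehat{L\mathfrak g}/U\widehat{L\mathfrak g}\circ F^NL\mathfrak g$; $\mathbb F(L\mathfrak g)=(U\widehat{L\mathfrak g}/U\widehat{L\mathfrak g}\circ F^1L\mathfrak g)[\frac1{c+\check h}]$. The Sugawara representation $T_{\mathfrak g}:\hat\theta\to\overline U\widehat{L\mathfrak g}[\frac1{c+\check h}]$ is the homomorphism of $R$-Lie algebras with $T_{\mathfrak g}(c_0)=\frac{c}{c+\check h}\dim\mathfrak g$ and $$T_{\mathfrak g}(\hat D)=-\frac1{2(c+\check h)}\sum_\kappa\sum_{l\in\mathbb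 Z}:X_\kappa\langle D,t^{-l-1}dt\rangle\circ X_\kappa t^l:$$ (same normal ordering). The completed enveloping algebras act on $\mathbb F$, resp. $\mathbb F(L\mathfrak g)$. $\operatorname{End}$ means $k$-linear endomorphisms.
   Formalization: Preservation of all submodules fails for D outside θ (by (ii), take JF): it is proved for θ̂, and for other D when M is stable under D acting on coefficients; submodules are over U[1/(c+ȟ)], U[1/ħ]; the bracket of θ̂_{L,R} is Leibniz over R, only c_0 is central. *)

(* Defs.v *)
From HB Require Import structures.
From mathcomp Require Import all_boot all_order all_algebra.
From mathcomp Require Import boolp classical_sets functions cardinality fsbigop.
From mathcomp Require Import generic_quotient zify ring.
Set Implicit Arguments.
Unset Strict Implicit.
Unset Printing Implicit Defensive.
Import Order.TTheory GRing.Theory Num.Theory.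
Local Open Scope ring_scope.
Local Open Scope quotient_scope.

Definition vanishes_below (V : nmodType) (f : int -> V) (N : int) : Prop :=
  forall n : int, n < N -> f n = 0.

Record laurent (R : nmodType) : Type := Laurent {
  lcoef : int -> R;
  lcoefP : exists N : int, vanishes_below lcoef N }.

Section LaurentZmod.
Variable R : zmodType.
Implicit Types f g h : laurent R.

Lemma laurentP f g : lcoef f =1 lcoef g -> f = g.
Proof.
case: f g => [f Hf] [g Hg] /= /funext E; subst g.
by congr Laurent; exact: Prop_irrelevance.
Qed.

HB.instance Definition _ := gen_eqMixin (laurent R).
HB.instance Definition _ := gen_choiceMixin (laurent R).

Fact ladd_sub f g : exists N, vanishes_below (fun n => lcoef f n + lcoef g n) N.
Proof.
case: (lcoefP f) (lcoefP g) => [a Ha] [b Hb]; exists (Num.min a b) => n.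
by rewrite lt_min => /andP[na nb]; rewrite Ha ?Hb ?addr0.
Qed.
Definition ladd f g := Laurent (ladd_sub f g).

Fact lopp_sub f : exists N, vanishes_below (fun n => - lcoef f n) N.
Proof. by case: (lcoefP f) => a Ha; exists a => n /Ha ->; rewrite oppr0. Qed.
Definition lopp f := Laurent (lopp_sub f).

Fact lzero_sub : exists N, vanishes_below (fun=> 0 : R) N.
Proof. by exists 0. Qed.
Definition lzero := Laurent lzero_sub.

Fact laddA : associative ladd.
Proof. by move=> f g h; apply: laurentP => n /=; rewrite addrA. Qed.
Fact laddC : commutative ladd.
Proof. by move=> f g; apply: laurentP => n /=; rewrite addrC. Qed.
Fact ladd0 : left_id lzero ladd.
Proof. by move=> f; apply: laurentP => n /=; rewrite add0r. Qed.
Fact laddN : left_inverse lzero lopp ladd.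
Proof. by move=> f; apply: laurentP => n /=; rewrite addNr. Qed.

HB.instance Definition _ :=
  GRing.isZmodule.Build (laurent R) laddA laddC ladd0 laddN.

Lemma lcoefD f g n : lcoef (f + g) n = lcoef f n + lcoef g n. Proof. by []. Qed.
Lemma lcoef0 n : lcoef (0 : laurent R) n = 0. Proof. by []. Qed.
End LaurentZmod.

Section LaurentRing.
Variable R : comNzRingType.
Implicit Types (F G : int -> R) (f g h : laurent R).

Definition lconv F G (n : int) : R := \sum_(i \in [set: int]) (F i * G (n - i)).

Definition lpoly F (a : int) (m : nat) : {poly R} :=
  \poly_(i < m.+1) F (a + i%:Z).

Lemma lconv_below F G a b :
  vanishes_below F a -> vanishes_below G b -> vanishes_below (lconv F G) (a + b).
Proof.
move=> Fa Gb n nab; apply: fsbig1 => i _.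
have [/Fa ->|ai] := ltP i a; first by rewrite mul0r.
by rewrite (Gb (n - i)) ?mulr0 //; lia.
Qed.

Lemma lconvE F G a b (m m' : nat) :
  vanishes_below F a -> vanishes_below G b -> (m <= m')%N ->
  lconv F G (a + b + m%:Z) = (lpoly F a m' * lpoly G b m')`_m.
Proof.
move=> Fa Gb mm'; rewrite /lconv.
rewrite (fsbigE [seq a + i%:Z | i <- iota 0 m.+1]) //; first last.
- move=> i _ ir; have [/Fa ->|ai] := ltP i a; first by rewrite mul0r.
  rewrite Gb ?mulr0 //; rewrite ltNge; apply/negP => H; move/negP: ir; apply.
  have -> : i = a + `|i - a|%N%:Z by lia.
  by apply: (map_f (fun j : nat => a + j%:Z)); rewrite mem_iota; lia.
- by rewrite map_inj_uniq ?iota_uniq // => i j; lia.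
rewrite coefM big_map -[iota 0 m.+1]/(index_iota 0 m.+1) big_mkcond /=.
rewrite big_mkord; apply: eq_bigr => i _.
have im : (i <= m)%N by rewrite -ltnS.
rewrite in_setT /lpoly !coef_poly !ltnS (leq_trans im) // (leq_trans (leq_subr _ _)) //.
by congr (_ * G _); rewrite -subzn //; lia.
Qed.

Fact lmul_sub f g : exists N, vanishes_below (lconv (lcoef f) (lcoef g)) N.
Proof.
case: (lcoefP f) (lcoefP g) => [a Ha] [b Hb]; exists (a + b).
exact: lconv_below.
Qed.
Definition lmul f g := Laurent (lmul_sub f g).

Fact lmono_sub (l : int) (r : R) :
  exists N, vanishes_below (fun n : int => r *+ (n == l)) N.
Proof. by exists l => n nl; rewrite lt_eqF. Qed.
Definition lmono (l : int) (r : R) := Laurent (lmono_sub l r).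

Lemma coefM_eq (p q p' q' : {poly R}) m :
  (forall i, (i <= m)%N -> p`_i = p'`_i) -> (forall i, (i <= m)%N -> q`_i = q'`_i) ->
  (p * q)`_m = (p' * q')`_m.
Proof.
move=> Hp Hq; rewrite !coefM; apply: eq_bigr => i _.
by rewrite Hp ?Hq ?leq_subr // -ltnS.
Qed.

Lemma nat_above (a n : int) : n < a \/ exists m : nat, n = a + m%:Z.
Proof.
have [|H] := ltP n a; first by left.
by right; exists `|n - a|%N; lia.
Qed.

Fact lmulC : commutative lmul.
Proof.
move=> f g; apply: laurentP => n /=.
case: (lcoefP f) (lcoefP g) => [a Ha] [b Hb].
case: (nat_above (a + b) n) => [H|[m ->]].
  by rewrite (lconv_below Ha Hb) ?(lconv_below Hb Ha) // addrC.
by rewrite (lconvE Ha Hb (leqnn m)) (addrC a b) (lconvE Hb Ha (leqnn m)) mulrC.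
Qed.

Fact lmulA : associative lmul.
Proof.
move=> f g h; apply: laurentP => n /=.
case: (lcoefP f) (lcoefP g) (lcoefP h) => [a Ha] [b Hb] [c Hc].
have Hab := lconv_below Ha Hb; have Hbc := lconv_below Hb Hc.
have Eabc : a + (b + c) = a + b + c by rewrite addrA.
case: (nat_above (a + b + c) n) => [H|[m ->]].
  by rewrite (lconv_below Hab Hc) // (lconv_below Ha Hbc) // Eabc.
rewrite (lconvE Hab Hc (leqnn m)) -{1}Eabc (lconvE Ha Hbc (leqnn m)).
transitivity ((lpoly (lcoef f) a m * (lpoly (lcoef g) b m * lpoly (lcoef h) c m))`_m).
  apply: coefM_eq => // i im; rewrite {1}/lpoly coef_poly ltnS im.
  by rewrite (lconvE Hb Hc im).
rewrite mulrA; apply: coefM_eq => // i im.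
by rewrite {3}/lpoly coef_poly ltnS im (lconvE Ha Hb im).
Qed.

Fact lmul1 : left_id (lmono 0 1) lmul.
Proof.
move=> f; apply: laurentP => n /=; rewrite /lconv.
rewrite (fsbigE [:: 0]) //=.
  by rewrite big_mkcond big_seq1 in_setT mulr1n mul1r subr0.
by move=> i _; rewrite inE => /negbTE ->; rewrite mul0r.
Qed.

Fact lmulDl : left_distributive lmul +%R.
Proof.
move=> f g h; apply: laurentP => n /=.
case: (lcoefP f) (lcoefP g) (lcoefP h) => [a' Ha'] [b' Hb'] [c Hc].
pose a := Num.min a' b'.
have Ha : vanishes_below (lcoef f) a.
  by move=> i; rewrite lt_min => /andP[/Ha'].
have Hb : vanishes_below (lcoef g) a.
  by move=> i; rewrite lt_min => /andP[_ /Hb'].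
have Hab : vanishes_below (fun i => lcoef f i + lcoef g i) a.
  by move=> i ia; rewrite Ha ?Hb ?addr0.
case: (nat_above (a + c) n) => [H|[m ->]].
  by rewrite !(lconv_below _ Hc H) // addr0.
rewrite !(lconvE _ Hc (leqnn m)) // -coefD -mulrDl.
by apply: coefM_eq => // i _; rewrite coefD !coef_poly; case: ifP => _ //; rewrite addr0.
Qed.

Fact lone_neq0 : lmono 0 1 != 0.
Proof.
apply/eqP => /(congr1 (fun f => lcoef f 0)) /= /eqP.
by rewrite mulr1n (negbTE (oner_neq0 R)).
Qed.

HB.instance Definition _ := GRing.Zmodule_isComNzRing.Build (laurent R)
  lmulA lmulC lmul1 lmulDl lone_neq0.

Fact lscale_sub (r : R) f : exists N, vanishes_below (fun n => r * lcoef f n) N.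
Proof. by case: (lcoefP f) => a Ha; exists a => n /Ha ->; rewrite mulr0. Qed.
Definition lscale (r : R) f := Laurent (lscale_sub r f).

Fact lscaleA r s f : lscale r (lscale s f) = lscale (r * s) f.
Proof. by apply: laurentP => n /=; rewrite mulrA. Qed.
Fact lscale1 : left_id 1 lscale.
Proof. by move=> f; apply: laurentP => n /=; rewrite mul1r. Qed.
Fact lscaleDr : right_distributive lscale +%R.
Proof. by move=> r f g; apply: laurentP => n /=; rewrite mulrDr. Qed.
Fact lscaleDl f : {morph lscale^~ f : r s / r + s}.
Proof. by move=> r s; apply: laurentP => n /=; rewrite mulrDl. Qed.
HB.instance Definition _ := GRing.Zmodule_isLmodule.Build R (laurent R)
  lscaleA lscale1 lscaleDr lscaleDl.

Fact lscaleAl r f g : r *: (f * g) = (r *: f) * g.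
Proof.
apply: laurentP => n.
case: (lcoefP f) (lcoefP g) => [a Ha] [c Hc].
have Hra : vanishes_below (lcoef (r *: f)) a.
  by move=> i ia /=; rewrite Ha ?mulr0.
rewrite /GRing.mul /=.
case: (nat_above (a + c) n) => [H|[m ->]].
  by rewrite (lconv_below Ha Hc H) (lconv_below Hra Hc H) mulr0.
rewrite (lconvE Ha Hc (leqnn m)) (lconvE Hra Hc (leqnn m)) -coefZ scalerAl.
by apply: coefM_eq => // i _; rewrite coefZ !coef_poly; case: ifP => _ //; rewrite mulr0.
Qed.
HB.instance Definition _ :=
  GRing.Lmodule_isLalgebra.Build R (laurent R) lscaleAl.
HB.instance Definition _ := GRing.Lalgebra_isComAlgebra.Build R (laurent R).

Lemma lcoefM f g n :
  lcoef (f * g) n = \sum_(i \in [set: int]) (lcoef f i * lcoef g (n - i)).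
Proof. by []. Qed.
Lemma lcoefZ r f n : lcoef (r *: f) n = r * lcoef f n.
Proof. by []. Qed.
Lemma lcoef_mono l r n : lcoef (lmono l r) n = r *+ (n == l).
Proof. by []. Qed.
End LaurentRing.

(* A presentation by generators and relations: the terms below modulo the
   smallest congruence making them an associative unital R-algebra in which
   UGen is R-linear and UGen x * UGen y - UGen y * UGen x = UGen (br x y).
   For a Lie bracket br this is the universal enveloping algebra of (V, br). *)
Section Enveloping.
Variables (R : comNzRingType) (V : lmodType R) (br : V -> V -> V).

Inductive uterm : Type :=
| UGen of V
| UCst of R
| UAdd of uterm & uterm
| UMul of uterm & uterm.

HB.instance Definition _ := gen_eqMixin uterm.
HB.instance Definition _ := gen_choiceMixin uterm.

Inductive ueq : uterm -> uterm -> Prop :=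
| ueq_refl x : ueq x x
| ueq_sym x y : ueq x y -> ueq y x
| ueq_trans y x z : ueq x y -> ueq y z -> ueq x z
| ueq_add x x' y y' : ueq x x' -> ueq y y' -> ueq (UAdd x y) (UAdd x' y')
| ueq_mul x x' y y' : ueq x x' -> ueq y y' -> ueq (UMul x y) (UMul x' y')
| ueq_addA x y z : ueq (UAdd x (UAdd y z)) (UAdd (UAdd x y) z)
| ueq_addC x y : ueq (UAdd x y) (UAdd y x)
| ueq_add0 x : ueq (UAdd (UCst 0) x) x
| ueq_mulA x y z : ueq (UMul x (UMul y z)) (UMul (UMul x y) z)
| ueq_mul1 x : ueq (UMul (UCst 1) x) x
| ueq_mul0 x : ueq (UMul (UCst 0) x) (UCst 0)
| ueq_mulDl x y z : ueq (UMul (UAdd x y) z) (UAdd (UMul x z) (UMul y z))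
| ueq_mulDr x y z : ueq (UMul x (UAdd y z)) (UAdd (UMul x y) (UMul x z))
| ueq_cstD r s : ueq (UCst (r + s)) (UAdd (UCst r) (UCst s))
| ueq_cstM r s : ueq (UCst (r * s)) (UMul (UCst r) (UCst s))
| ueq_cstC r x : ueq (UMul (UCst r) x) (UMul x (UCst r))
| ueq_genD v w : ueq (UGen (v + w)) (UAdd (UGen v) (UGen w))
| ueq_genZ r v : ueq (UGen (r *: v)) (UMul (UCst r) (UGen v))
| ueq_genB v w : ueq (UMul (UGen v) (UGen w))
                     (UAdd (UGen (br v w)) (UMul (UGen w) (UGen v))).

Definition ueqb (x y : uterm) : bool := `[< ueq x y >].

Fact ueqb_refl : reflexive ueqb.
Proof. by move=> x; apply/asboolP; exact: ueq_refl. Qed.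
Fact ueqb_sym : symmetric ueqb.
Proof. by move=> x y; apply/asboolP/asboolP; exact: ueq_sym. Qed.
Fact ueqb_trans : transitive ueqb.
Proof.
by move=> y x z /asboolP xy /asboolP yz; apply/asboolP; exact: (ueq_trans xy yz).
Qed.

Canonical ueq_equiv := EquivRel ueqb ueqb_refl ueqb_sym ueqb_trans.

Definition uea : Type := {eq_quot ueq_equiv}.
HB.instance Definition _ := Choice.on uea.
HB.instance Definition _ := EqQuotient.on uea.

Definition uclass (x : uterm) : uea := \pi_uea x.

Lemma uclassP x y : uclass x = uclass y <-> ueq x y.
Proof.
split; first by move=> /eqmodP /asboolP.
by move=> xy; apply/eqmodP/asboolP.
Qed.

Lemma ueaW (P : uea -> Prop) : (forall x, P (uclass x)) -> forall u, P u.
Proof. exact: quotW. Qed.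

Definition uadd (u v : uea) : uea := uclass (UAdd (repr u) (repr v)).
Definition umul (u v : uea) : uea := uclass (UMul (repr u) (repr v)).
Definition uopp (u : uea) : uea := umul (uclass (UCst (- 1))) u.

Lemma repr_uclass x : ueq (repr (uclass x)) x.
Proof. by apply/uclassP; exact: reprK. Qed.

Lemma uaddE x y : uadd (uclass x) (uclass y) = uclass (UAdd x y).
Proof. by apply/uclassP/ueq_add; exact: repr_uclass. Qed.
Lemma umulE x y : umul (uclass x) (uclass y) = uclass (UMul x y).
Proof. by apply/uclassP/ueq_mul; exact: repr_uclass. Qed.

Fact uaddA : associative uadd.
Proof.
elim/ueaW=> x; elim/ueaW=> y; elim/ueaW=> z; rewrite !uaddE.
exact/uclassP/ueq_addA.
Qed.
Fact uaddC : commutative uadd.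
Proof.
by elim/ueaW=> x; elim/ueaW=> y; rewrite !uaddE; exact/uclassP/ueq_addC.
Qed.
Fact uadd0 : left_id (uclass (UCst 0)) uadd.
Proof. by elim/ueaW=> x; rewrite uaddE; exact/uclassP/ueq_add0. Qed.
Fact uaddN : left_inverse (uclass (UCst 0)) uopp uadd.
Proof.
elim/ueaW=> x; rewrite /uopp umulE uaddE; apply/uclassP.
apply: (ueq_trans (y := UAdd (UMul (UCst (-1)) x) (UMul (UCst 1) x))).
  by apply: ueq_add; [exact: ueq_refl|apply: ueq_sym; exact: ueq_mul1].
apply: (ueq_trans (y := UMul (UAdd (UCst (-1)) (UCst 1)) x)).
  by apply: ueq_sym; exact: ueq_mulDl.
apply: (ueq_trans (y := UMul (UCst 0) x)); last exact: ueq_mul0.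
apply: ueq_mul; last exact: ueq_refl.
by apply: ueq_sym; rewrite -[X in UCst X](addNr (1 : R)); exact: ueq_cstD.
Qed.

HB.instance Definition _ := GRing.isZmodule.Build uea uaddA uaddC uadd0 uaddN.

Fact umulA : associative umul.
Proof.
elim/ueaW=> x; elim/ueaW=> y; elim/ueaW=> z; rewrite !umulE.
exact/uclassP/ueq_mulA.
Qed.
Fact umul1 : left_id (uclass (UCst 1)) umul.
Proof. by elim/ueaW=> x; rewrite umulE; exact/uclassP/ueq_mul1. Qed.
Fact umulr1 : right_id (uclass (UCst 1)) umul.
Proof.
elim/ueaW=> x; rewrite umulE; apply/uclassP.
exact: (ueq_trans (ueq_sym (ueq_cstC 1 x)) (ueq_mul1 x)).
Qed.
Fact umulDl : left_distributive umul +%R.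
Proof.
elim/ueaW=> x; elim/ueaW=> y; elim/ueaW=> z.
by rewrite /GRing.add /= !(uaddE, umulE); exact/uclassP/ueq_mulDl.
Qed.
Fact umulDr : right_distributive umul +%R.
Proof.
elim/ueaW=> x; elim/ueaW=> y; elim/ueaW=> z.
by rewrite /GRing.add /= !(uaddE, umulE); exact/uclassP/ueq_mulDr.
Qed.

Fixpoint uaug (x : uterm) : R :=
  match x with
  | UGen _ => 0
  | UCst r => r
  | UAdd y z => uaug y + uaug z
  | UMul y z => uaug y * uaug z
  end.

Lemma ueq_uaug x y : ueq x y -> uaug x = uaug y.
Proof.
elim=> //=.
- by move=> ? ? ? _ -> _ ->.
- by move=> ? ? ? ? _ -> _ ->.
- by move=> ? ? ? ? _ -> _ ->.
- by move=> *; rewrite addrA.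
- by move=> *; rewrite addrC.
- by move=> *; rewrite add0r.
- by move=> *; rewrite mulrA.
- by move=> *; rewrite mul1r.
- by move=> *; rewrite mul0r.
- by move=> *; rewrite mulrDl.
- by move=> *; rewrite mulrDr.
- by move=> *; rewrite mulrC.
- by move=> *; rewrite addr0.
- by move=> *; rewrite mulr0.
- by move=> *; rewrite mul0r add0r.
Qed.

Fact uone_neq0 : uclass (UCst 1) != 0.
Proof.
apply/eqP => /uclassP /ueq_uaug /= /eqP.
by rewrite (negbTE (oner_neq0 R)).
Qed.

HB.instance Definition _ := GRing.Zmodule_isNzRing.Build uea
  umulA umul1 umulr1 umulDl umulDr uone_neq0.

Definition uscale (r : R) (u : uea) : uea := uclass (UCst r) * u.

Fact uscaleA r s u : uscale r (uscale s u) = uscale (r * s) u.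
Proof.
rewrite /uscale mulrA; congr (_ * _).
by rewrite {1}/GRing.mul /= umulE; apply/uclassP/ueq_sym/ueq_cstM.
Qed.
Fact uscale1 : left_id 1 uscale.
Proof. by move=> u; rewrite /uscale mul1r. Qed.
Fact uscaleDr : right_distributive uscale +%R.
Proof. by move=> r u v; rewrite /uscale mulrDr. Qed.
Fact uscaleDl u : {morph uscale^~ u : r s / r + s}.
Proof.
move=> r s; rewrite /uscale -mulrDl; congr (_ * _).
by rewrite [RHS]/GRing.add /= uaddE; exact/uclassP/ueq_cstD.
Qed.
HB.instance Definition _ := GRing.Zmodule_isLmodule.Build R uea
  uscaleA uscale1 uscaleDr uscaleDl.
Fact uscaleAl (r : R) (u v : uea) : r *: (u * v) = (r *: u) * v.
Proof. by rewrite /GRing.scale /= /uscale mulrA. Qed.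
HB.instance Definition _ := GRing.Lmodule_isLalgebra.Build R uea uscaleAl.
Fact uscaleAr (r : R) (u v : uea) : r *: (u * v) = u * (r *: v).
Proof.
rewrite /GRing.scale /= /uscale !mulrA; congr (_ * _).
elim/ueaW: u => x; rewrite /GRing.mul /= !umulE; exact/uclassP/ueq_cstC.
Qed.
HB.instance Definition _ := GRing.Lalgebra_isAlgebra.Build R uea uscaleAr.

Definition ugen (v : V) : uea := uclass (UGen v).

Fact ugen_linear : linear ugen.
Proof.
move=> r v w; rewrite /ugen /GRing.add /GRing.scale /= /uscale /GRing.mul /=.
rewrite umulE uaddE; apply/uclassP; apply: ueq_trans (ueq_genD _ _) _.
by apply: ueq_add; [exact: ueq_genZ|exact: ueq_refl].
Qed.
HB.instance Definition _ := GRing.isLinear.Build R V uea _ ugen ugen_linear.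

Lemma ugenB v w : ugen v * ugen w - ugen w * ugen v = ugen (br v w).
Proof.
apply/eqP; rewrite subr_eq; apply/eqP.
by rewrite /GRing.mul /GRing.add /= !umulE uaddE; exact/uclassP/ueq_genB.
Qed.
End Enveloping.

(* The module (U / U S)[1/z] for a subset S and a central element z of U:
   the fraction [frac u n] is z^-n times the class of u. *)
Section Fractions.
Variables (R : comNzRingType) (U : algType R) (S : U -> Prop) (z : U).

Definition left_ideal (u : U) : Prop :=
  exists2 s : seq (U * U), (forall p, p \in s -> S p.2)
                         & u = \sum_(p <- s) p.1 * p.2.

Lemma left_ideal0 : left_ideal 0.
Proof. by exists [::]; rewrite ?big_nil. Qed.
Lemma left_idealD u v : left_ideal u -> left_ideal v -> left_ideal (u + v).
Proof.
move=> [s Ss ->] [t St ->]; exists (s ++ t); last by rewrite big_cat.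
by move=> p; rewrite mem_cat => /orP[/Ss|/St].
Qed.
Lemma left_idealM a u : left_ideal u -> left_ideal (a * u).
Proof.
move=> [s Ss ->]; exists [seq (a * p.1, p.2) | p <- s].
  by move=> _ /mapP[p /Ss Sp ->].
by rewrite big_map mulr_sumr; apply: eq_bigr => p _; rewrite mulrA.
Qed.
Lemma left_idealN u : left_ideal u -> left_ideal (- u).
Proof. by rewrite -mulN1r; exact: left_idealM. Qed.

Definition frac_eq (x y : U * nat) : Prop :=
  exists p : nat, left_ideal (z ^+ p * (z ^+ y.2 * x.1 - z ^+ x.2 * y.1)).
Definition frac_eqb (x y : U * nat) : bool := `[< frac_eq x y >].

Fact frac_eqb_refl : reflexive frac_eqb.
Proof.
by move=> x; apply/asboolP; exists 0%N; rewrite subrr mulr0; exact: left_ideal0.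
Qed.
Fact frac_eqb_sym : symmetric frac_eqb.
Proof.
by move=> x y; apply/asboolP/asboolP => -[p Hp]; exists p;
   rewrite -opprB mulrN; exact: left_idealN.
Qed.
Fact frac_eqb_trans : transitive frac_eqb.
Proof.
move=> [v b] [u a] [w c] /asboolP[p /= Hp] /asboolP[q /= Hq]; apply/asboolP.
exists (p + q + b)%N => /=.
have := left_idealD (left_idealM (z ^+ (q + c)) Hp) (left_idealM (z ^+ (p + a)) Hq).
rewrite !mulrBr !mulrA -!exprD addrA.
have -> : (q + c + p + a = p + a + q + c)%N by lia.
rewrite subrK; congr (left_ideal (_ ^+ _ * _ - _ ^+ _ * _)); lia.
Qed.

Canonical frac_equiv :=
  EquivRel frac_eqb frac_eqb_refl frac_eqb_sym frac_eqb_trans.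

Definition fracmod : Type := {eq_quot frac_equiv}.
HB.instance Definition _ := Choice.on fracmod.
HB.instance Definition _ := EqQuotient.on fracmod.

Definition frac (u : U) (n : nat) : fracmod := \pi_fracmod (u, n).

Lemma fracP u m v n : frac u m = frac v n <-> frac_eq (u, m) (v, n).
Proof.
split; first by move=> /eqmodP /asboolP.
by move=> H; apply/eqmodP/asboolP.
Qed.

Lemma fracW (P : fracmod -> Prop) : (forall u n, P (frac u n)) -> forall x, P x.
Proof. by move=> H; apply: quotW => -[u n]; exact: H. Qed.

Lemma repr_frac u n : frac_eq (repr (frac u n)) (u, n).
Proof.
case E : (repr _) => [v m]; apply/fracP.
by rewrite /frac -E; exact: reprK.
Qed.

Definition frac_add (x y : fracmod) : fracmod :=
  frac (z ^+ (repr y).2 * (repr x).1 + z ^+ (repr x).2 * (repr y).1)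
       ((repr x).2 + (repr y).2).
Definition frac_scale (r : R) (x : fracmod) : fracmod :=
  frac (r *: (repr x).1) (repr x).2.
Definition frac_opp (x : fracmod) : fracmod := frac_scale (- 1) x.

Lemma frac_addE u m v n :
  frac_add (frac u m) (frac v n) = frac (z ^+ n * u + z ^+ m * v) (m + n).
Proof.
case: (repr_frac u m) (repr_frac v n); rewrite /frac_add.
case: (repr (frac u m)) (repr (frac v n)) => [u' m'] [v' n'] /= p Hp [q /= Hq].
apply/fracP; exists (p + q)%N => /=.
have := left_idealD (left_idealM (z ^+ (q + n + n')) Hp)
                    (left_idealM (z ^+ (p + m + m')) Hq).
rewrite !mulrDr !mulrN !mulrDr !opprD !mulrA -!exprD addrACA.
by congr (left_ideal (_ ^+ _ * _ + _ ^+ _ * _ + (- (_ ^+ _ * _) - _ ^+ _ * _))); lia.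
Qed.

Lemma frac_scaleE r u n : frac_scale r (frac u n) = frac (r *: u) n.
Proof.
case: (repr_frac u n); rewrite /frac_scale.
case: (repr (frac u n)) => [u' n'] /= p Hp; apply/fracP; exists p => /=.
have := left_idealM (r *: 1) Hp.
by rewrite -scalerAl mul1r scalerAr scalerBr !scalerAr.
Qed.

Lemma frac_eqW u v n : u = v -> frac u n = frac v n. Proof. by move=> ->. Qed.

Fact frac_addA : associative frac_add.
Proof.
elim/fracW=> u a; elim/fracW=> v b; elim/fracW=> w c; rewrite !frac_addE addnA.
apply: frac_eqW; rewrite !mulrDr !mulrA -!exprD addrA.
by congr (_ ^+ _ * _ + _ ^+ _ * _ + _ ^+ _ * _); lia.
Qed.
Fact frac_addC : commutative frac_add.
Proof.
by elim/fracW=> u a; elim/fracW=> v b; rewrite !frac_addE addnC addrC.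
Qed.
Fact frac_add0 : left_id (frac 0 0) frac_add.
Proof.
by elim/fracW=> u a; rewrite frac_addE mulr0 expr0 mul1r !add0r.
Qed.
Lemma frac_cancel u m n : frac (z ^+ m * u) (m + n) = frac u n.
Proof.
apply/fracP; exists 0%N => /=; rewrite mulrA -exprD addnC subrr mulr0.
exact: left_ideal0.
Qed.
Lemma frac0 n : frac 0 n = frac 0 0.
Proof. by rewrite -(frac_cancel 0 n 0) mulr0 addn0. Qed.
Lemma frac_addE1 u v n : frac_add (frac u n) (frac v n) = frac (u + v) n.
Proof. by rewrite frac_addE -mulrDr frac_cancel. Qed.
Fact frac_addN : left_inverse (frac 0 0) frac_opp frac_add.
Proof.
by elim/fracW=> u a; rewrite /frac_opp frac_scaleE frac_addE1 scaleN1r addNr frac0.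
Qed.
HB.instance Definition _ := GRing.isZmodule.Build fracmod
  frac_addA frac_addC frac_add0 frac_addN.

Fact frac_scaleA r s x : frac_scale r (frac_scale s x) = frac_scale (r * s) x.
Proof. by elim/fracW: x => u n; rewrite !frac_scaleE scalerA. Qed.
Fact frac_scale1 : left_id 1 frac_scale.
Proof. by elim/fracW=> u n; rewrite frac_scaleE scale1r. Qed.
Fact frac_scaleDr : right_distributive frac_scale +%R.
Proof.
move=> r; elim/fracW=> u m; elim/fracW=> v n.
by rewrite /GRing.add /= !(frac_addE, frac_scaleE) scalerDr !scalerAr.
Qed.
Fact frac_scaleDl x : {morph frac_scale^~ x : r s / r + s}.
Proof.
elim/fracW: x => u n r s.
by rewrite [RHS]/GRing.add /= !frac_scaleE frac_addE1 scalerDl.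
Qed.
HB.instance Definition _ := GRing.Zmodule_isLmodule.Build R fracmod
  frac_scaleA frac_scale1 frac_scaleDr frac_scaleDl.

(* Well defined (see [act_frac], [divz_frac]) when z is central. *)
Definition act (a : U) (x : fracmod) : fracmod :=
  frac (a * (repr x).1) (repr x).2.
Definition divz (x : fracmod) : fracmod := frac (repr x).1 (repr x).2.+1.
Definition vac : fracmod := frac 1 0.

Lemma act_frac a u n : (forall b, b * z = z * b) ->
  act a (frac u n) = frac (a * u) n.
Proof.
move=> zC; case: (repr_frac u n); rewrite /act.
case: (repr (frac u n)) => [u' n'] /= p Hp; apply/fracP; exists p => /=.
have aX i w : a * (z ^+ i * w) = z ^+ i * (a * w).
  by rewrite !mulrA; congr (_ * _); exact/commrX/zC.
by have := left_idealM a Hp; rewrite aX mulrBr !aX.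
Qed.

Lemma divz_frac u n : divz (frac u n) = frac u n.+1.
Proof.
case: (repr_frac u n); rewrite /divz.
case: (repr (frac u n)) => [u' n'] /= p Hp; apply/fracP; exists p => /=.
have := left_idealM z Hp.
by rewrite !mulrBr !mulrA -!exprS -!exprD; congr (left_ideal (_ ^+ _ * _ - _ ^+ _ * _)); lia.
Qed.

(* Submodules over U[1/z]. *)
Definition is_submodule (M : fracmod -> Prop) : Prop :=
  [/\ M 0,
      forall x y, M x -> M y -> M (x + y),
      forall a x, M x -> M (act a x) &
      forall x, M x -> M (divz x)].

(* The sum over l in Z of the u_l, applied to v, is w.  For a family whose sum
   converges in the completion of U with respect to the left ideals U F^N, all
   but finitely many u_l annihilate a given v. *)
Definition sum_acts (u : int -> U) (v w : fracmod) : Prop :=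
  exists n0 : nat, forall m n : nat, (n0 <= m)%N -> (n0 <= n)%N ->
    act (\sum_(i < (m + n)%N.+1) u (i%:Z - m%:Z)) v = w.
End Fractions.

(* L is the localization of an R-algebra O isomorphic to R[[t]]: a coordinate
   identifies L with R((t)), and O with R[[t]], m^N with t^N R[[t]]. *)
Record coordinate (R : comNzRingType) (L : comAlgType R) : Type := Coordinate {
  expansion : {lrmorphism L -> laurent R};
  of_laurent : laurent R -> L;
  expansionK : cancel expansion of_laurent;
  of_laurentK : cancel of_laurent expansion }.

Section Disc.
Variables (R : comNzRingType) (L : comAlgType R) (phi : coordinate L).
Implicit Types (f g : L) (D E : L -> L).

Definition coef f (n : int) : R := lcoef (expansion phi f) n.

Definition mpow (N : int) f : Prop := vanishes_below (coef f) N.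

(* For additive maps this is continuity in the m-adic topology. *)
Definition continuous_madic D : Prop :=
  forall N : int, exists M : int, forall f, mpow M f -> mpow N (D f).

Definition tpow (l : int) : L := of_laurent phi (lmono l 1).

Fact lderiv_sub (f : laurent R) :
  exists N, vanishes_below (fun n => lcoef f (n + 1) *~ (n + 1)) N.
Proof.
case: (lcoefP f) => a Ha; exists (a - 1) => n na.
by rewrite Ha ?mul0rz //; lia.
Qed.
Definition ddt f : L := of_laurent phi (Laurent (lderiv_sub (expansion phi f))).

(* The residue of the differential f dt. *)
Definition res f : R := coef f (- 1).

Fact ltrunc_sub (l : int) (f : laurent R) :
  exists N, vanishes_below (fun n => if n <= l then lcoef f n else 0) N.
Proof. by case: (lcoefP f) => a Ha; exists a => n /Ha ->; rewrite if_same. Qed.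
Definition trunc_le (l : int) f : L :=
  of_laurent phi (Laurent (ltrunc_sub l (expansion phi f))).

(* D r for r in R and D a derivation of L preserving R. *)
Definition anchor D (r : R) : R := coef (D r%:A) 0.

Definition commutator D E : L -> L := fun f => D (E f) - E (D f).

(* The value of D at the differential g dt. *)
Definition pairing D g : L := g * D (tpow 1).

Lemma coef_tD f g n : coef (f + g) n = coef f n + coef g n.
Proof. by rewrite /coef raddfD. Qed.
Lemma coef_tN f n : coef (- f) n = - coef f n.
Proof. by rewrite /coef raddfN. Qed.
Lemma coef_tZ r f n : coef (r *: f) n = r * coef f n.
Proof. by rewrite /coef linearZ. Qed.
Lemma coef_t0 n : coef 0 n = 0.
Proof. by rewrite /coef raddf0. Qed.

Lemma mpow0 N : mpow N 0.
Proof. by move=> n _; rewrite coef_t0. Qed.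
Lemma mpowD N f g : mpow N f -> mpow N g -> mpow N (f + g).
Proof. by move=> Hf Hg n nN; rewrite coef_tD Hf ?Hg ?addr0. Qed.
Lemma mpowN N f : mpow N f -> mpow N (- f).
Proof. by move=> Hf n nN; rewrite coef_tN Hf ?oppr0. Qed.
Lemma mpowZ N r f : mpow N f -> mpow N (r *: f).
Proof. by move=> Hf n nN; rewrite coef_tZ Hf ?mulr0. Qed.
Lemma mpowW N M f : M <= N -> mpow N f -> mpow M f.
Proof. by move=> MN Hf n nM; apply: Hf; exact: lt_le_trans MN. Qed.

Lemma continuous_madic_lin r D E :
  continuous_madic D -> continuous_madic E ->
  continuous_madic (fun f => r *: D f + E f).
Proof.
move=> cD cE N; case: (cD N) (cE N) => [a Ha] [b Hb].
exists (Num.max a b) => f Hf.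
apply: mpowD; first by apply/mpowZ/Ha/(mpowW _ Hf); rewrite le_max lexx.
by apply/Hb/(mpowW _ Hf); rewrite le_max lexx orbT.
Qed.

Lemma continuous_madic_comm D E :
  continuous_madic D -> continuous_madic E -> continuous_madic (commutator D E).
Proof.
move=> cD cE N; case: (cD N) (cE N) => [a Ha] [b Hb].
case: (cE a) (cD b) => [a' Ha'] [b' Hb'].
exists (Num.max a' b') => f Hf.
apply: mpowD; first by apply/Ha/Ha'/(mpowW _ Hf); rewrite le_max lexx.
by apply/mpowN/Hb/Hb'/(mpowW _ Hf); rewrite le_max lexx orbT.
Qed.
End Disc.

Section Derivations.
Variables (k : fieldType) (R : comAlgType k) (L : comAlgType R).
Variable phi : coordinate L.
Implicit Types (D E : L -> L).

Definition is_k_derivation_of_R (d : R -> R) : Prop :=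
  [/\ forall r s, d (r + s) = d r + d s,
      forall (a : k) r, d (a *: r) = a *: d r &
      forall r s, d (r * s) = d r * s + r * d s].

(* k acts on L through k -> R. *)
Definition is_theta_LR D : Prop :=
  [/\ forall f g, D (f + g) = D f + D g,
      forall (a : k) f, D ((a%:A : R) *: f) = (a%:A : R) *: D f,
      forall f g, D (f * g) = D f * g + f * D g,
      continuous_madic phi D &
      forall r : R, exists s : R, D r%:A = s%:A].

Definition is_theta D : Prop :=
  [/\ forall f g, D (f + g) = D f + D g,
      forall (r : R) f, D (r *: f) = r *: D f,
      forall f g, D (f * g) = D f * g + f * D g &
      continuous_madic phi D].

Definition theta_LR_pred : {pred L -> L} := fun D => `[< is_theta_LR D >].
Definition theta_pred : {pred L -> L} := fun D => `[< is_theta D >].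

Lemma lin_fctE (r : R) D E f : (r *: D + E) f = r *: D f + E f.
Proof. by []. Qed.

Fact theta_LR_lin r D E : is_theta_LR D -> is_theta_LR E -> is_theta_LR (r *: D + E).
Proof.
move=> [D1 D2 D3 D4 D5] [E1 E2 E3 E4 E5]; split.
- by move=> f g; rewrite !lin_fctE D1 E1 scalerDr addrACA.
- by move=> a f; rewrite !lin_fctE D2 E2 scalerDr !scalerA mulrC.
- move=> f g; rewrite !lin_fctE D3 E3 scalerDr mulrDl mulrDr -scalerAl -scalerAr.
  by rewrite addrACA.
- exact: continuous_madic_lin.
- move=> s; rewrite lin_fctE; case: (D5 s) (E5 s) => [u ->] [v ->].
  by exists (r * u + v); rewrite scalerDl scalerA.
Qed.

Fact theta_lin r D E : is_theta D -> is_theta E -> is_theta (r *: D + E).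
Proof.
move=> [D1 D2 D3 D4] [E1 E2 E3 E4]; split.
- by move=> f g; rewrite !lin_fctE D1 E1 scalerDr addrACA.
- by move=> a f; rewrite !lin_fctE D2 E2 scalerDr !scalerA mulrC.
- move=> f g; rewrite !lin_fctE D3 E3 scalerDr mulrDl mulrDr -scalerAl -scalerAr.
  by rewrite addrACA.
- exact: continuous_madic_lin.
Qed.

Fact theta_LR0 : is_theta_LR 0.
Proof.
split=> [f g|a f|f g|N|r] /=; rewrite ?addr0 ?scaler0 ?mul0r ?mulr0 ?addr0 //.
  by exists 0 => f _; exact: mpow0.
by exists 0; rewrite scale0r.
Qed.

Fact theta0 : is_theta 0.
Proof.
split=> [f g|a f|f g|N] /=; rewrite ?addr0 ?scaler0 ?mul0r ?mulr0 ?addr0 //.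
by exists 0 => f _; exact: mpow0.
Qed.

Fact theta_LR_submod : submod_closed theta_LR_pred.
Proof.
split; first exact/asboolP/theta_LR0.
by move=> r D E /asboolP HD /asboolP HE; exact/asboolP/theta_LR_lin.
Qed.
Fact theta_submod : submod_closed theta_pred.
Proof.
split; first exact/asboolP/theta0.
by move=> r D E /asboolP HD /asboolP HE; exact/asboolP/theta_lin.
Qed.

HB.instance Definition _ :=
  GRing.isSubmodClosed.Build R (L -> L) theta_LR_pred theta_LR_submod.
HB.instance Definition _ :=
  GRing.isSubmodClosed.Build R (L -> L) theta_pred theta_submod.

Record theta_LR : Type := ThetaLR {
  theta_LR_val :> L -> L; theta_LR_valP : theta_LR_val \in theta_LR_pred }.
HB.instance Definition _ := [isSub for theta_LR_val].
HB.instance Definition _ := [Choice of theta_LR by <:].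
HB.instance Definition _ := [SubChoice_isSubLmodule of theta_LR by <:].

Record theta : Type := Theta {
  theta_val :> L -> L; theta_valP : theta_val \in theta_pred }.
HB.instance Definition _ := [isSub for theta_val].
HB.instance Definition _ := [Choice of theta by <:].
HB.instance Definition _ := [SubChoice_isSubLmodule of theta by <:].

Fact theta_LR_comm (D E : theta_LR) : commutator D E \in theta_LR_pred.
Proof.
case: D E => [D /asboolP[D1 D2 D3 D4 D5]] [E /asboolP[E1 E2 E3 E4 E5]] /=.
apply/asboolP; rewrite /commutator; split.
- by move=> f g; rewrite !(D1, E1) opprD addrACA.
- by move=> a f; rewrite !(D2, E2) scalerBr.
- by move=> f g; rewrite !(D3, E3, D1, E1); ring.
- exact: continuous_madic_comm.
- move=> r; case: (D5 r) (E5 r) => [u Du] [v Ev].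
  case: (D5 v) (E5 u) => [u' Du'] [v' Ev'].
  by exists (u' - v'); rewrite Du Ev Du' Ev' scalerBl.
Qed.

Fact theta_comm (D E : theta) : commutator D E \in theta_pred.
Proof.
case: D E => [D /asboolP[D1 D2 D3 D4]] [E /asboolP[E1 E2 E3 E4]] /=.
apply/asboolP; rewrite /commutator; split.
- by move=> f g; rewrite !(D1, E1) opprD addrACA.
- by move=> a f; rewrite !(D2, E2) scalerBr.
- by move=> f g; rewrite !(D3, E3, D1, E1); ring.
- exact: continuous_madic_comm.
Qed.

Definition theta_LR_bracket (D E : theta_LR) : theta_LR :=
  ThetaLR (theta_LR_comm D E).
Definition theta_bracket (D E : theta) : theta := Theta (theta_comm D E).

Fact theta_sub_LR (D : theta) : theta_val D \in theta_LR_pred.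
Proof.
have /asboolP[D1 D2 D3 D4] := theta_valP D; apply/asboolP; split=> // r.
have D0 : theta_val D 1 = 0.
  by apply: (addIr (theta_val D 1)); rewrite add0r -{3}(mulr1 1) D3 mulr1 mul1r.
by exists 0; rewrite D2 D0 scaler0 scale0r.
Qed.
Definition theta_incl (D : theta) : theta_LR := ThetaLR (theta_sub_LR D).

(* With D = \sum_m a_m D_m and E = \sum_n b_n D_n, where
   a_m = coef (D t) (m + 1), this is \sum_m (m^3 - m)/12 a_m b_(-m). *)
Definition virasoro_cocycle (D E : theta) : R :=
  \sum_(m \in [set: int])
    ((((m ^+ 3 - m)%:~R / 12%:R : k)%:A : R)
      * coef phi (D (tpow phi 1)) (m + 1) * coef phi (E (tpow phi 1)) (1 - m)).

(* (D, r) stands for D^ + r c_0. *)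
Definition theta_hat : Type := (theta * R^o)%type.
HB.instance Definition _ := GRing.Lmodule.on theta_hat.
Definition theta_hat_bracket (x y : theta_hat) : theta_hat :=
  (theta_bracket x.1 y.1, virasoro_cocycle x.1 y.1).

(* Brackets on extensions of theta_LR satisfy
   [x, r y] = r [x, y] + (D r) y for x over D, as in theta_LR itself, so
   it is c_0 (and not every r c_0) that commutes with everything. *)
Record theta_hat_LR_extension : Type := {
  ext_car :> lmodType R;
  ext_bracket : ext_car -> ext_car -> ext_car;
  ext_c0 : ext_car;
  ext_proj : {linear ext_car -> theta_LR};
  ext_incl : {linear theta_hat -> ext_car};
  ext_bracketDl : forall x y z,
    ext_bracket (x + y) z = ext_bracket x z + ext_bracket y z;
  ext_bracketDr : forall x y z,
    ext_bracket x (y + z) = ext_bracket x y + ext_bracket x z;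
  ext_bracketxx : forall x, ext_bracket x x = 0;
  ext_jacobi : forall x y z,
    ext_bracket x (ext_bracket y z) + ext_bracket y (ext_bracket z x)
      + ext_bracket z (ext_bracket x y) = 0;
  ext_leibniz : forall x (r : R) y,
    ext_bracket x (r *: y)
      = r *: ext_bracket x y + anchor phi (ext_proj x) r *: y;
  ext_proj_bracket : forall x y,
    ext_proj (ext_bracket x y) = theta_LR_bracket (ext_proj x) (ext_proj y);
  ext_proj_surj : forall D : theta_LR, exists x, ext_proj x = D;
  ext_proj_ker : forall x, ext_proj x = 0 <-> exists r : R, x = r *: ext_c0;
  ext_c0_free : forall r : R, r *: ext_c0 = 0 -> r = 0;
  ext_c0_central : forall x, ext_bracket x ext_c0 = 0;
  ext_incl_bracket : forall x y,
    ext_incl (theta_hat_bracket x y) = ext_bracket (ext_incl x) (ext_incl y);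
  ext_incl_c0 : ext_incl (0, 1) = ext_c0;
  ext_incl_proj : forall x, ext_proj (ext_incl x) = theta_incl x.1 }.

(* theta_hat_LR / theta_hat = theta_LR / theta = theta_R *)
Definition extension_quotient (E : theta_hat_LR_extension) : Prop :=
  [/\ forall x : E, (exists y, x = ext_incl E y) <->
        (exists D : theta, ext_proj E x = theta_incl D),
      forall D : theta_LR, (exists D' : theta, D = theta_incl D') <->
        anchor phi D =1 (fun=> 0),
      forall D : theta_LR, is_k_derivation_of_R (anchor phi D) &
      forall d : R -> R, is_k_derivation_of_R d ->
        exists D : theta_LR, anchor phi D =1 d].

(* Representations by k-linear endomorphisms, R-linear in the first variable. *)
Record is_representation (E : theta_hat_LR_extension) (F : lmodType R)
    (T : E -> F -> F) : Prop := {
  rep_linear : forall (r : R) x y v, T (r *: x + y) v = r *: T x v + T y v;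
  rep_additive : forall x v w, T x (v + w) = T x v + T x w;
  rep_k_linear : forall x (a : k) v,
    T x ((a%:A : R) *: v) = (a%:A : R) *: T x v;
  rep_bracket : forall x y v,
    T (ext_bracket x y) v = T x (T y v) - T y (T x v) }.
End Derivations.

Section NormalOrdering.
Variables (R : comNzRingType) (L : comAlgType R) (phi : coordinate L).

(* : j(f) o j(t^l) : extended R-linearly and continuously from f = t^n. *)
Definition normal_order (U : algType R) (j : L -> U) (f : L) (l : int) : U :=
  j (trunc_le phi l f) * j (tpow phi l)
    + j (tpow phi l) * j (f - trunc_le phi l f).

Definition quadratic_term (U : algType R) (j : L -> U) (D : L -> L) (l : int) : U :=
  normal_order j (pairing phi D (tpow phi (- l - 1))) l.

Definition coefficientwise (d : R -> R) (f f' : L) : Prop :=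
  forall n, coef phi f' n = d (coef phi f n).
End NormalOrdering.

Section Oscillator.
Variables (k : fieldType) (R : comAlgType k) (L : comAlgType R).
Variable phi : coordinate L.

(* (f, r) stands for f + r hbar. *)
Definition osc : Type := (L * R^o)%type.
HB.instance Definition _ := GRing.Lmodule.on osc.
Definition osc_bracket (x y : osc) : osc := (0, res phi (y.1 * ddt phi x.1)).

Definition osc_env : algType R := uea osc_bracket.
Definition osc_in (f : L) : osc_env := ugen osc_bracket (f, 0).
Definition hbar : osc_env := ugen osc_bracket (0, 1).

Definition osc_m (u : osc_env) : Prop := exists2 f, mpow phi 1 f & u = osc_in f.
Definition osc_fock : lmodType R := fracmod osc_m hbar.
Definition osc_act : osc_env -> osc_fock -> osc_fock := act (S := osc_m) (z := hbar).
Definition div_hbar : osc_fock -> osc_fock := divz (S := osc_m) (z := hbar).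

(* w = T(D^) v *)
Definition osc_rep (D : theta phi) (v w : osc_fock) : Prop :=
  exists2 v', sum_acts (S := osc_m) (z := hbar) (quadratic_term phi osc_in D) v v'
            & w = - (((2%:R^-1 : k)%:A : R) *: div_hbar v').

(* N applies the k-derivation d of R to the coefficients of the elements
   t^(n_1) o ... o t^(n_s) / hbar^p, which span the R-module F.  There is
   exactly one such N; for d = 0 it is 0. *)
Record is_osc_horizontal (d : R -> R) (N : osc_fock -> osc_fock) : Prop := {
  osc_horD : forall v w, N (v + w) = N v + N w;
  osc_horZ : forall (r : R) v, N (r *: v) = d r *: v + r *: N v;
  osc_hor_vac : N (vac osc_m hbar) = 0;
  osc_hor_act : forall f f' v, coefficientwise phi d f f' ->
    N (osc_act (osc_in f) v) = osc_act (osc_in f') v + osc_act (osc_in f) (N v);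
  osc_hor_hbar : forall v, N (osc_act hbar v) = osc_act hbar (N v);
  osc_hor_div : forall v, N (div_hbar v) = div_hbar (N v) }.

(* The relation [T(D^), r] = D r is incompatible with T(D^) preserving every
   submodule: J F, with J an ideal of R, can be preserved only if D J lies in
   J.  With d = D restricted to R, the condition below is what is needed; it
   is void when D lies in theta. *)
Definition osc_stable (d : R -> R) (M : osc_fock -> Prop) : Prop :=
  forall N, is_osc_horizontal d N -> forall v, M v -> M (N v).
End Oscillator.

Section SimpleLie.
Variables (k : fieldType) (g : vectType k) (br : g -> g -> g).

Definition is_lie_bracket : Prop :=
  [/\ forall (a : k) x y z, br (a *: x + y) z = a *: br x z + br y z,
      forall (a : k) x y z, br z (a *: x + y) = a *: br z x + br z y,
      forall x, br x x = 0 &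
      forall x y z, br x (br y z) + br y (br z x) + br z (br x y) = 0].

Definition is_simple_lie : Prop :=
  (exists x y, br x y != 0) /\
  forall I : {vspace g}, (forall x y, y \in I -> br x y \in I) ->
    I = 0%VS \/ I = fullv.

Definition is_invariant_form (B : g -> g -> k) : Prop :=
  [/\ forall (a : k) x y z, B (a *: x + y) z = a * B x z + B y z,
      forall x y, B x y = B y x &
      forall x y z, B (br x y) z = B x (br y z)].

Definition is_weight_vector (h : {vspace g}) (alpha : g -> k) (x : g) : Prop :=
  forall y, y \in h -> br y x = alpha y *: x.

Definition is_split_cartan (h : {vspace g}) : Prop :=
  [/\ forall x y, x \in h -> y \in h -> br x y = 0,
      forall x, (forall y, y \in h -> br y x = 0) -> x \in h &
      exists2 e : (\dim {:g}).-tuple g, basis_of fullv e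
        & forall i, exists alpha, is_weight_vector h alpha (tnth e i)].

(* a is the coroot of the root alpha: a = [e, f] with e, f root vectors of
   weights alpha and - alpha and alpha(a) = 2. *)
Definition is_coroot (h : {vspace g}) (a : g) : Prop :=
  exists (alpha : g -> k) (e f : g),
    [/\ is_weight_vector h alpha e, is_weight_vector h (fun y => - alpha y) f,
        br e f = a, a \in h & alpha a = 2%:R /\ e != 0].

(* The squared lengths of coroots are positive rational multiples of each
   other, so they can be compared even though k is not ordered. *)
Definition is_small_coroot (h : {vspace g}) (B : g -> g -> k) (a : g) : Prop :=
  is_coroot h a /\
  forall b, is_coroot h b -> exists2 q : rat, 1 <= q & B b b = ratr q * B a a.

Definition is_normalized_form (h : {vspace g}) (B : g -> g -> k) : Prop :=
  is_invariant_form B /\ forall a, is_small_coroot h B a -> B a a = 2%:R.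

Definition is_orthonormal_basis (B : g -> g -> k)
    (X : (\dim {:g}).-tuple g) : Prop :=
  basis_of fullv X /\ forall i j, B (tnth X i) (tnth X j) = (i == j)%:R.
End SimpleLie.

Section Sugawara.
Variables (k : fieldType) (R : comAlgType k) (L : comAlgType R).
Variable phi : coordinate L.
Variables (g : vectType k) (br : g -> g -> g) (B : g -> g -> k) (h : k).

(* g (x)_k L, in coordinates with respect to the basis [vbasis fullv] of g. *)
Definition loop : Type := {ffun 'I_(\dim {:g}) -> L}.
HB.instance Definition _ := GRing.Lmodule.on loop.
Definition loop_basis (i : 'I_(\dim {:g})) : g := (vbasis {:g})`_i.
Definition tens (x : g) (f : L) : loop :=
  [ffun i => ((coord (vbasis {:g}) i x)%:A : R) *: f].
Definition loop_bracket (u v : loop) : loop :=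
  \sum_i \sum_j tens (br (loop_basis i) (loop_basis j)) (u i * v j).
Definition loop_cocycle (u v : loop) : R :=
  \sum_i \sum_j
    B (loop_basis i) (loop_basis j) *: res phi (v j * ddt phi (u i)).

(* (u, r) stands for u + r c. *)
Definition affine : Type := (loop * R^o)%type.
HB.instance Definition _ := GRing.Lmodule.on affine.
Definition affine_bracket (x y : affine) : affine :=
  (loop_bracket x.1 y.1, loop_cocycle x.1 y.1).

Definition aff_env : algType R := uea affine_bracket.
Definition aff_in (x : g) (f : L) : aff_env := ugen affine_bracket (tens x f, 0).
Definition aff_c : aff_env := ugen affine_bracket (0, 1).
Definition aff_ch : aff_env := aff_c + (h%:A : R)%:A.

Definition aff_F1 (w : aff_env) : Prop :=
  exists2 u : loop, (forall i, mpow phi 1 (u i)) & w = ugen affine_bracket (u, 0).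
Definition aff_fock : lmodType R := fracmod aff_F1 aff_ch.
Definition aff_act : aff_env -> aff_fock -> aff_fock :=
  act (S := aff_F1) (z := aff_ch).
Definition div_ch : aff_fock -> aff_fock := divz (S := aff_F1) (z := aff_ch).

(* w = T_g(D^) v *)
Definition sugawara_rep (X : (\dim {:g}).-tuple g) (D : theta phi)
    (v w : aff_fock) : Prop :=
  exists2 v', sum_acts (S := aff_F1) (z := aff_ch)
      (fun l => \sum_i quadratic_term phi (aff_in (tnth X i)) D l) v v'
    & w = - (((2%:R^-1 : k)%:A : R) *: div_ch v').

(* As [is_osc_horizontal], for the elements
   X_1 t^(n_1) o ... o X_s t^(n_s) o c^q / (c + h)^p. *)
Record is_aff_horizontal (d : R -> R) (N : aff_fock -> aff_fock) : Prop := {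
  aff_horD : forall v w, N (v + w) = N v + N w;
  aff_horZ : forall (r : R) v, N (r *: v) = d r *: v + r *: N v;
  aff_hor_vac : N (vac aff_F1 aff_ch) = 0;
  aff_hor_act : forall x f f' v, coefficientwise phi d f f' ->
    N (aff_act (aff_in x f) v) = aff_act (aff_in x f') v + aff_act (aff_in x f) (N v);
  aff_hor_c : forall v, N (aff_act aff_c v) = aff_act aff_c (N v);
  aff_hor_div : forall v, N (div_ch v) = div_ch (N v) }.

Definition aff_stable (d : R -> R) (M : aff_fock -> Prop) : Prop :=
  forall N, is_aff_horizontal d N -> forall v, M v -> M (N v).
End Sugawara.

(* Main.v *)
(* With respect to the coordinate t, every D in theta_LR is the sum of the
   vertical derivation (D t) d/dt and of the horizontal lift of its restriction
   to R, which acts on coefficients.  So theta_hat_LR is theta_LR + R c_0 with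
   the residue cocycle res ((D t)''' (E t)) / 12 and with R acted upon through
   the anchor; its cocycle identity reduces to the residue of the derivative of
   a Wronskian.

   On a Fock module the normally ordered sum is exactly
     Q_A = sum_(l >= 0) sum_a J_a(t^(-l-1) A) J_a(t^l) + J_a(t^(-l-1)) J_a(t^l A),
   A = D t.  Such sums are contractions of a bilinear kernel s(p, q) along the
   residue pairing; moving a factor t^m from one argument to the other changes
   them by a finite sum.  An R-linear function of a Laurent series that kills
   m^N for some N vanishes as soon as it kills the powers of t, so that
   [Q_A, J_b(g)] and [T(D), Q_B] are computed for g = t^m and A = t^n, and there
   only finite sums remain.  A derivation of R acts on the Fock module through a
   derivation of the enveloping algebra, and the representation is the sum of
   the vertical Sugawara operator, of this operator and of the central charge.
   The oscillator case is the Sugawara case of an abelian Lie algebra of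
   dimension 1 with dual Coxeter number 0. *)

Require Import Defs.
From HB Require Import structures.
From mathcomp Require Import all_boot all_order all_algebra.
From mathcomp Require Import boolp classical_sets functions cardinality fsbigop.
From mathcomp Require Import ssrAC zify ring.
Set Implicit Arguments.
Unset Strict Implicit.
Unset Printing Implicit Defensive.
Import Order.TTheory GRing.Theory Num.Theory.
Local Open Scope ring_scope.

(** Each half of [Q_A] is a finite sum on a given vector only because the deeper factor acts first,
    so terms cannot be exchanged freely between the halves. Every move of a power of t leaves a
    finite oriented sum, and these boundary sums carry the content. For g = t^m the structure
    constants leave m equal terms [-2h J_b(t^(m-1) A)]. The central terms of the mode commutators
    recombine across the two halves, by the expansion of a series in residues, to [-2c J_b(A g')].
    Hence [[Q_A, J_b(g)] = -2 (c + h) J_b(A g')], which explains the prefactor [-1/(2 (c + h))]. In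
    the bracket of two operators the boundary sum is that of l (n - 1 - l) over 0 <= l < n, that is
    n (n - 1) (n - 2) / 6: this is the third derivative of t^n up to 1/6, and with the factor 1/2 of
    T it yields the constant 1/12. A derivation that moves R is not R-linear; reduction to powers of
    t is then applied to a difference in which the terms (d r) f cancel. *)

Lemma int_step_ind (P : int -> Prop) :
  P 0 -> (forall n, P n <-> P (n + 1)) -> forall n, P n.
Proof.
move=> P0 PS; case=> m.
  by elim: m => // m IH; rewrite -addn1 PoszD -PS.
elim: m => [|m IH]; apply/PS; first by rewrite NegzE addNr.
by rewrite (_ : Negz m.+1 + 1 = Negz m) // !NegzE; lia.
Qed.

(** * Oriented sums over the integers *)

Section IntSums.
Variable V : zmodType.
Implicit Types (G H : int -> V) (n : int).

(* The oriented sum of G over 0 <= l < n; for n < 0 it is minus the sum over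
   n <= l < 0. *)
Definition isum n G : V :=
  match n with
  | Posz m => \sum_(i < m) G i
  | Negz m => - \sum_(i < m.+1) G (- i.+1%:Z)
  end.

Lemma isum0 G : isum 0 G = 0. Proof. exact: big_ord0. Qed.

Lemma isumS n G : isum (n + 1) G = isum n G + G n.
Proof.
case: n => m; first by rewrite -PoszD addn1 /= big_ord_recr.
case: m => [|m].
  by rewrite (_ : Negz 0 + 1 = 0) // isum0 /= big_ord1 NegzE addNr.
rewrite (_ : Negz m.+1 + 1 = Negz m); last by rewrite !NegzE; lia.
by rewrite /= [in RHS]big_ord_recr /= opprD NegzE addrNK.
Qed.

Lemma isum_pred n G : isum n G = isum (n - 1) G + G (n - 1).
Proof. by rewrite -isumS subrK. Qed.

Lemma eq_isum n G H : (forall l, G l = H l) -> isum n G = isum n H.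
Proof. by move=> /funext->. Qed.

Lemma isumD n G H : isum n (fun l => G l + H l) = isum n G + isum n H.
Proof. by case: n => m /=; rewrite big_split //= opprD. Qed.

Lemma isumSl n G : isum (n + 1) G = G 0 + isum n (fun l => G (l + 1)).
Proof.
elim/int_step_ind: n => [|n]; first by rewrite isumS !isum0 add0r addr0.
rewrite [isum (n + 1 + 1) G]isumS (isumS n (fun l => G (l + 1))) addrA.
(* The step is an equivalence: read from right to left, by cancelling the added term, it is the
   induction towards negative n. *)
by split=> [->//|/addIr].
Qed.

Lemma isum_rev n G : isum n (fun l => G (n - 1 - l)) = isum n G.
Proof.
elim/int_step_ind: n => [|n]; first by rewrite !isum0.
rewrite [isum (n + 1) G]isumS isumSl [RHS in _ <-> _ = RHS]addrC.
rewrite (_ : G (n + 1 - 1 - 0) = G n); last by congr G; lia.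
rewrite (@eq_isum n (fun l => G (n + 1 - 1 - (l + 1))) (fun l => G (n - 1 - l))).
  by split=> [->//|/addrI].
by move=> l; congr G; lia.
Qed.

Lemma isum_const n (x : V) : isum n (fun=> x) = x *~ n.
Proof.
elim/int_step_ind: n => [|n]; first by rewrite isum0 mulr0z.
by rewrite isumS mulrzDr mulr1z; split=> [->//|/addIr].
Qed.

Definition finite_above G : Prop := exists N : int, forall l, N <= l -> G l = 0.

(* The sum of G over l >= 0; 0 by convention when it is infinite. *)
Definition tsum G : V := \sum_(i \in [set: nat]) G i%:Z.

Lemma tsumE (N : nat) G : (forall l : int, N%:Z <= l -> G l = 0) ->
  tsum G = \sum_(i < N) G i%:Z.
Proof.
move=> GN; rewrite /tsum (fsbigE (index_iota 0 N)) ?iota_uniq //; first last.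
  by move=> i _; rewrite mem_index_iota -leqNgt => Ni; rewrite GN // lez_nat.
by rewrite big_mkcond /= big_mkord; apply: eq_bigr => i _; rewrite in_setT.
Qed.

Lemma finite_aboveP G : finite_above G ->
  exists N : nat, forall M : nat, (N <= M)%N -> forall l : int, M%:Z <= l -> G l = 0.
Proof. by case=> N GN; exists `|N|%N => M NM l Ml; apply: GN; lia. Qed.

Lemma eq_tsum G H : (forall l : nat, G l = H l) -> tsum G = tsum H.
Proof. by move=> GH; apply: eq_fsbigr => i _; exact: GH. Qed.

Lemma tsum_eq0 G : (forall l : nat, G l = 0) -> tsum G = 0.
Proof. by move=> G0; apply: fsbig1 => i _; exact: G0. Qed.

Lemma finite_aboveD G H : finite_above G -> finite_above H ->
  finite_above (fun l => G l + H l).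
Proof.
case=> a Ga [b Hb]; exists (Num.max a b) => l.
by rewrite ge_max => /andP[/Ga-> /Hb->]; rewrite addr0.
Qed.

Lemma tsumD G H : finite_above G -> finite_above H ->
  tsum (fun l => G l + H l) = tsum G + tsum H.
Proof.
move=> /finite_aboveP[a Ga] /finite_aboveP[b Hb]; pose N := maxn a b.
have {}Ga := Ga N (leq_maxl _ _); have {}Hb := Hb N (leq_maxr _ _).
rewrite (tsumE Ga) (tsumE Hb) (@tsumE N) ?big_split // => l Nl.
by rewrite Ga ?Hb ?addr0.
Qed.

Lemma finite_aboveN G : finite_above G -> finite_above (fun l => - G l).
Proof. by case=> a Ga; exists a => l /Ga ->; rewrite oppr0. Qed.

Lemma tsumN G : finite_above G -> tsum (fun l => - G l) = - tsum G.
Proof.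
move=> fG; apply/eqP; rewrite -addr_eq0 -tsumD //; last exact: finite_aboveN.
by apply/eqP/tsum_eq0 => l; rewrite addNr.
Qed.

Lemma finite_aboveB G H : finite_above G -> finite_above H ->
  finite_above (fun l => G l - H l).
Proof. by move=> fG fH; apply/finite_aboveD/finite_aboveN. Qed.

Lemma tsumB G H : finite_above G -> finite_above H ->
  tsum (fun l => G l - H l) = tsum G - tsum H.
Proof. by move=> fG fH; rewrite -tsumN //; apply/tsumD/finite_aboveN. Qed.

Lemma tsumSl G : finite_above G -> tsum G = G 0 + tsum (fun l => G (l + 1)).
Proof.
move=> /finite_aboveP[N GN]; have GS := GN N.+1 (leqnSn N).
rewrite (tsumE GS) (@tsumE N) => [|l Nl]; last by apply: GS; lia.
rewrite big_ord_recl; congr (_ + _); apply: eq_bigr => i _; congr G.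
by rewrite /= /bump /=; lia.
Qed.

Lemma finite_above_shift n G : finite_above G -> finite_above (fun l => G (l + n)).
Proof. by case=> N GN; exists (N - n) => l Nl; apply: GN; lia. Qed.

(** Valid for n of either sign: for n < 0 the oriented sum removes the terms that the shift adds
    below 0. *)
Lemma tsum_shift n G : finite_above G ->
  tsum G = isum n G + tsum (fun l => G (l + n)).
Proof.
move=> fG; elim/int_step_ind: n => [|n].
  by rewrite isum0 add0r; apply: eq_tsum => l; rewrite addr0.
rewrite isumS (tsumSl (finite_above_shift n fG)) add0r -addrA.
rewrite (@eq_tsum (fun l => G (l + 1 + n)) (fun l => G (l + (n + 1)))) //.
by move=> l; congr G; lia.
Qed.
End IntSums.

Lemma tsum_morph (V W : zmodType) (f : V -> W) G : f 0 = 0 -> {morph f : x y / x + y} ->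
  finite_above G -> f (tsum G) = tsum (fun l => f (G l)).
Proof.
move=> f0 fD /finite_aboveP[N GN]; have {}GN := GN N (leqnn N).
rewrite (tsumE GN) (@tsumE _ N) => [|l Nl]; last by rewrite GN.
by rewrite (big_morph f fD f0).
Qed.

Lemma isum_morph (V W : zmodType) (f : V -> W) n G : f 0 = 0 ->
  {morph f : x y / x + y} -> f (isum n G) = isum n (fun l => f (G l)).
Proof.
move=> f0 fD; elim/int_step_ind: n => [|n]; first by rewrite !isum0.
by rewrite !isumS fD; split=> [->//|/addIr].
Qed.

(** The factor 6 keeps the identity in the integers. With n - 1 for n and x = n - 1 the right side
    is n (n - 1) (n - 2), the coefficient of the third derivative of t^n; this is the origin of the
    Virasoro cubic. *)
Lemma isum_quadratic (n x : int) :
  isum n (fun l => l * (x - l)) * 6 = (n * (n - 1)) * (3 * x - 2 * n + 1).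
Proof.
elim/int_step_ind: n => [|n]; first by rewrite isum0; ring.
rewrite isumS [(_ + _) * 6]mulrDl; split=> [->|H]; first by ring.
by apply: (addIr (n * (x - n) * 6)); rewrite H; ring.
Qed.

(** * Laurent series *)

Section LaurentCalculus.
Variables (R : comNzRingType) (L : comAlgType R) (phi : coordinate L).
Implicit Types (f g : L) (l m n N : int).
Local Notation "'t^ n" := (tpow phi n) (at level 2, n at level 2, format "''t^' n").
Local Notation coef := (coef phi).
Local Notation ddt := (ddt phi).
Local Notation res := (res phi).
Local Notation mpow := (mpow phi).

Lemma coef_inj f g : (forall n, coef f n = coef g n) -> f = g.
Proof. by move=> E; apply: (can_inj (expansionK phi)); apply: laurentP. Qed.

Lemma mpow_bound f : exists N, mpow N f.
Proof. exact: lcoefP. Qed.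

Lemma coef_tpow l n : coef 't^l n = (n == l)%:R.
Proof. by rewrite /Defs.coef /tpow of_laurentK. Qed.

Lemma expansionM f g : expansion phi (f * g) = expansion phi f * expansion phi g.
Proof. exact: rmorphM. Qed.

Lemma mpowM a b f g : mpow a f -> mpow b g -> mpow (a + b) (f * g).
Proof. by move=> fa gb; rewrite /Defs.mpow /Defs.coef expansionM; exact: lconv_below. Qed.

Lemma coef_tpowM l f n : coef ('t^l * f) n = coef f (n - l).
Proof.
rewrite /Defs.coef expansionM /tpow of_laurentK lcoefM (fsbigE [:: l]) //.
  by rewrite big_mkcond big_seq1 in_setT lcoef_mono eqxx mul1r.
by move=> i _; rewrite inE lcoef_mono => /negbTE->; rewrite mul0r.
Qed.

Lemma tpow0 : 't^0 = 1.
Proof. by apply: coef_inj => n; rewrite /Defs.coef /tpow of_laurentK rmorph1. Qed.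

Lemma tpowD l m : 't^(l + m) = 't^l * 't^m.
Proof.
apply: coef_inj => n; rewrite coef_tpowM !coef_tpow; congr (_%:R).
by apply/eqP/eqP; lia.
Qed.

Lemma tpowM l m f : 't^l * ('t^m * f) = 't^(l + m) * f.
Proof. by rewrite tpowD mulrA. Qed.

Lemma mpow_tpowM l N f : mpow N f -> mpow (l + N) ('t^l * f).
Proof. by move=> H n nN; rewrite coef_tpowM H //; lia. Qed.

Lemma mpow_tpow l : mpow l 't^l.
Proof. by move=> n nl; rewrite coef_tpow lt_eqF. Qed.

Lemma coef_ddt f n : coef (ddt f) n = coef f (n + 1) *~ (n + 1).
Proof. by rewrite /Defs.coef /Defs.ddt of_laurentK. Qed.

Lemma coef_trunc_le l f n : coef (trunc_le phi l f) n = if n <= l then coef f n else 0.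
Proof. by rewrite /Defs.coef /trunc_le of_laurentK. Qed.

Fact ddt_linear : linear ddt.
Proof.
move=> r f g; apply: coef_inj => n.
by rewrite coef_tD coef_tZ !coef_ddt coef_tD coef_tZ mulrzDl mulrzAr.
Qed.
HB.instance Definition _ := GRing.isLinear.Build R L L _ ddt ddt_linear.

Lemma ddtMz f n : ddt (f *~ n) = ddt f *~ n. Proof. exact: raddfMz. Qed.

Lemma resD f g : res (f + g) = res f + res g. Proof. exact: coef_tD. Qed.
Lemma resZ r f : res (r *: f) = r * res f. Proof. exact: coef_tZ. Qed.
Lemma resN f : res (- f) = - res f. Proof. exact: coef_tN. Qed.
Lemma res_eq0 N f : mpow N f -> 0 <= N -> res f = 0.
Proof. by move=> fN N0; apply: fN; lia. Qed.
Lemma res_ddt f : res (ddt f) = 0.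
Proof. by rewrite /Defs.res coef_ddt addNr mulr0z. Qed.

Lemma mpow_ddt N f : mpow N f -> mpow (N - 1) (ddt f).
Proof. by move=> H n nN; rewrite coef_ddt H ?mul0rz //; lia. Qed.

Definition linear_fun (F : lmodType R) (Phi : L -> F) : Prop :=
  forall r f g, Phi (r *: f + g) = r *: Phi f + Phi g.

Definition vanishes_deep (F : lmodType R) (Phi : L -> F) : Prop :=
  exists N, forall f, mpow N f -> Phi f = 0.

(** R-linear and continuous for the discrete topology on F, which is enough for the values on the
    powers of t to determine the map. *)
Definition contlin (F : lmodType R) (Phi : L -> F) : Prop :=
  linear_fun Phi /\ vanishes_deep Phi.

Section LinearFun.
Variables (F : lmodType R) (Phi : L -> F).
Hypothesis PhiL : linear_fun Phi.

Lemma linear_fun0 : Phi 0 = 0.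
Proof. by have := PhiL (-1) 0 0; rewrite scaleN1r oppr0 addr0 scaleN1r addNr. Qed.
Lemma linear_funD f g : Phi (f + g) = Phi f + Phi g.
Proof. by have := PhiL 1 f g; rewrite !scale1r. Qed.
Lemma linear_funZ r f : Phi (r *: f) = r *: Phi f.
Proof. by rewrite -[r *: f]addr0 PhiL linear_fun0 addr0. Qed.
Lemma linear_funN f : Phi (- f) = - Phi f.
Proof. by rewrite -(scaleN1r f) linear_funZ scaleN1r. Qed.
Lemma linear_funB f g : Phi (f - g) = Phi f - Phi g.
Proof. by rewrite linear_funD linear_funN. Qed.
Lemma linear_funMz f n : Phi (f *~ n) = Phi f *~ n.
Proof. by rewrite -(scaler_int n f) -(scaler_int n (Phi f)) linear_funZ. Qed.
Lemma linear_fun_sum I (r : seq I) (G : I -> L) :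
  Phi (\sum_(i <- r) G i) = \sum_(i <- r) Phi (G i).
Proof. exact: (big_morph Phi linear_funD linear_fun0). Qed.
End LinearFun.

Section MonomialReduction.
Variable F : lmodType R.
Implicit Types Phi Psi : L -> F.

Lemma monomial_reduction Phi : contlin Phi -> (forall m, Phi 't^m = 0) -> Phi =1 fun=> 0.
Proof.
move=> [PhiL [N PhiN]] Phit f; case: (mpow_bound f) => a fa.
(* The part of f in degrees a to N - 1 (if N < a, some harmless extra terms); the rest f - h lies in
   m^N. *)
pose h := \sum_(i < `|N - a|%N) coef f (a + i%:Z) *: 't^(a + i%:Z).
rewrite -(subrK h f) linear_funD // (linear_fun_sum PhiL) big1 => [|i _].
  rewrite addr0 PhiN // => n nN; rewrite coef_tD coef_tN.
  rewrite (_ : coef h n = \sum_(i < `|N - a|%N) coef f n *+ (n == a + i%:Z)).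
    have [na|an] := ltP n a.
      by rewrite fa // big1 ?subr0 // => i _; rewrite mul0rn.
    have nb : (`|n - a| < `|N - a|)%N by lia.
    rewrite (bigD1 (Ordinal nb)) //= big1 => [|i].
      by rewrite addr0 (_ : n == _) ?subrr //; lia.
    by rewrite -val_eqE /= => ni; rewrite (_ : (n == _) = false) //; lia.
  rewrite /h; elim/big_rec2: _ => [|i y x _ <-]; first by rewrite coef_t0.
  by rewrite coef_tD coef_tZ coef_tpow; case: eqP => [->|_]; rewrite ?mulr1 ?mulr0.
by rewrite linear_funZ // Phit scaler0.
Qed.

Lemma contlinD Phi Psi : contlin Phi -> contlin Psi -> contlin (fun f => Phi f + Psi f).
Proof.
move=> [PhiL [a Pa]] [PsiL [b Pb]]; split.
  by move=> r f g; rewrite PhiL PsiL scalerDr addrACA.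
exists (Num.max a b) => f fN.
by rewrite Pa ?Pb ?addr0 //; apply: mpowW fN; rewrite le_max lexx ?orbT.
Qed.

Lemma contlin_comp (F' : lmodType R) (u : F -> F') Phi :
  (forall r x y, u (r *: x + y) = r *: u x + u y) -> contlin Phi -> contlin (u \o Phi).
Proof.
move=> uL [PhiL [a Pa]]; split=> [r f g|]; first by rewrite /= PhiL uL.
exists a => f /Pa /= ->; have := uL (-1) 0 0.
by rewrite scaler0 addr0 scaleN1r addNr.
Qed.

Lemma contlinN Phi : contlin Phi -> contlin (fun f => - Phi f).
Proof.
by apply: (contlin_comp (u := -%R)) => r x y; rewrite opprD scalerN.
Qed.

Lemma contlinMz Phi n : contlin Phi -> contlin (fun f => Phi f *~ n).
Proof.
by apply: (contlin_comp (u := fun x => x *~ n)) => r x y; rewrite mulrzDl -scalerMzr.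
Qed.

Lemma contlinZ Phi s : contlin Phi -> contlin (fun f => s *: Phi f).
Proof.
by apply: (contlin_comp (u := *:%R s)) => r x y; rewrite scalerDr !scalerA mulrC.
Qed.

Lemma contlinM Phi g : contlin Phi -> contlin (fun f => Phi (g * f)).
Proof.
move=> [PhiL [a Pa]]; split=> [r f f'|]; first by rewrite mulrDr -scalerAr PhiL.
case: (mpow_bound g) => b gb; exists (a - b) => f fN; apply: Pa.
by rewrite -(subrK b a) addrC; exact: mpowM.
Qed.

Lemma contlin_ddt Phi : contlin Phi -> contlin (fun f => Phi (ddt f)).
Proof.
move=> [PhiL [a Pa]]; split=> [r f f'|]; first by rewrite linearP PhiL.
by exists (a + 1) => f /mpow_ddt; rewrite addrK => /Pa.
Qed.

Lemma contlin_sum I (r : seq I) (G : I -> L -> F) : (forall i, contlin (G i)) ->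
  contlin (fun f => \sum_(i <- r) G i f).
Proof.
move=> GC; elim: r => [|i r IH].
  split=> [s f g|]; first by rewrite !big_nil scaler0 addr0.
  by exists 0 => f _; rewrite big_nil.
by rewrite (_ : (fun _ => _) = fun f => G i f + \sum_(j <- r) G j f);
   [exact: contlinD | apply/funext=> f; rewrite big_cons].
Qed.
End MonomialReduction.

Lemma contlin_coef n : contlin (fun f => coef f n : R^o).
Proof.
split=> [r f g|]; first by rewrite coef_tD coef_tZ.
by exists (n + 1) => f -> //; lia.
Qed.
Lemma contlin_res : contlin (res : L -> R^o).
Proof. exact: contlin_coef. Qed.

Lemma coefMz f m n : coef (f *~ m) n = coef f n *~ m.
Proof. by rewrite (linear_funMz (contlin_coef n).1). Qed.

Lemma resMz f m : res (f *~ m) = res f *~ m.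
Proof. exact: coefMz. Qed.

Lemma ddt_tpow l : ddt 't^l = 't^(l - 1) *~ l.
Proof.
apply: coef_inj => n; rewrite coef_ddt coefMz !coef_tpow -subr_eq opprK.
by case: eqP => [->//|_]; rewrite !mul0rz.
Qed.

Lemma ddtM f g : ddt (f * g) = ddt f * g + f * ddt g.
Proof.
apply/eqP; rewrite -subr_eq0; apply/eqP/coef_inj => n; rewrite coef_t0.
have C := contlin_coef n.
apply: (monomial_reduction
  (Phi := fun f => coef (ddt (f * g) - (ddt f * g + f * ddt g)) n : R^o)) => [|l].
  rewrite (_ : (fun _ => _) = fun f => coef (ddt (g * f)) n
    - (coef (g * ddt f) n + coef (ddt g * f) n) :> R^o); last first.
    by apply/funext=> h; rewrite coef_tD coef_tN coef_tD ![h * _]mulrC ![_ * g]mulrC.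
  apply: contlinD; first exact: (contlinM g (contlin_ddt C)).
  apply/contlinN/contlinD; first exact: (contlin_ddt (contlinM g C)).
  exact: (contlinM (ddt g) C).
rewrite coef_tD coef_tN coef_tD ddt_tpow mulrzAl coefMz coef_ddt !coef_tpowM coef_ddt.
rewrite (_ : n - (l - 1) = n + 1 - l); last by lia.
rewrite (_ : n - l + 1 = n + 1 - l); last by lia.
by rewrite -mulrzDr (addrC l) subrK subrr.
Qed.

End LaurentCalculus.

(** * Rational constants in R *)

Section RationalScalars.
Variables (k : fieldType) (k0 : [pchar k] =i pred0) (R : comAlgType k).

Definition half : R := (2%:R^-1 : k)%:A.
Definition sixth : R := (6%:R^-1 : k)%:A.
Definition twelfth : R := (12%:R^-1 : k)%:A.

Lemma inv_nat_algK (m : nat) : (m.+1%:R^-1 : k)%:A * m.+1%:R = 1 :> R.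
Proof.
rewrite mulr_natr scalerMnl -mulr_natr mulVf ?scale1r //.
by move/pcharf0P: k0 => ->.
Qed.

Lemma half_sixth : half * sixth = twelfth.
Proof. by rewrite /half /sixth /twelfth -scalerAl mul1r scalerA -invfM -natrM. Qed.

Lemma halfK (F : lmodType R) (x : F) : half *: (2 *: x) = x.
Proof. by rewrite scalerA inv_nat_algK scale1r. Qed.

Lemma sixthK (F : lmodType R) (x : F) : sixth *: (x *~ 6) = x.
Proof. by rewrite -scaler_int scalerA inv_nat_algK scale1r. Qed.
End RationalScalars.

(** * Contractions along the residue pairing *)

Section Kernels.
Variables (R : comNzRingType) (L : comAlgType R) (phi : coordinate L).
Variable F : lmodType R.
Implicit Types (f g p q u w : L) (l m n N : int) (s : L -> L -> F).
Local Notation "'t^ n" := (tpow phi n) (at level 2, n at level 2, format "''t^' n").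
Local Notation mpow := (mpow phi).
Local Notation res := (res phi).
Local Notation ddt := (ddt phi).

(** The model is J(p) J(q) v, where q acts first: the depth that kills v is uniform in p, whereas
    the depth required of p depends on q. The asymmetry between the fields reflects this. *)
Record smooth_kernel s : Prop := {
  kernel_contl : forall q, contlin phi (s^~ q);
  kernel_linr : forall p, linear_fun (s p);
  kernel_deep : exists N, forall p q, mpow N q -> s p q = 0 }.

Lemma kernel_finite_unif s w : smooth_kernel s ->
  exists N, forall l, N <= l -> forall p, s p ('t^l * w) = 0.
Proof.
case=> _ _ [N sN]; case: (mpow_bound phi w) => b wb; exists (N - b) => l lN p.
by apply: sN; apply: (mpowW (N := l + b)); [lia|exact: mpow_tpowM].
Qed.

Lemma kernel_finite s (h : int -> L) w : smooth_kernel s ->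
  finite_above (fun l => s (h l) ('t^l * w)).
Proof. by case/(kernel_finite_unif w) => N H; exists N => l /H. Qed.

(** With x and y standing for t in the first and the second argument, [contract] inserts 1/(x - y)
    and [contract1] inserts 1/(x - y)^2, both expanded in nonnegative powers of y. *)
Definition contract s u w : F := tsum (fun l => s ('t^(- l - 1) * u) ('t^l * w)).
Definition contract1 s u w : F :=
  tsum (fun l => s ('t^(- l - 2) * u) ('t^l * w) *~ (l + 1)).

Lemma finite_aboveMz (G H : int -> F) (c : int -> int) : finite_above G ->
  (forall l, H l = G l *~ c l) -> finite_above H.
Proof. by case=> N GN E; exists N => l /GN E0; rewrite E E0 mul0rz. Qed.

Lemma kernel_finite_Mz s (h : int -> L) w (c : int -> int) : smooth_kernel s ->
  finite_above (fun l => s (h l) ('t^l * w) *~ c l).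
Proof. by move=> sk; exact: (finite_aboveMz (kernel_finite h w sk)). Qed.

Lemma kernel_finite_shift s (h : int -> L) m w (c : int -> int) : smooth_kernel s ->
  finite_above (fun l => s (h l) ('t^(l + m) * w) *~ c l).
Proof.
case/(kernel_finite_unif w) => N H; exists (N - m) => l lN.
by rewrite H ?mul0rz //; lia.
Qed.

(** The finite sum is the quotient (x^m - y^m) / (x - y), a Laurent polynomial for m of either
    sign. *)
Lemma contract_shift s m u w : smooth_kernel s ->
  contract s ('t^m * u) w
  = contract s u ('t^m * w) + isum m (fun l => s ('t^(m - l - 1) * u) ('t^l * w)).
Proof.
move=> sk; rewrite {1}/contract (@tsum_shift _ m); last exact: (kernel_finite _ _ sk).
rewrite addrC; congr (_ + _).
  by apply: eq_tsum => l; rewrite !tpowM; congr (s ('t^_ * _) ('t^_ * _)); lia.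
by apply: eq_isum => l; rewrite !tpowM; congr (s ('t^_ * _) _); lia.
Qed.

(** First order Taylor expansion: x^n is y^n + n x^(n-1) (x - y) plus a remainder divisible by (x -
    y)^2, and the finite sum is the quotient of that remainder. *)
Lemma contract1_shift s n u w : smooth_kernel s ->
  contract1 s ('t^n * u) w = contract1 s u ('t^n * w) + contract s ('t^(n - 1) * u) w *~ n
    + isum n (fun l => s ('t^(n - l - 2) * u) ('t^l * w) *~ (l + 1 - n)).
Proof.
move=> sk; pose G l := s ('t^(n - l - 2) * u) ('t^l * w).
have fG c : finite_above (fun l => G l *~ c l).
  exact: (kernel_finite_Mz _ _ _ sk).
have -> : contract1 s ('t^n * u) w = tsum (fun l => G l *~ (l + 1 - n) + G l *~ n).
  apply: eq_tsum => l; rewrite -mulrzDr subrK tpowM; congr (s ('t^_ * _) _ *~ _); lia.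
rewrite tsumD // (@tsum_shift _ n) // -addrA addrC; congr (_ + _ + _).
  apply: eq_tsum => l; rewrite /G !tpowM; congr (s ('t^_ * _) ('t^_ * _) *~ _); lia.
rewrite /contract (tsum_morph (f := fun x => x *~ n)) ?mul0rz //; first last.
- exact: (kernel_finite _ _ sk).
- by move=> x y; rewrite mulrzDl.
by apply: eq_tsum => l; rewrite tpowM; congr (s ('t^_ * _) _ *~ _); lia.
Qed.

Lemma eq_kernel s s' : (forall p q, s p q = s' p q) -> s = s'.
Proof. by move=> E; apply/funext=> p; apply/funext. Qed.

Lemma tsum_linear (G H K : int -> F) r : finite_above G -> finite_above H ->
  (forall l, K l = r *: G l + H l) -> tsum K = r *: tsum G + tsum H.
Proof.
move=> fG fH E; rewrite (tsum_morph (f := *:%R r)) ?scaler0 //; last exact: scalerDr.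
rewrite -tsumD //; first by apply: eq_tsum => l; exact: E.
by case: fG => N GN; exists N => l /GN ->; rewrite scaler0.
Qed.

Lemma contlin_tsum_l s (e c : int -> int) w : smooth_kernel s ->
  contlin phi (fun u => tsum (fun l => s ('t^(e l) * u) ('t^l * w) *~ c l)).
Proof.
move=> sk; split=> [r u u'|].
  apply: tsum_linear => [||l]; try exact: kernel_finite_Mz.
  by rewrite mulrDr -scalerAr (kernel_contl sk _).1 mulrzDl scalerMzr.
(* From K on the terms vanish whatever u is, so only finitely many l impose a depth on u. *)
have [K HK] := kernel_finite_unif w sk.
have [M HM] : exists M, forall u, mpow M u -> forall l : nat, (l < `|K|)%N ->
    s ('t^(e l) * u) ('t^l * w) = 0.
  elim: `|K|%N => [|j [M HM]]; first by exists 0.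
  have [M' HM'] := (kernel_contl sk ('t^j * w)).2.
  exists (Num.max M (M' - e j)) => u uM l; rewrite ltnS leq_eqVlt.
  case/orP=> [/eqP->|lj]; last by apply: HM => //; apply: mpowW uM; rewrite le_max lexx.
  apply: HM'; rewrite -(subrK (e j) M') addrC; apply: mpow_tpowM.
  by apply: mpowW uM; rewrite le_max lexx orbT.
exists M => u uM; apply: tsum_eq0 => l; have [lK|Kl] := ltnP l `|K|%N.
  by rewrite HM ?mul0rz.
by rewrite HK ?mul0rz //; lia.
Qed.

Lemma contlin_tsum_r s (e c : int -> int) u : smooth_kernel s ->
  contlin phi (fun w => tsum (fun l => s ('t^(e l) * u) ('t^l * w) *~ c l)).
Proof.
move=> sk; split=> [r w w'|].
  apply: tsum_linear => [||l]; try exact: kernel_finite_Mz.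
  by rewrite mulrDr -scalerAr (kernel_linr sk) mulrzDl scalerMzr.
have [N sN] := kernel_deep sk; exists N => w wN; apply: tsum_eq0 => l.
rewrite sN ?mul0rz //; apply: (mpowW (N := l%:Z + N)); first lia.
exact: mpow_tpowM.
Qed.

Lemma contractE s u w :
  contract s u w = tsum (fun l => s ('t^(- l - 1) * u) ('t^l * w) *~ 1).
Proof. by apply: eq_tsum => l; rewrite mulr1z. Qed.

Lemma contlin_contract_l s w : smooth_kernel s -> contlin phi (fun u => contract s u w).
Proof. by under eq_fun do rewrite contractE; exact: contlin_tsum_l. Qed.
Lemma contlin_contract_r s u : smooth_kernel s -> contlin phi (fun w => contract s u w).
Proof. by under eq_fun do rewrite contractE; exact: contlin_tsum_r. Qed.
Lemma contlin_contract1_l s w : smooth_kernel s -> contlin phi (fun u => contract1 s u w).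
Proof. exact: contlin_tsum_l. Qed.
Lemma contlin_contract1_r s u : smooth_kernel s -> contlin phi (fun w => contract1 s u w).
Proof. exact: contlin_tsum_r. Qed.

(* The weights l come from D t^l = l t^(l-1) (D t); the second half of the sum is
   reindexed by one. *)
Lemma contract_tderiv s u w a : smooth_kernel s ->
  tsum (fun l => s ('t^(- l - 1 - 1) * (a * u)) ('t^l * w) *~ (- l - 1)
               + s ('t^(- l - 1) * u) ('t^(l - 1) * (a * w)) *~ l)
  = contract1 s u (a * w) - contract1 s (a * u) w.
Proof.
move=> sk; pose G l := s ('t^(- l - 2) * u) ('t^l * (a * w)) *~ (l + 1).
have fG : finite_above G by exact: kernel_finite_Mz.
rewrite tsumD; first last.
- exact: (kernel_finite_shift _ (-1) _ id sk).
- exact: (kernel_finite_Mz (fun l => 't^(- l - 1 - 1) * (a * u)) w (fun l => - l - 1)).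
rewrite addrC; congr (_ + _).
  (* The reindexing by one adds only the term l = -1, whose weight l + 1 is 0. *)
  rewrite /contract1 -/G (tsum_shift (-1) fG) (_ : isum _ _ = 0); last first.
    apply: (addIr (G (-1))); rewrite -isumS addNr isum0 add0r /G addNr mulr0z //.
  rewrite add0r; apply: eq_tsum => l; rewrite /G.
  by congr (s ('t^_ * _) _ *~ _); lia.
rewrite (tsum_morph (f := -%R)) ?oppr0 //; [|exact: opprD|exact: kernel_finite_Mz].
apply: eq_tsum => l; rewrite -mulrNz; congr (s ('t^_ * _) _ *~ _); lia.
Qed.

Lemma tsum_single (G : int -> F) (j : nat) : (forall l : nat, l != j -> G l = 0) ->
  tsum G = G j.
Proof.
move=> G0; rewrite /tsum (fsbigE [:: j]) //.
  by rewrite big_mkcond big_seq1 in_setT.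
by move=> i _; rewrite inE => /G0.
Qed.

Lemma res_tpow m : res 't^m = (m == -1)%:R.
Proof. by rewrite /Defs.res coef_tpow eq_sym. Qed.

Lemma residue_finite_l (Phi : L -> F) f (e : int -> L) :
  finite_above (fun l => res (f * 't^l) *: Phi (e l)).
Proof.
case: (mpow_bound phi f) => b fb; exists (- b) => l lb.
by rewrite (res_eq0 (mpowM fb (@mpow_tpow _ _ phi l))) ?scale0r //; lia.
Qed.

Lemma contlin_bound (Phi : L -> F) u : contlin phi Phi ->
  exists K, forall l, K <= l -> Phi ('t^l * u) = 0.
Proof.
move=> [_ [N PN]]; case: (mpow_bound phi u) => b ub; exists (N - b) => l lN.
by apply: PN; apply: (mpowW (N := l + b)); [lia|exact: mpow_tpowM].
Qed.

Lemma residue_finite_r (Phi : L -> F) u (r : int -> R) : contlin phi Phi ->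
  finite_above (fun l => r l *: Phi ('t^l * u)).
Proof. by case/(contlin_bound u) => K HK; exists K => l /HK ->; rewrite scaler0. Qed.

(* f = \sum_(l >= 0) (res (f t^l) t^(-l-1) + res (f t^(-l-1)) t^l). *)
Lemma residue_expansion (Phi : L -> F) f u : contlin phi Phi ->
  tsum (fun l => res (f * 't^l) *: Phi ('t^(- l - 1) * u))
  + tsum (fun l => res (f * 't^(- l - 1)) *: Phi ('t^l * u)) = Phi (u * f).
Proof.
move=> PhiC; have [K HK] := contlin_bound u PhiC.
have fin1 g := residue_finite_l Phi g (fun l => 't^(- l - 1) * u).
have fin2 g := residue_finite_r u (fun l => res (g * 't^(- l - 1))) PhiC.
apply/eqP; rewrite -subr_eq0; apply/eqP.
apply: (monomial_reduction (phi := phi) (Phi := fun f =>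
  tsum (fun l => res (f * 't^l) *: Phi ('t^(- l - 1) * u))
  + tsum (fun l => res (f * 't^(- l - 1)) *: Phi ('t^l * u)) - Phi (u * f))) => [|m].
  apply: contlinD; last exact/contlinN/contlinM.
  apply: contlinD; split.
  - move=> r g g'; apply: tsum_linear => // l.
    by rewrite mulrDl -scalerAl resD resZ scalerDl scalerA.
  - exists 0 => g g0; apply: tsum_eq0 => l.
    by rewrite (res_eq0 (mpowM g0 (@mpow_tpow _ _ phi l))) ?scale0r.
  - move=> r g g'; apply: tsum_linear => // l.
    by rewrite mulrDl -scalerAl resD resZ scalerDl scalerA.
  - exists `|K|%:Z => g g0; apply: tsum_eq0 => l; have [Kl|lK] := leP K l%:Z.
      by rewrite HK ?scaler0.
    by rewrite (res_eq0 (mpowM g0 (@mpow_tpow _ _ phi _))) ?scale0r //; lia.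
apply/eqP; rewrite subr_eq0 [u * _]mulrC; apply/eqP.
have resE l l' : res ('t^l * 't^l') = (l + l' == - 1)%:R by rewrite -tpowD res_tpow.
(* A nonnegative power t^m meets only the second sum, at l = m; [Negz m] stands for t^(-m-1), which
   meets only the first sum, again at l = m. *)
case: m => m.
  rewrite tsum_eq0 => [|l]; last first.
    by rewrite resE (_ : _ == _ = false) ?scale0r //; lia.
  rewrite add0r (@tsum_single _ m) => [|l lm].
    by rewrite resE (_ : _ == _) ?scale1r //; lia.
  by rewrite resE (_ : _ == _ = false) ?scale0r //; lia.
rewrite addrC tsum_eq0 => [|l]; last first.
  by rewrite resE (_ : _ == _ = false) ?scale0r //; lia.
rewrite add0r (@tsum_single _ m) => [|l lm].
  by rewrite resE (_ : _ == _) ?scale1r //; [congr (Phi ('t^_ * _))|]; lia.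
by rewrite resE (_ : _ == _ = false) ?scale0r //; lia.
Qed.

(** The bookkeeping of [contract_anomaly]: a1, a2 are double contractions, c1, c2 simple ones, and
    i1, x the boundary sums, which alone survive. *)
Lemma zmod_cancel (V : zmodType) (a1 a2 c1 c2 i1 x : V) :
  a1 - (a2 + c1 + i1) + (a2 - (a1 + (c2 + x))) + (c1 + c2) = - (i1 + x).
Proof.
rewrite !opprD !addrA [LHS](ACl ((4 * 8) * (1 * 6) * (2 * 5) * (3 * 9) * (7 * 10)))%AC /=.
by rewrite subrr !addNr !addr0.
Qed.

Section Anomaly.
Variables (s : L -> L -> F) (K : F).
Hypothesis sk : smooth_kernel s.
Hypothesis sC : forall p q, s p q - s q p = - (res (p * ddt q) *: K).

(** Linearity in a reduces to a = t^n, with b arbitrary. The shift formulas then cancel all infinite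
    sums; the boundary sums pair into differences s p q - s q p, which [sC] turns into multiples of
    K. *)
Lemma contract_anomaly a b :
  (contract1 s 1 (b * a) - contract1 s (b * a) 1
    + (contract1 s b a - contract1 s a b)
    + (contract s (b * ddt a) 1 + contract s 1 (b * ddt a))) *~ 6
  + res (ddt (ddt (ddt a)) * b) *: K = 0.
Proof.
move: a; apply: (monomial_reduction (phi := phi)) => [|n].
  apply: contlinD.
    apply: contlinMz; apply: contlinD.
      apply: contlinD.
        apply: contlinD; first exact: (contlinM _ (contlin_contract1_r _ sk)).
        exact: (contlinN (contlinM _ (contlin_contract1_l _ sk))).
      by apply: contlinD; [exact: contlin_contract1_r|exact/contlinN/contlin_contract1_l].
    apply: contlinD.
      exact: (contlin_ddt (contlinM _ (contlin_contract_l _ sk))).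
    exact: (contlin_ddt (contlinM _ (contlin_contract_r _ sk))).
  have C : contlin phi (fun f => res (f * b) *: K).
    under eq_fun do rewrite mulrC.
    apply: (contlin_comp (u := fun r : R^o => r *: K)) => [r x y|].
      by rewrite scalerDl scalerA.
    exact: (contlinM b (contlin_res phi)).
  exact: (contlin_ddt (contlin_ddt (contlin_ddt C))).
rewrite ddt_tpow !mulrzAr ![b * _]mulrC.
rewrite !(linear_funMz (contlin_contract_l _ sk).1) !(linear_funMz (contlin_contract_r _ sk).1).
have sh1 := contract1_shift n b 1 sk.
have := contract1_shift n 1 b sk; rewrite mulr1 (contract_shift _ _ _ sk) => sh2.
rewrite mulrzDl -!addrA in sh2; rewrite mulr1 in sh1 *; rewrite sh1 sh2 zmod_cancel.
pose G l := s ('t^(n - l - 2) * b) 't^l; pose H l := s 't^(n - l - 2) ('t^l * b).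
(* The term l = n - 1 has weight 0; without it this sum has the same range as the one coming from
   the simple contraction. *)
have -> : isum n (fun l => s ('t^(n - l - 2) * b) ('t^l * 1) *~ (l + 1 - n))
    = isum (n - 1) (fun l => G l *~ (l + 1 - n)).
  rewrite isum_pred (_ : n - 1 + 1 - n = 0) ?mulr0z ?addr0; last lia.
  by apply: eq_isum => l; rewrite mulr1.
have -> : isum (n - 1) (fun l => s ('t^(n - 1 - l - 1) * 1) ('t^l * b)) *~ n
    + isum n (fun l => s ('t^(n - l - 2) * 1) ('t^l * b) *~ (l + 1 - n))
    = isum (n - 1) (fun l => H (n - 1 - 1 - l) *~ (n - 1 - l)).
  rewrite [X in _ + X]isum_pred (_ : n - 1 + 1 - n = 0); last lia.
  rewrite mulr0z addr0.
  rewrite (isum_morph _ (f := fun x => x *~ n)) ?mul0rz // => [|x y]; last exact: mulrzDl.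
  (* Reversing the range gives the l-th term of [H] the two arguments of the l-th term of [G],
     exchanged. *)
  rewrite -isumD -[LHS]isum_rev; apply: eq_isum => l; rewrite /H !mulr1.
  rewrite (_ : n - 1 - (n - 1 - 1 - l) - 1 = n - (n - 1 - 1 - l) - 2); last lia.
  by rewrite -mulrzDr; congr (_ *~ _); lia.
pose Z := res ('t^(n - 3) * b) *: K.
have GH l : G l *~ (l + 1 - n) + H (n - 1 - 1 - l) *~ (n - 1 - l) = Z *~ (l * (n - 1 - l)).
  rewrite (_ : l + 1 - n = - (n - 1 - l)); last lia.
  rewrite mulrNz -mulNrz -mulrzDl /G /H addrC -opprB.
  rewrite (_ : n - (n - 1 - 1 - l) - 2 = l); last lia.
  rewrite (_ : n - l - 2 = n - 1 - 1 - l) ?sC; last lia.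
  rewrite opprK ddt_tpow mulrzAr mulrAC -tpowD (_ : n - 1 - 1 - l + (l - 1) = n - 3); last lia.
  by rewrite resMz -scalerMzl mulrzA.
rewrite -isumD (eq_isum _ GH).
rewrite -(isum_morph (f := fun x => Z *~ x)) ?mulr0z // => [|x y]; last exact: mulrzDr.
rewrite !ddtMz ddt_tpow !ddtMz ddt_tpow !mulrzAl !resMz -!scalerMzl.
rewrite (_ : n - 1 - 1 - 1 = n - 3) -/Z; last lia.
rewrite mulNrz -!mulrzA isum_quadratic addrC -mulrzBr -[RHS](mulr0z Z); congr (_ *~ _).
by ring.
Qed.
End Anomaly.
End Kernels.

(** * Derivations preserving R *)

Section Derivations.
Variables (k : fieldType) (R : comAlgType k) (L : comAlgType R).
Variable phi : coordinate L.
Implicit Types (f g : L) (l m n N : int) (d : R -> R) (r : R).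
Local Notation "'t^ n" := (tpow phi n) (at level 2, n at level 2, format "''t^' n").
Local Notation mpow := (mpow phi).
Local Notation res := (res phi).
Local Notation ddt := (ddt phi).
Local Notation coef := (coef phi).
Local Notation is_der := (@is_k_derivation_of_R k R).

Section DerivationOfR.
Variable d : R -> R.
Hypothesis dP : is_der d.

Lemma derD r s : d (r + s) = d r + d s. Proof. by case: dP. Qed.
Lemma derM r s : d (r * s) = d r * s + r * d s. Proof. by case: dP. Qed.
Lemma derZ (a : k) r : d (a *: r) = a *: d r. Proof. by case: dP. Qed.
Lemma der0 : d 0 = 0. Proof. by have := derZ 0 0; rewrite !scale0r. Qed.
Lemma derN r : d (- r) = - d r. Proof. by rewrite -(scaleN1r r) derZ scaleN1r. Qed.
Lemma der1 : d 1 = 0.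
Proof. by apply: (addrI (d 1)); have := derM 1 1; rewrite !mulr1 mul1r addr0 => <-. Qed.
Lemma derA (a : k) : d a%:A = 0. Proof. by rewrite derZ der1 scaler0. Qed.
Lemma derMz r n : d (r *~ n) = d r *~ n.
Proof. by rewrite -(scaler_int n r) derZ scaler_int. Qed.
End DerivationOfR.

Lemma der_commutator d e : is_der d -> is_der e -> is_der (fun r => d (e r) - e (d r)).
Proof.
move=> dP eP; split=> [r s|a r|r s].
- by rewrite !(derD dP, derD eP) opprD addrACA.
- by rewrite !(derZ dP, derZ eP) scalerBr.
- by rewrite !(derM dP, derM eP, derD dP, derD eP); ring.
Qed.

Lemma der_linear r d e : is_der d -> is_der e -> is_der (fun s => r * d s + e s).
Proof.
move=> dP eP; split=> [s s'|a s|s s'].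
- by rewrite (derD dP) (derD eP) mulrDr addrACA.
- by rewrite (derZ dP) (derZ eP) scalerDr scalerAr.
- by rewrite (derM dP) (derM eP); ring.
Qed.

Lemma der_zero : is_der (fun=> 0).
Proof. by split=> [r s|a r|r s]; rewrite ?addr0 ?scaler0 ?mul0r ?mulr0 ?addr0. Qed.

(* Rewriting with [mulr_algl] from right to left would loop, as r%:A is itself a
   scaling; the factor has to be opaque. *)
Lemma scale_as_mul : exists a : R -> L, forall r f, r *: f = a r * f.
Proof. by exists (fun r => r%:A) => r f; rewrite mulr_algl. Qed.

(* The correction d 0 vanishes for a derivation; it makes the series Laurent
   for every function d. *)
Fact nabla_sub d f : exists N, vanishes_below (fun n => d (coef f n) - d 0) N.
Proof. by case: (mpow_bound phi f) => N fN; exists N => n /fN ->; rewrite subrr. Qed.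
Definition nabla d f : L := of_laurent phi (Laurent (nabla_sub d f)).

Section Nabla.
Variable d : R -> R.
Hypothesis dP : is_der d.

Lemma coef_nabla f n : coef (nabla d f) n = d (coef f n).
Proof. by rewrite /Defs.coef /nabla of_laurentK /= (der0 dP) subr0. Qed.

Lemma nablaD f g : nabla d (f + g) = nabla d f + nabla d g.
Proof. by apply: (coef_inj (phi := phi)) => n; rewrite !(coef_nabla, coef_tD) (derD dP). Qed.
Lemma nablaZ r f : nabla d (r *: f) = d r *: f + r *: nabla d f.
Proof. by apply: (coef_inj (phi := phi)) => n; rewrite !(coef_nabla, coef_tD, coef_tZ) (derM dP). Qed.
Lemma nabla0 : nabla d 0 = 0.
Proof. by apply: (coef_inj (phi := phi)) => n; rewrite coef_nabla !coef_t0 (der0 dP). Qed.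
Lemma nabla_tpowM l f : nabla d ('t^l * f) = 't^l * nabla d f.
Proof. by apply: (coef_inj (phi := phi)) => n; rewrite !(coef_nabla, coef_tpowM). Qed.
Lemma nabla_tpow l : nabla d 't^l = 0.
Proof.
apply: (coef_inj (phi := phi)) => n; rewrite coef_nabla coef_tpow coef_t0.
by case: eqP => _; rewrite ?(der1 dP) ?(der0 dP).
Qed.
Lemma nabla_ddt f : nabla d (ddt f) = ddt (nabla d f).
Proof. by apply: (coef_inj (phi := phi)) => n; rewrite !(coef_nabla, coef_ddt) (derMz dP). Qed.
Lemma nabla_res f : d (res f) = res (nabla d f).
Proof. by rewrite /Defs.res coef_nabla. Qed.
Lemma mpow_nabla N f : mpow N f -> mpow N (nabla d f).
Proof. by move=> fN n nN; rewrite coef_nabla fN // (der0 dP). Qed.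

(** Neither side is R-linear in f, but replacing f by r f adds (d r) f g to both, so their
    difference [X] is. On t^l it vanishes because multiplication by t^l only shifts coefficients. *)
Lemma nablaM f g : nabla d (f * g) = nabla d f * g + f * nabla d g.
Proof.
apply/eqP; rewrite -subr_eq0; apply/eqP/(coef_inj (phi := phi)) => n; rewrite coef_t0.
pose X f := nabla d (f * g) - (nabla d f * g + f * nabla d g).
apply: (monomial_reduction (phi := phi) (Phi := fun f => coef (X f) n : R^o)) => [|l].
  split=> [r f' h|].
    rewrite (_ : X _ = r *: X f' + X h); first by rewrite [LHS]coef_tD coef_tZ.
    have [a aE] := scale_as_mul.
    by rewrite /X !(mulrDl, nablaD, nablaZ) -!scalerAl nablaZ !aE; ring.
  case: (mpow_bound phi g) => b gb; exists (n + 1 - b) => h hN.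
  have nb : n < n + 1 - b + b by lia.
  rewrite /X coef_tD coef_tN coef_tD coef_nabla (mpowM hN gb nb) (der0 dP).
  by rewrite (mpowM (mpow_nabla hN) gb nb) (mpowM hN (mpow_nabla gb) nb) addr0 subrr.
by rewrite /X nabla_tpowM nabla_tpow mul0r add0r subrr coef_t0.
Qed.
End Nabla.

Lemma nabla_linear r d e f : is_der d -> is_der e ->
  nabla (fun s => r * d s + e s) f = r *: nabla d f + nabla e f.
Proof.
move=> dP eP; apply: (coef_inj (phi := phi)) => n.
by rewrite coef_tD coef_tZ !coef_nabla //; exact: der_linear.
Qed.
Lemma nabla_commutator d e f : is_der d -> is_der e ->
  nabla (fun s => d (e s) - e (d s)) f = nabla d (nabla e f) - nabla e (nabla d f).
Proof.
move=> dP eP; apply: (coef_inj (phi := phi)) => n.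
by rewrite coef_tD coef_tN !coef_nabla //; exact: der_commutator.
Qed.

Fact nabla_theta_LR d (dP : is_der d) : nabla d \in theta_LR_pred phi.
Proof.
apply/asboolP; split; first exact: nablaD.
- by move=> a f; rewrite nablaZ // (derA dP) scale0r add0r.
- exact: nablaM.
- by move=> N; exists N => f; exact: mpow_nabla.
- by move=> r; exists (d r); rewrite nablaZ // -(tpow0 phi) nabla_tpow // scaler0 addr0.
Qed.
Definition horizontal_lift d (dP : is_der d) : theta_LR phi := ThetaLR (nabla_theta_LR dP).

Section ThetaLR.
Implicit Types D E : theta_LR phi.

Lemma thetaP D : is_theta_LR phi D. Proof. exact/asboolP/theta_LR_valP. Qed.
Lemma thetaD D f g : D (f + g) = D f + D g. Proof. by case: (thetaP D). Qed.
Lemma thetaM D f g : D (f * g) = D f * g + f * D g. Proof. by case: (thetaP D). Qed.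
Lemma coef_cst r n : coef r%:A n = r *+ (n == 0).
Proof. by rewrite coef_tZ -(tpow0 phi) coef_tpow mulr_natr. Qed.
Lemma theta_cst D r : D r%:A = (anchor phi D r)%:A.
Proof.
case: (thetaP D) => _ _ _ _ /(_ r) [s E]; rewrite /anchor E.
by rewrite coef_cst eqxx.
Qed.
Lemma thetaZ D r f : D (r *: f) = anchor phi D r *: f + r *: D f.
Proof. by rewrite -mulr_algl thetaM theta_cst !mulr_algl. Qed.

Lemma anchor_der D : is_der (anchor phi D).
Proof.
split=> [r s|a r|r s].
- by rewrite /anchor scalerDl thetaD coef_tD.
- case: (thetaP D) => _ DZ _ _ _.
  by rewrite /anchor -(mulr_algl a r) -scalerA DZ coef_tZ mulr_algl.
- rewrite {1}/anchor -scalerA thetaZ theta_cst coef_tD !coef_tZ.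
  by rewrite (_ : coef 1 0 = 1) ?mulr1 // -(tpow0 phi) coef_tpow eqxx.
Qed.

Lemma theta_tpow D m : D 't^m = 't^(m - 1) *~ m * D 't^1.
Proof.
(* Cancelling t makes the induction step reversible and so covers negative powers. *)
have t_inj f g : f * 't^1 = g * 't^1 -> f = g.
  move=> /(congr1 ( *%R^~ 't^(-1))) /=.
  by rewrite -!mulrA -tpowD subrr tpow0 !mulr1.
elim/int_step_ind: m => [|m].
  apply: (addrI (D 't^0)); have := thetaM D 1 1.
  by rewrite tpow0 !mulr1 mul1r mulr0z mul0r addr0 => <-.
rewrite (tpowD phi m 1) thetaM addrK.
have -> : 't^m *~ (m + 1) * D 't^1 = 't^(m - 1) *~ m * D 't^1 * 't^1 + 't^m * D 't^1.
  by rewrite mulrzDr mulr1z mulrDl mulrAC [_ *~ m * 't^1]mulrzAl -tpowD subrK.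
by split=> [->//|/addIr/t_inj].
Qed.

(** Both sides have the same anchor, so their difference is R-linear; it is continuous because D is,
    and it kills the powers of t by the chain rule. *)
Lemma thetaE D f : D f = D 't^1 * ddt f + nabla (anchor phi D) f.
Proof.
have dP := anchor_der D.
apply/eqP; rewrite -subr_eq0; apply/eqP/(coef_inj (phi := phi)) => n; rewrite coef_t0.
pose X f := D f - (D 't^1 * ddt f + nabla (anchor phi D) f).
apply: (monomial_reduction (phi := phi) (Phi := fun f => coef (X f) n : R^o)) => [|l].
  split=> [r f' h|].
    rewrite (_ : X _ = r *: X f' + X h); first by rewrite [LHS]coef_tD coef_tZ.
    have [a aE] := scale_as_mul.
    by rewrite /X !(thetaD, thetaZ, nablaD dP, nablaZ dP, ddt_linear) !aE; ring.
  case: (thetaP D) => _ _ _ /(_ (n + 1)) [N DN] _; case: (mpow_bound phi (D 't^1)) => b tb.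
  (* The three bounds make D h, (D t) h' and nabla h vanish in degree n; the derivative costs one
     degree. *)
  exists (Num.max N (Num.max (n + 2 - b) (n + 1))) => h hN.
  have nn : n < n + 1 by lia.
  have h1 : mpow N h by apply: mpowW hN; rewrite le_max lexx.
  have h2 : mpow (n + 2 - b) h by apply: mpowW hN; rewrite !le_max lexx orbT.
  have h3 : mpow (n + 1) h by apply: mpowW hN; rewrite !le_max lexx !orbT.
  rewrite /X coef_tD coef_tN coef_tD (DN h h1 n nn) (mpow_nabla dP h3 nn).
  rewrite (mpowM tb (mpow_ddt h2)) ?addr0 ?subrr //; lia.
by rewrite /X theta_tpow nabla_tpow // ddt_tpow addr0 mulrC subrr coef_t0.
Qed.

Lemma anchor_linear r D E : anchor phi (r *: D + E) = fun s => r * anchor phi D s + anchor phi E s.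
Proof. by apply/funext=> s; rewrite /anchor coef_tD coef_tZ. Qed.

Lemma anchor_bracket D E : anchor phi (theta_LR_bracket D E)
  = fun r => anchor phi D (anchor phi E r) - anchor phi E (anchor phi D r).
Proof.
apply/funext=> r; rewrite {1}/anchor /= /commutator !theta_cst.
by rewrite -scalerBl coef_cst eqxx.
Qed.

Lemma bracket_t D E : theta_LR_bracket D E 't^1 =
  (D 't^1 * ddt (E 't^1) - E 't^1 * ddt (D 't^1))
  + (nabla (anchor phi D) (E 't^1) - nabla (anchor phi E) (D 't^1)).
Proof. by rewrite /= /commutator [LHS]/= !(thetaE _ (theta_LR_val _ _)); ring. Qed.

Lemma anchor_theta (D : theta phi) : anchor phi D = fun=> 0.
Proof.
have /asboolP[D1 D2 D3 D4] := theta_valP D; apply/funext=> r.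
have D0 : D 1 = 0 by apply: (addrI (D 1)); have := D3 1 1; rewrite !mulr1 mul1r addr0 => <-.
by rewrite /anchor D2 D0 scaler0 coef_t0.
Qed.

Lemma anchor0_theta D : anchor phi D =1 (fun=> 0) -> exists D' : theta phi, D = theta_incl D'.
Proof.
move=> D0; have [D1 _ D3 D4 _] := thetaP D.
have DP : theta_LR_val D \in theta_pred phi.
  by apply/asboolP; split=> // r f; rewrite thetaZ D0 scale0r add0r.
by exists (Theta DP); exact: val_inj.
Qed.

Lemma anchor_lift d (dP : is_der d) : anchor phi (horizontal_lift dP) =1 d.
Proof. by move=> r; rewrite /anchor /= coef_nabla // coef_cst eqxx. Qed.
End ThetaLR.
End Derivations.

(** * The extended Virasoro algebra *)

Section Extension.
Variables (k : fieldType) (R : comAlgType k) (L : comAlgType R).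
Variable phi : coordinate L.
Implicit Types (f g : L) (D : theta_LR phi) (r s : R).
Local Notation "'t^ n" := (tpow phi n) (at level 2, n at level 2, format "''t^' n").
Local Notation res := (res phi).
Local Notation ddt := (ddt phi).
Local Notation coef := (coef phi).
Local Notation twelfth := (twelfth R).

Definition residue_cocycle f g : R := twelfth * res (ddt (ddt (ddt f)) * g).

Lemma virasoro_cocycleE (D E : theta phi) :
  virasoro_cocycle D E = residue_cocycle (D 't^1) (E 't^1).
Proof.
rewrite /residue_cocycle -resZ scalerAr /Defs.res /Defs.coef expansionM lcoefM.
(* The coefficient of D t in degree m + 1 reaches degree m - 2 after three derivatives, with the
   factor (m + 1) m (m - 1) = m^3 - m. *)
rewrite (@reindex_fsbigT _ _ _ int int (fun m => m - 2)); last first.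
  by exists (fun m => m + 2) => m; rewrite ?addrK ?subrK.
apply: eq_fsbigr => m _.
rewrite -!/(Defs.coef phi _ _) !coef_ddt coef_tZ.
have -> : ((((m ^+ 3 - m)%:~R / 12%:R : k)%:A : R)) = (m ^+ 3 - m)%:~R * twelfth.
  by rewrite -scalerA scaler_int mulrzl.
rewrite (_ : - 1 - (m - 2) = 1 - m); last lia.
rewrite (_ : m - 2 + 1 + 1 + 1 = m + 1); last lia.
set a := coef _ (m + 1); set p := _ *~ (m - 2 + 1).
have -> : p = (m ^+ 3 - m)%:~R * a.
  by rewrite /p -!mulrzA mulrzl; congr (_ *~ _); ring.
by ring.
Qed.

Lemma res_ibp f g : res (ddt f * g) = - res (f * ddt g).
Proof. by apply/eqP; rewrite -addr_eq0 -resD -ddtM res_ddt. Qed.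

Lemma res_anti3 f g : res (ddt (ddt (ddt f)) * g) = - res (ddt (ddt (ddt g)) * f).
Proof. by rewrite (res_ibp (ddt (ddt f))) (res_ibp (ddt f)) (res_ibp f) opprK mulrC. Qed.

Lemma residue_cocycleC f g : residue_cocycle f g = - residue_cocycle g f.
Proof. by rewrite /residue_cocycle res_anti3 mulrN. Qed.

Lemma residue_cocycleDl f f' g :
  residue_cocycle (f + f') g = residue_cocycle f g + residue_cocycle f' g.
Proof. by rewrite /residue_cocycle !raddfD /= mulrDl resD mulrDr. Qed.
Lemma residue_cocycleDr f g g' :
  residue_cocycle f (g + g') = residue_cocycle f g + residue_cocycle f g'.
Proof. by rewrite /residue_cocycle mulrDr resD mulrDr. Qed.
Lemma residue_cocycleZr f r g : residue_cocycle f (r *: g) = r * residue_cocycle f g.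
Proof. by rewrite /residue_cocycle -scalerAr resZ mulrCA. Qed.
Lemma residue_cocycleNr f g : residue_cocycle f (- g) = - residue_cocycle f g.
Proof. by rewrite /residue_cocycle mulrN resN mulrN. Qed.

Lemma der_residue_cocycle d f g : is_k_derivation_of_R d ->
  d (residue_cocycle f g) = residue_cocycle (nabla phi d f) g + residue_cocycle f (nabla phi d g).
Proof.
move=> dP; rewrite /residue_cocycle (derM dP) (derA dP) mul0r add0r (nabla_res phi dP).
by rewrite (nablaM phi dP) resD mulrDr !(nabla_ddt phi dP).
Qed.

(* The sum is the residue of the derivative of the Wronskian of f, g, h. *)
Lemma residue_cocycle_wronskian f g h :
  residue_cocycle f (g * ddt h - h * ddt g) + residue_cocycle g (h * ddt f - f * ddt h)
  + residue_cocycle h (f * ddt g - g * ddt f) = 0.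
Proof.
rewrite /residue_cocycle -!mulrDr -!resD.
pose W := ddt (ddt f) * (g * ddt h - h * ddt g) + ddt (ddt g) * (h * ddt f - f * ddt h)
  + ddt (ddt h) * (f * ddt g - g * ddt f).
rewrite (_ : _ + _ + _ = ddt W) ?res_ddt ?mulr0 //.
have dN x : ddt (- x) = - ddt x by rewrite raddfN.
have dD x y : ddt (x + y) = ddt x + ddt y by rewrite raddfD.
by rewrite /W !(dD, ddtM, dN); ring.
Qed.

Definition theta_LR_cocycle D E : R := residue_cocycle (D 't^1) (E 't^1).

(** The terms in r1, r2, r3 cancel because the anchor is compatible with brackets. The derivatives
    of the cocycle values cancel the horizontal parts of the brackets, by the Leibniz rule and
    antisymmetry of the cocycle. The vertical parts leave the Wronskian identity. *)
Lemma theta_LR_cocycle_jacobi D1 D2 D3 (r1 r2 r3 : R) :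
  let psi := theta_LR_cocycle in let br := @theta_LR_bracket _ _ _ phi in
  let d := anchor phi in
  psi D1 (br D2 D3)
    + (d D1 (psi D2 D3 + (d D2 r3 - d D3 r2)) - d (br D2 D3) r1)
  + (psi D2 (br D3 D1)
    + (d D2 (psi D3 D1 + (d D3 r1 - d D1 r3)) - d (br D3 D1) r2))
  + (psi D3 (br D1 D2)
    + (d D3 (psi D1 D2 + (d D1 r2 - d D2 r1)) - d (br D1 D2) r3)) = 0.
Proof.
move=> psi br d; have dP D := anchor_der D.
rewrite /psi /theta_LR_cocycle /br /d !bracket_t !anchor_bracket.
rewrite !(derD (dP _)) !(derN (dP _)) !(der_residue_cocycle _ _ (dP _)).
set f := D1 't^1; set g := D2 't^1; set h := D3 't^1.
rewrite !(residue_cocycleDr, residue_cocycleNr).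
rewrite (residue_cocycleC (nabla _ _ _)) ![residue_cocycle (nabla _ _ _) _]residue_cocycleC.
have := residue_cocycle_wronskian f g h.
rewrite !(residue_cocycleDr, residue_cocycleNr) => W.
by rewrite -[RHS]W; ring.
Qed.

Definition ext_type : lmodType R := (theta_LR phi * R^o)%type.
Implicit Types x y z : ext_type.

Definition ext_br x y : ext_type :=
  (theta_LR_bracket x.1 y.1,
   theta_LR_cocycle x.1 y.1 + (anchor phi x.1 y.2 - anchor phi y.1 x.2)).

Lemma theta_LR_ext D D' : (forall f, D f = D' f) -> D = D'.
Proof. by move=> DE; apply/val_inj/funext. Qed.

Lemma thetaN D f : D (- f) = - D f.
Proof.
apply/eqP; rewrite -addr_eq0 -thetaD addNr; apply/eqP.
by apply: (addrI (D 0)); rewrite -thetaD !addr0.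
Qed.

Lemma ext_brC x y : ext_br x y = - ext_br y x.
Proof.
case: x y => [D a] [E b]; congr pair; first by apply: theta_LR_ext => f /=; rewrite opprB.
by rewrite /= /theta_LR_cocycle [in LHS]residue_cocycleC [RHS]opprD opprB.
Qed.

Lemma ext_br_Dl x y z : ext_br (x + y) z = ext_br x z + ext_br y z.
Proof.
case: x y z => [D a] [E b] [G c]; congr pair.
  apply: theta_LR_ext => f; rewrite /= /commutator /=.
  rewrite [LHS]/= thetaD opprD addrACA //.
have A : anchor phi (D + E) c = anchor phi D c + anchor phi E c.
  by rewrite /anchor -coef_tD.
rewrite /= A (derD (anchor_der G)) /theta_LR_cocycle residue_cocycleDl.
by rewrite opprD [X in _ + _ + X]addrACA [LHS]addrACA.
Qed.

Lemma ext_br_Dr x y z : ext_br x (y + z) = ext_br x y + ext_br x z.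
Proof. by rewrite ext_brC ext_br_Dl opprD -!ext_brC. Qed.

Lemma ext_br_leibniz x r y :
  ext_br x (r *: y) = r *: ext_br x y + anchor phi x.1 r *: y.
Proof.
case: x y => [D a] [E b]; congr pair.
  apply: theta_LR_ext => f; rewrite /= /commutator /=.
  change (D (r *: E f) - r *: E (D f) = r *: (D (E f) - E (D f)) + anchor phi D r *: E f).
  by rewrite thetaZ scalerBr [RHS]addrC addrA.
have A : anchor phi (r *: E) a = r * anchor phi E a by rewrite /anchor -coef_tZ.
change (theta_LR_cocycle D (r *: E) + (anchor phi D (r * b) - anchor phi (r *: E) a)
  = r * (theta_LR_cocycle D E + (anchor phi D b - anchor phi E a)) + anchor phi D r * b).
by rewrite A (derM (anchor_der D)) /theta_LR_cocycle residue_cocycleZr; ring.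
Qed.

Lemma ext_br_jacobi x y z :
  ext_br x (ext_br y z) + ext_br y (ext_br z x) + ext_br z (ext_br x y) = 0.
Proof.
case: x y z => [D1 a] [D2 b] [D3 c]; congr pair; last exact: theta_LR_cocycle_jacobi.
apply: theta_LR_ext => f.
change (D1 (D2 (D3 f) - D3 (D2 f)) - (D2 (D3 (D1 f)) - D3 (D2 (D1 f)))
  + (D2 (D3 (D1 f) - D1 (D3 f)) - (D3 (D1 (D2 f)) - D1 (D3 (D2 f))))
  + (D3 (D1 (D2 f) - D2 (D1 f)) - (D1 (D2 (D3 f)) - D2 (D1 (D3 f)))) = 0).
by rewrite !(thetaD, thetaN); ring.
Qed.

Hypothesis k0 : [pchar k] =i pred0.

Lemma ext_br_xx x : ext_br x x = 0.
Proof.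
have : 2 *: ext_br x x = 0 by rewrite scaler_nat mulr2n {1}ext_brC addNr.
by move/(congr1 ( *:%R (half R))); rewrite scaler0 (halfK k0).
Qed.

Definition ext_proj_fun (x : ext_type) : theta_LR phi := x.1.
Fact ext_proj_linear : linear ext_proj_fun. Proof. by []. Qed.
HB.instance Definition _ := GRing.isLinear.Build R ext_type (theta_LR phi) _
  ext_proj_fun ext_proj_linear.

Definition ext_incl_fun (y : theta_hat phi) : ext_type := (theta_incl y.1, y.2).
Fact ext_incl_linear : linear ext_incl_fun.
Proof. by move=> r [D a] [E b]; congr pair; exact: theta_LR_ext. Qed.
HB.instance Definition _ := GRing.isLinear.Build R (theta_hat phi) ext_type _
  ext_incl_fun ext_incl_linear.

Definition ext_unit : ext_type := (0, 1).

Fact ext_proj_fun_surj (D : theta_LR phi) : exists x, ext_proj_fun x = D.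
Proof. by exists (D, 0). Qed.

Fact ext_proj_fun_ker x : ext_proj_fun x = 0 <-> exists r : R, x = r *: ext_unit.
Proof.
case: x => D a; rewrite /ext_proj_fun /=; split=> [->|[r [-> _]]].
  by exists a; congr pair; rewrite ?scaler0 //= [RHS]mulr1.
by rewrite scaler0.
Qed.

Fact ext_unit_free r : r *: ext_unit = 0 -> r = 0.
Proof. by case=> _; rewrite [LHS]mulr1. Qed.

Fact ext_unit_central x : ext_br x ext_unit = 0.
Proof.
case: x => D a; congr pair.
  apply: theta_LR_ext => f; change (D 0 - 0 = 0); rewrite subr0.
  by apply: (addrI (D 0)); rewrite -thetaD !addr0.
change (theta_LR_cocycle D 0 + (anchor phi D 1 - anchor phi (0 : theta_LR phi) a) = 0).
rewrite (der1 (anchor_der D)) /anchor coef_t0 subr0 addr0.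
by rewrite /theta_LR_cocycle /residue_cocycle mulr0 /Defs.res coef_t0 mulr0.
Qed.

Fact ext_incl_fun_bracket (x y : theta_hat phi) :
  ext_incl_fun (theta_hat_bracket x y) = ext_br (ext_incl_fun x) (ext_incl_fun y).
Proof.
case: x y => [D a] [E b]; congr pair; first exact: theta_LR_ext.
by rewrite /= virasoro_cocycleE !anchor_theta subrr addr0.
Qed.

Fact ext_incl_fun_c0 : ext_incl_fun (0, 1) = ext_unit.
Proof. by congr pair; exact: theta_LR_ext. Qed.

Definition theta_hat_LR : theta_hat_LR_extension phi :=
  @Build_theta_hat_LR_extension k R L phi ext_type ext_br ext_unit
    ext_proj_fun ext_incl_fun ext_br_Dl ext_br_Dr ext_br_xx ext_br_jacobi
    ext_br_leibniz (fun=> fun=> erefl) ext_proj_fun_surj ext_proj_fun_ker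
    ext_unit_free ext_unit_central ext_incl_fun_bracket ext_incl_fun_c0 (fun=> erefl).

Lemma theta_hat_LR_quotient : extension_quotient theta_hat_LR.
Proof.
split.
- move=> [D a] /=; split=> [[[E b] [-> _]]|[E DE]]; first by exists E.
  by exists (E, a); congr pair.
- move=> D; split=> [[E ->] r|]; last exact: anchor0_theta.
  by rewrite anchor_theta.
- exact: anchor_der.
- by move=> d dP; exists (horizontal_lift phi dP); exact: anchor_lift.
Qed.
End Extension.

(** * Enveloping algebras and their fractions *)

Section EnvelopingInduction.
Variables (R : comNzRingType) (V : lmodType R) (br : V -> V -> V).

Lemma uclassD x y : uclass br (UAdd x y) = uclass br x + uclass br y.
Proof. by rewrite [RHS]/GRing.add /= uaddE. Qed.
Lemma uclassM x y : uclass br (UMul x y) = uclass br x * uclass br y.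
Proof. by rewrite [RHS]/GRing.mul /= umulE. Qed.
Lemma uclassC r : uclass br (UCst V r) = r%:A.
Proof. by rewrite -[LHS]mulr1. Qed.

Lemma uea_ind (P : uea br -> Prop) :
  (forall v, P (ugen br v)) -> (forall r, P r%:A) ->
  (forall x y, P x -> P y -> P (x + y)) -> (forall x y, P x -> P y -> P (x * y)) ->
  forall u, P u.
Proof.
move=> Pg Pc Pa Pm; elim/ueaW; elim=> [v|r|x Px y Py|x Px y Py].
- exact: Pg.
- by rewrite uclassC.
- by rewrite uclassD; exact: Pa.
- by rewrite uclassM; exact: Pm.
Qed.
End EnvelopingInduction.

Section EnvelopingDerivation.
Variables (k : fieldType) (R : comAlgType k) (V : lmodType R) (br : V -> V -> V).
Variables (d : R -> R) (D : V -> V).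
Hypothesis dP : is_k_derivation_of_R d.
Hypothesis DD : forall v w, D (v + w) = D v + D w.
Hypothesis DZ : forall r v, D (r *: v) = d r *: v + r *: D v.
Hypothesis Dbr : forall v w, D (br v w) = br (D v) w + br v (D w).

(** A derivation over d is not R-linear, so it is no direct instance of the universal property over
    R. It is defined on terms, with values in the quotient, and then checked against each relation
    of the presentation. *)
Fixpoint uder_term (x : uterm V) : uea br :=
  match x with
  | UGen v => ugen br (D v)
  | UCst r => (d r)%:A
  | UAdd y z => uder_term y + uder_term z
  | UMul y z => uder_term y * uclass br z + uclass br y * uder_term z
  end.

Lemma ueq_uder x y : ueq br x y -> uder_term x = uder_term y.
Proof.
elim=> {x y} /=.
- by [].
- by move=> x y _ ->.
- by move=> y x z _ -> _ ->.
- by move=> x x' y y' _ -> _ ->.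
- move=> x x' y y' xx -> yy ->.
  by rewrite (iffRL (uclassP _ _ _) xx) (iffRL (uclassP _ _ _) yy).
- by move=> x y z; rewrite addrA.
- by move=> x y; rewrite addrC.
- by move=> x; rewrite (der0 dP) scale0r add0r.
- by move=> x y z; rewrite !uclassM mulrDl mulrDr !mulrA addrA.
- by move=> x; rewrite (der1 dP) scale0r mul0r add0r uclassC scale1r mul1r.
- by move=> x; rewrite (der0 dP) uclassC !scale0r !mul0r addr0.
- by move=> x y z; rewrite uclassD !mulrDl addrACA.
- by move=> x y z; rewrite uclassD !mulrDr addrACA.
- by move=> r s; rewrite (derD dP) scalerDl.
- by move=> r s; rewrite (derM dP) !uclassC -!scalerAl !mul1r !scalerA -scalerDl mulrC.
- by move=> r x; rewrite uclassC -!scalerAl -!scalerAr !mul1r !mulr1 addrC.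
- by move=> v w; rewrite DD raddfD.
- move=> r v; rewrite DZ raddfD /= !linearZ /= uclassC -!scalerAl !mul1r //.
- move=> v w; rewrite Dbr raddfD /= -!ugenB -!/(ugen _ _).
  by rewrite !addrA [RHS](ACl (1 * 3 * (4 * 5) * (2 * 6)))%AC /= !addNr !addr0.
Qed.

Definition uder (u : uea br) : uea br := uder_term (repr u).

Lemma uderE x : uder (uclass br x) = uder_term x.
Proof. by apply: ueq_uder; exact: repr_uclass. Qed.

Lemma uder_gen v : uder (ugen br v) = ugen br (D v).
Proof. exact: uderE. Qed.
Lemma uder_cst r : uder r%:A = (d r)%:A.
Proof. by rewrite -uclassC uderE. Qed.
Lemma uderD u v : uder (u + v) = uder u + uder v.
Proof. by elim/ueaW: u => x; elim/ueaW: v => y; rewrite -uclassD !uderE. Qed.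
Lemma uderM u v : uder (u * v) = uder u * v + u * uder v.
Proof. by elim/ueaW: u => x; elim/ueaW: v => y; rewrite -uclassM !uderE. Qed.
Lemma uderZ r u : uder (r *: u) = d r *: u + r *: uder u.
Proof. by rewrite -!(mulr_algl _ u) -(mulr_algl _ (uder u)) uderM uder_cst. Qed.
End EnvelopingDerivation.

Section FracModule.
Variables (R : comNzRingType) (U : algType R) (S : U -> Prop) (z : U).
Hypothesis zC : forall b : U, b * z = z * b.
Local Notation F := (fracmod S z).
Local Notation act := (@act R U S z).
Local Notation divz := (@Defs.divz R U S z).
Local Notation frac := (@Defs.frac R U S z).
Implicit Types (a b u : U) (x y : F) (r : R).

Lemma fracD u v n : frac (u + v) n = frac u n + frac v n.
Proof. by rewrite [RHS]/GRing.add /= frac_addE1. Qed.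
Lemma fracZ r u n : frac (r *: u) n = r *: frac u n.
Proof. by rewrite [RHS]/GRing.scale /= frac_scaleE. Qed.

(* Two fractions have a common denominator. *)
Lemma fracW2 (P : F -> F -> Prop) :
  (forall u v n, P (frac u n) (frac v n)) -> forall x y, P x y.
Proof.
move=> H; elim/fracW=> u m; elim/fracW=> v n.
by rewrite -(frac_cancel S z u n m) -(frac_cancel S z v m n) addnC.
Qed.

Lemma actE a u n : act a (frac u n) = frac (a * u) n.
Proof. exact: act_frac. Qed.

Lemma act_linear a r x y : act a (r *: x + y) = r *: act a x + act a y.
Proof.
move: x y; apply: fracW2 => u v n.
by rewrite -fracZ -fracD !actE -fracZ -fracD mulrDr scalerAr.
Qed.
Lemma divz_linear r x y : divz (r *: x + y) = r *: divz x + divz y.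
Proof.
by move: x y; apply: fracW2 => u v n; rewrite -fracZ -fracD !divz_frac -fracZ -fracD.
Qed.
Lemma actDl a b x : act (a + b) x = act a x + act b x.
Proof. by elim/fracW: x => u n; rewrite !actE mulrDl fracD. Qed.
Lemma actZl r a x : act (r *: a) x = r *: act a x.
Proof. by elim/fracW: x => u n; rewrite !actE -fracZ scalerAl. Qed.
Lemma act1 x : act 1 x = x.
Proof. by elim/fracW: x => u n; rewrite actE mul1r. Qed.
Lemma actM a b x : act (a * b) x = act a (act b x).
Proof. by elim/fracW: x => u n; rewrite !actE mulrA. Qed.
Lemma act_sum (I : Type) (s : seq I) (G : I -> U) x :
  act (\sum_(i <- s) G i) x = \sum_(i <- s) act (G i) x.
Proof.
elim/big_rec2: _ => [|i y u _ <-]; last by rewrite actDl.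
by rewrite -(scale0r (0 : U)) actZl scale0r.
Qed.
Lemma divzK x : act z (divz x) = x.
Proof.
elim/fracW: x => u n; rewrite divz_frac actE.
exact: (frac_cancel S z u 1 n).
Qed.
Lemma act_divz a x : act a (divz x) = divz (act a x).
Proof. by elim/fracW: x => u n; rewrite !(divz_frac, actE). Qed.

Lemma frac_ideal u n : left_ideal S u -> frac u n = 0.
Proof.
move=> Su; rewrite -[RHS](frac0 S z n); apply/fracP; exists 0%N => /=.
by rewrite mulr0 subr0; do 2 apply: left_idealM.
Qed.

Section FracDerivation.
Variables (d : R -> R) (D : U -> U).
Hypothesis DD : forall u v, D (u + v) = D u + D v.
Hypothesis DM : forall u v, D (u * v) = D u * v + u * D v.
Hypothesis DZ : forall r u, D (r *: u) = d r *: u + r *: D u.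
Hypothesis D1 : D 1 = 0.
Hypothesis Dz : D z = 0.
Hypothesis DS : forall u, S u -> S (D u).

Lemma left_ideal_der u : left_ideal S u -> left_ideal S (D u).
Proof.
have D0 : D 0 = 0 by apply: (addrI (D 0)); rewrite -DD !addr0.
case=> s Ss ->; rewrite (big_morph D DD D0); move: Ss.
elim: s => [|p s IH] Ss; first by rewrite big_nil; exact: left_ideal0.
have Sp : S p.2 by apply: Ss; rewrite inE eqxx.
rewrite big_cons DM; apply: left_idealD.
  apply: left_idealD.
    by exists [:: (D p.1, p.2)] => [q|]; rewrite ?big_seq1 // inE => /eqP ->.
  by exists [:: (p.1, D p.2)] => [q|]; rewrite ?big_seq1 // inE => /eqP -> /=; exact: DS.
by apply: IH => q qs; apply: Ss; rewrite inE qs orbT.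
Qed.

Definition fder x : F := frac (D (repr x).1) (repr x).2.

Lemma fderE u n : fder (frac u n) = frac (D u) n.
Proof.
have DN v : D (- v) = - D v.
  by apply/eqP; rewrite -addr_eq0 -DD addNr; apply/eqP/(addrI (D 0)); rewrite -DD !addr0.
have DX m v : D (z ^+ m * v) = z ^+ m * D v.
  elim: m v => [|m IH] v; first by rewrite !mul1r.
  by rewrite !exprS -!mulrA DM Dz mul0r add0r IH.
case: (repr_frac S z u n); rewrite /fder.
case: (repr (frac u n)) => [u' n'] /= p Hp; apply/fracP; exists p => /=.
by have := left_ideal_der Hp; rewrite DX DD DN !DX.
Qed.

Lemma fderD x y : fder (x + y) = fder x + fder y.
Proof. by move: x y; apply: fracW2 => u v n; rewrite -fracD !fderE -fracD DD. Qed.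
Lemma fderZ r x : fder (r *: x) = d r *: x + r *: fder x.
Proof. by elim/fracW: x => u n; rewrite -fracZ !fderE DZ fracD !fracZ. Qed.
Lemma fder_vac : fder (vac S z) = 0.
Proof. by rewrite fderE D1. Qed.
Lemma fder_act a x : fder (act a x) = act (D a) x + act a (fder x).
Proof. by elim/fracW: x => u n; rewrite !(actE, fderE) DM fracD. Qed.
Lemma fder_divz x : fder (divz x) = divz (fder x).
Proof. by elim/fracW: x => u n; rewrite !(divz_frac, fderE). Qed.
End FracDerivation.
End FracModule.

(* Multiplication by a generator on the left is continuous for the topology of
   the left ideals generated by the subsets [deep N]. *)
Section Smoothness.
Variables (R : comNzRingType) (V : lmodType R) (br : V -> V -> V).
Variable deep : int -> V -> Prop.
Hypothesis deepW : forall M N v, M <= N -> deep N v -> deep M v.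
Hypothesis deep_br : forall v M, exists N, forall w, deep N w -> deep M (br w v).

Definition deep_gen (M : int) (u : uea br) : Prop := exists2 w, deep M w & u = ugen br w.

Lemma left_ideal_gen (M : int) (u : uea br) w :
  deep M w -> left_ideal (deep_gen M) (u * ugen br w).
Proof.
move=> Mw; exists [:: (u, ugen br w)]; last by rewrite big_seq1.
by move=> p; rewrite inE => /eqP ->; exists w.
Qed.

(** A deep generator w passes a generator v at the cost of [w, v], which is deep again. For a
    product x y, w must first pass x with a result of depth M', where M' is what passing y
    requires. *)
Lemma uea_smooth (u : uea br) M :
  exists N, forall w, deep N w -> left_ideal (deep_gen M) (ugen br w * u).
Proof.
elim/uea_ind: u M => [v|r|x y Hx Hy|x y Hx Hy] M.
- have [N HN] := deep_br v M; exists (Num.max M N) => w wN.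
  rewrite -(subrK (ugen br v * ugen br w) (_ * _)) ugenB -[ugen br (br w v)]mul1r.
  apply: left_idealD; apply: left_ideal_gen.
    by apply/HN/(deepW _ wN); rewrite le_max lexx orbT.
  by apply: deepW wN; rewrite le_max lexx.
- exists M => w wM; rewrite -scalerAr mulr1 -mulr_algl; exact: left_ideal_gen.
- have [a Ha] := Hx M; have [b Hb] := Hy M; exists (Num.max a b) => w wN.
  rewrite mulrDr; apply: left_idealD.
    by apply/Ha/(deepW _ wN); rewrite le_max lexx.
  by apply/Hb/(deepW _ wN); rewrite le_max lexx orbT.
- have [M' HM'] := Hy M; have [N HN] := Hx M'; exists N => w /HN [s Ss E].
  rewrite mulrA E mulr_suml; move: Ss; elim: s {E} => [|p s IH] Ss.
    by rewrite big_nil; exact: left_ideal0.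
  rewrite big_cons; apply: left_idealD; last first.
    by apply: IH => q qs; apply: Ss; rewrite inE qs orbT.
  have [w' w'M ->] : deep_gen M' p.2 by apply: Ss; rewrite inE eqxx.
  by rewrite -mulrA; apply/left_idealM/HM'.
Qed.

Lemma fock_smooth (S : uea br -> Prop) (z : uea br) (x : fracmod S z) :
  (forall b, b * z = z * b) -> (forall w, deep 1 w -> S (ugen br w)) ->
  exists N, forall w, deep N w -> act (ugen br w) x = 0.
Proof.
move=> zC SP; elim/fracW: x => u n; have [N HN] := uea_smooth u 1.
exists N => w /HN [s Ss E]; rewrite act_frac //; apply: frac_ideal; rewrite E.
by exists s => // p /Ss [w' w'1 ->]; exact: SP.
Qed.
End Smoothness.

Section Commutators.
Variable V : zmodType.
Implicit Types u w : V -> V.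

Definition opcomm u w (v : V) : V := u (w v) - w (u v).

(** The three summands will be the vertical, horizontal and central parts of the representation; the
    grouping makes each cross commutator start with the horizontal operator. *)
Lemma opcomm_expand u1 u2 u3 w1 w2 w3 v :
  {morph u1 : x y / x + y} -> {morph u2 : x y / x + y} -> {morph u3 : x y / x + y} ->
  {morph w1 : x y / x + y} -> {morph w2 : x y / x + y} -> {morph w3 : x y / x + y} ->
  opcomm (fun x => u1 x + u2 x + u3 x) (fun x => w1 x + w2 x + w3 x) v =
  (opcomm u1 w1 v + (opcomm u2 w1 v - opcomm w2 u1 v)) + opcomm u2 w2 v
  + (opcomm u2 w3 v - opcomm w2 u3 v)
  + (opcomm u1 w3 v + opcomm u3 w1 v + opcomm u3 w3 v).
Proof.
move=> a1 a2 a3 b1 b2 b3; rewrite /opcomm !(a1, a2, a3, b1, b2, b3) !opprD !opprK !addrA.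
by rewrite [LHS](ACl
  (1 * 10 * 4 * 11 * 13 * 2 * 5 * 14 * 6 * 17 * 15 * 8 * 3 * 16 * 7 * 12 * 9 * 18))%AC.
Qed.
End Commutators.

Lemma scaler_swap (R : comNzRingType) (F : lmodType R) (r s : R) (x : F) :
  r *: (s *: x) = s *: (r *: x).
Proof. by rewrite !scalerA mulrC. Qed.

(** * Sugawara operators on smooth modules *)

Section Sugawara.
Variables (k : fieldType) (k0 : [pchar k] =i pred0).
Variables (R : comAlgType k) (L : comAlgType R) (phi : coordinate L).
Variables (F : lmodType R) (n : nat) (J : 'I_n -> L -> {linear F -> F}).
Variables (c zi : {linear F -> F}) (C : 'I_n -> 'I_n -> 'I_n -> R) (h : R).
Implicit Types (f g p q u A B : L) (l m : int) (v x y : F) (a b : 'I_n).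
Local Notation half := (half R).
Local Notation sixth := (sixth R).
Local Notation twelfth := (twelfth R).
Local Notation "'t^ n" := (tpow phi n) (at level 2, n at level 2, format "''t^' n").
Local Notation mpow := (mpow phi).
Local Notation res := (res phi).
Local Notation ddt := (ddt phi).
Local Notation contract := (contract phi).
Local Notation contract1 := (contract1 phi).

Hypothesis J_linear : forall a v, linear_fun (fun f => J a f v).
Hypothesis J_comm : forall a b f g v, J a f (J b g v) =
  J b g (J a f v) + \sum_e C a b e *: J e (f * g) v
    + (a == b)%:R *: (res (g * ddt f) *: c v).
Hypothesis J_smooth : forall v, exists N, forall a f, mpow N f -> J a f v = 0.
Hypothesis c_J : forall a f v, c (J a f v) = J a f (c v).
Hypothesis zi_J : forall a f v, zi (J a f v) = J a f (zi v).
Hypothesis zi_c : forall v, zi (c v) = c (zi v).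
Hypothesis ziK : forall v, zi (c v + h *: v) = v.
(** For structure constants in an orthonormal basis, [C_rot] and the two diagonal conditions express
    their total antisymmetry, and [C_casimir] says that the Casimir element acts on the adjoint
    representation by 2h. *)
Hypothesis C_rot : forall a b e, C e b a = - C a b e.
Hypothesis C_diag : forall a e, C a a e = 0.
Hypothesis C_diag13 : forall a b, C a b a = 0.
Hypothesis C_casimir : forall b d,
  \sum_a \sum_e C a b e * C a e d = (b == d)%:R * (2 * h).

Lemma contlin_J a v : contlin phi (fun f => J a f v).
Proof. by split=> //; case: (J_smooth v) => N H; exists N => f /H. Qed.

Lemma J_D a f v x : J a f (v + x) = J a f v + J a f x. Proof. exact: linearD. Qed.
Lemma J_Z a f r v : J a f (r *: v) = r *: J a f v. Proof. exact: linearZ. Qed.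
Lemma J_N a f v : J a f (- v) = - J a f v. Proof. exact: linearN. Qed.
Lemma J_sum a f (I : Type) (r : seq I) (G : I -> F) :
  J a f (\sum_(i <- r) G i) = \sum_(i <- r) J a f (G i).
Proof. exact: raddf_sum. Qed.

Definition kernel (M : 'I_n -> 'I_n -> R) v p q : F :=
  \sum_a \sum_e M a e *: J a p (J e q v).
Definition casimir v p q : F := \sum_a J a p (J a q v).

Lemma kernel_smooth M v : smooth_kernel phi (kernel M v).
Proof.
split.
- move=> q; apply: contlin_sum => a; apply: contlin_sum => e.
  exact/contlinZ/contlin_J.
- move=> p r q q'; rewrite /kernel scaler_sumr -big_split; apply: eq_bigr => a _ /=.
  rewrite scaler_sumr -big_split; apply: eq_bigr => e _ /=.
  by rewrite J_linear linearP scalerDr !scalerA mulrC.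
- case: (J_smooth v) => N H; exists N => p q qN; rewrite /kernel big1 // => a _.
  by rewrite big1 // => e _; rewrite H // linear0 scaler0.
Qed.

Lemma casimirE v : casimir v = kernel (fun a e => (a == e)%:R) v.
Proof.
apply: eq_kernel => p q; apply: eq_bigr => a _.
rewrite (bigD1 a) //= eqxx scale1r big1 ?addr0 // => e ea.
by rewrite eq_sym (negbTE ea) scale0r.
Qed.

Lemma casimir_smooth v : smooth_kernel phi (casimir v).
Proof. by rewrite casimirE; exact: kernel_smooth. Qed.

Lemma casimir_linear r v v' p q :
  casimir (r *: v + v') p q = r *: casimir v p q + casimir v' p q.
Proof.
rewrite /casimir scaler_sumr -big_split; apply: eq_bigr => a _ /=.
by rewrite !linearP.
Qed.

Definition quadratic_sum A v : F := contract (casimir v) A 1 + contract (casimir v) 1 A.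

Lemma quadratic_sum_linear A r v v' :
  quadratic_sum A (r *: v + v') = r *: quadratic_sum A v + quadratic_sum A v'.
Proof.
rewrite /quadratic_sum scalerDr addrACA; congr (_ + _).
  by apply: tsum_linear => [||l]; try exact: (kernel_finite _ _ (casimir_smooth _)); exact: casimir_linear.
by apply: tsum_linear => [||l]; try exact: (kernel_finite _ _ (casimir_smooth _)); exact: casimir_linear.
Qed.

Lemma contlin_quadratic_sum v : contlin phi (fun A => quadratic_sum A v).
Proof.
by apply: contlinD; [exact/contlin_contract_l/casimir_smooth|
  exact/contlin_contract_r/casimir_smooth].
Qed.

Lemma quadratic_sum_comm (u : F -> F) A v : u 0 = 0 -> {morph u : x y / x + y} ->
  (forall a f x, u (J a f x) = J a f (u x)) -> u (quadratic_sum A v) = quadratic_sum A (u v).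
Proof.
move=> u0 uD uJ; have uC p q : u (casimir v p q) = casimir (u v) p q.
  by rewrite /casimir (big_morph u uD u0); apply: eq_bigr => a _; rewrite !uJ.
rewrite uD /contract !(tsum_morph u0 uD); try exact: (kernel_finite _ _ (casimir_smooth _)).
by congr (_ + _); apply: eq_tsum => l; exact: uC.
Qed.

(** Commuting [J b g] past either mode gives a structure term and a central term. [C_rot] rewrites
    the second structure term as minus the kernel of the first, so the two differ only in the
    argument that carries g. *)
Lemma casimir_J b g v p q : casimir (J b g v) p q = J b g (casimir v p q)
  + (kernel (fun a e => C a b e) v p (g * q) - kernel (fun a e => C a b e) v (g * p) q)
  - (res (ddt g * q) *: c (J b p v) + res (ddt g * p) *: c (J b q v)).
Proof.
have ibp f f' : res (f * ddt f') = - res (ddt f * f').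
  by apply/eqP; rewrite -addr_eq0 addrC -resD -ddtM res_ddt.
have delta (G : 'I_n -> F) : \sum_a (a == b)%:R *: G a = G b.
  rewrite (bigD1 b) //= eqxx scale1r big1 ?addr0 // => a /negbTE ->.
  by rewrite scale0r.
have E a : J a p (J a q (J b g v)) = J b g (J a p (J a q v))
    + (\sum_e C a b e *: J a p (J e (g * q) v)
       + \sum_e C a b e *: J e (g * p) (J a q v))
    + ((a == b)%:R *: (res (g * ddt q) *: c (J a p v))
       + (a == b)%:R *: (res (g * ddt p) *: c (J a q v))).
  rewrite (J_comm a b q g v) !J_D (J_comm a b p g (J a q v)).
  rewrite J_sum !J_Z -c_J -[in RHS](mulrC q) -[in RHS](mulrC p).
  under [X in _ + X + _ = _]eq_bigr do rewrite J_Z.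
  set x0 := J b g _; set x1 := \sum_e _; set x2 := _ *: (_ *: c (J a q v)).
  set x3 := \sum_e _; set x4 := _ *: _.
  by rewrite [LHS](ACl (1 * (4 * 2) * (5 * 3)))%AC.
rewrite {1}/casimir (eq_bigr _ (fun a _ => E a)) !big_split /= !delta -J_sum.
congr (_ + _ + _).
  congr (_ + _); rewrite exchange_big -sumrN /=; apply: eq_bigr => a _.
  by rewrite -sumrN; apply: eq_bigr => e _; rewrite C_rot scaleNr.
by rewrite !ibp !scaleNr opprD.
Qed.

Definition structure_term b v A g : F :=
  contract (kernel (fun a e => C a b e) v) A g
  - contract (kernel (fun a e => C a b e) v) (A * g) 1
  + (contract (kernel (fun a e => C a b e) v) 1 (A * g)
     - contract (kernel (fun a e => C a b e) v) g A).

(** Antisymmetry of C in its outer indices turns the symmetrization into a sum of mode commutators.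
    Their central terms have a = e, where C vanishes, and their structure terms are contracted by
    the Casimir identity. *)
Lemma structure_symm b v p q : kernel (fun a e => C a b e) v p q
  + kernel (fun a e => C a b e) v q p = (2 * h) *: J b (p * q) v.
Proof.
rewrite /kernel [X in _ + X]exchange_big -big_split /=.
under eq_bigr => a _.
  rewrite -big_split /=.
  under eq_bigr => e _.
    rewrite [C e b a]C_rot scaleNr -scalerBr J_comm -[X in X - _]addrA addrAC subrr add0r.
    rewrite scalerDr.
    have -> : C a b e *: ((a == e)%:R *: (res (q * ddt p) *: c v)) = 0.
      by case: eqP => [<-|_]; rewrite ?C_diag13 ?scale0r ?scaler0.
    rewrite addr0 scaler_sumr.
    over.
  rewrite exchange_big /=.
  over.
rewrite exchange_big /=.
under eq_bigr => d _.
  under eq_bigr => a _ do (under eq_bigr => e _ do rewrite scalerA; rewrite -scaler_suml).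
  rewrite -scaler_suml C_casimir -scalerA.
  over.
rewrite (bigD1 b) //= eqxx scale1r big1 ?addr0 // => d.
by rewrite eq_sym => /negbTE ->; rewrite scale0r.
Qed.

(** For g = t^m the infinite sums cancel; the two boundary sums, one of them reversed, combine by
    [structure_symm] into m equal terms, which produce the derivative m t^(m-1). *)
Lemma structure_termE b v A g :
  structure_term b v A g = - ((2 * h) *: J b (A * ddt g) v).
Proof.
set s := kernel (fun a e => C a b e) v; have sk : smooth_kernel phi s := kernel_smooth _ _.
apply/eqP; rewrite -addr_eq0; apply/eqP; move: g.
apply: (monomial_reduction (phi := phi)) => [|m].
  apply: contlinD; last exact/contlinZ/(contlin_ddt (contlinM A (contlin_J b v))).
  apply: contlinD; apply: contlinD.
  - exact: contlin_contract_r.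
  - exact/contlinN/(contlinM A (contlin_contract_l 1 sk)).
  - exact: (contlinM A (contlin_contract_r 1 sk)).
  - exact/contlinN/contlin_contract_l.
rewrite /structure_term -/s [A * _]mulrC (contract_shift m A 1 sk) mulr1.
have := contract_shift m 1 A sk; rewrite mulr1 => ->.
rewrite !opprD !addrA subrr add0r.
rewrite addrK -(isum_rev _ (fun l => s (_ * 1) _)) -opprD -isumD.
rewrite (@eq_isum _ _ _ (fun=> (2 * h) *: J b ('t^(m - 1) * A) v)) => [|l].
  rewrite isum_const ddt_tpow mulrzAr (linear_funMz (J_linear b v)) [A * _]mulrC.
  by rewrite scalerMzr addNr.
rewrite !mulr1 (_ : m - (m - 1 - l) - 1 = l); last lia.
rewrite (_ : m - 1 - l = m - l - 1); last lia.
by rewrite structure_symm mulrAC -tpowD (_ : m - l - 1 + l = m - 1) //; lia.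
Qed.

Lemma quadratic_sum_J b A g v : quadratic_sum A (J b g v) = J b g (quadratic_sum A v)
  - 2 *: (c (J b (A * ddt g) v) + h *: J b (A * ddt g) v).
Proof.
pose Phi f := c (J b f v); pose s := kernel (fun a e => C a b e) v.
have PhiC : contlin phi Phi.
  by apply: (contlin_comp (u := c)) (contlin_J b v) => r x y; exact: linearP.
(* [R1] and [R2] are the central terms from commuting past the right and the left mode. *)
pose R1 f u := tsum (fun l => res (f * 't^l) *: Phi ('t^(- l - 1) * u)).
pose R2 f u := tsum (fun l => res (f * 't^(- l - 1)) *: Phi ('t^l * u)).
have E u w : contract (casimir (J b g v)) u w = J b g (contract (casimir v) u w)
    + (contract s u (w * g) - contract s (u * g) w)
    - (R1 (ddt g * w) u + R2 (ddt g * u) w).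
  have sk := kernel_smooth (fun a e => C a b e) v.
  have csk := casimir_smooth v.
  have f1 := kernel_finite (fun l => 't^(- l - 1) * u) w csk.
  have f1' : finite_above (fun l => J b g (casimir v ('t^(- l - 1) * u) ('t^l * w))).
    by case: f1 => N H; exists N => l /H ->; rewrite linear0.
  have f2 := kernel_finite (fun l => 't^(- l - 1) * u) (w * g) sk.
  have f3 := kernel_finite (fun l => 't^(- l - 1) * (u * g)) w sk.
  have f4 := residue_finite_l phi Phi (ddt g * w) (fun l => 't^(- l - 1) * u).
  have f5 := residue_finite_r w (fun l => res (ddt g * u * 't^(- l - 1))) PhiC.
  rewrite /R1 /R2 /contract (tsum_morph (f := J b g)) ?linear0 //; last exact: J_D.
  rewrite -tsumD // -tsumB // -tsumD //; last exact: finite_aboveB.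
  rewrite -tsumB; [|exact/finite_aboveD/finite_aboveB|exact: finite_aboveD].
  apply: eq_tsum => l; rewrite casimir_J.
  by rewrite !(mulrC g) -!mulrA (mulrC w 't^l) (mulrC u 't^(- l%:Z - 1)).
rewrite /quadratic_sum !E J_D !mul1r !mulr1.
(* Each [R1] joins the [R2] of the other half of the quadratic sum; each pair is a complete residue
   expansion of [Phi] at A g'. *)
have RE : R1 (ddt g) A + R2 (ddt g * A) 1 + (R1 (ddt g * A) 1 + R2 (ddt g) A)
    = 2 *: c (J b (A * ddt g) v).
  rewrite [_ + R2 (ddt g) A]addrC addrACA [R2 (ddt g * A) 1 + _]addrC.
  rewrite !(residue_expansion _ _ PhiC) mul1r [ddt g * A]mulrC.
  by rewrite scaler_nat mulr2n.
have := structure_termE b v A g; rewrite /structure_term -/s => SE.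
rewrite addrACA -opprD RE [X in X - _]addrACA SE.
by rewrite [2 *: (_ + _)]scalerDr scalerA opprD addrA [RHS]addrAC.
Qed.

Definition sugawara_op A v : F := - (half *: zi (quadratic_sum A v)).

Lemma sugawara_op_linear A r v v' : sugawara_op A (r *: v + v') = r *: sugawara_op A v + sugawara_op A v'.
Proof.
rewrite /sugawara_op quadratic_sum_linear linearP scalerDr opprD scalerN !scalerA.
by rewrite [half * r]mulrC.
Qed.

Lemma sugawara_op_J b A g v : sugawara_op A (J b g v) = J b g (sugawara_op A v) + J b (A * ddt g) v.
Proof.
rewrite /sugawara_op quadratic_sum_J linearB [zi (2 *: _)]linearZ /= ziK scalerBr (halfK k0).
by rewrite opprB addrC zi_J J_N J_Z.
Qed.

Lemma sugawara_opD A x y : sugawara_op A (x + y) = sugawara_op A x + sugawara_op A y.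
Proof. by have := sugawara_op_linear A 1 x y; rewrite !scale1r. Qed.
Lemma sugawara_op0 A : sugawara_op A 0 = 0.
Proof. by apply: (addrI (sugawara_op A 0)); rewrite -sugawara_opD !addr0. Qed.

Lemma contlin_sugawara_op v : contlin phi (fun A => sugawara_op A v).
Proof.
apply: (contlin_comp (u := fun x => - (half *: zi x))) (contlin_quadratic_sum v) => r x y.
by rewrite linearP scalerDr opprD scalerN !scalerA [half * r]mulrC.
Qed.

Lemma sugawara_op_comm (u : F -> F) A v : (forall r x y, u (r *: x + y) = r *: u x + u y) ->
  (forall a f x, u (J a f x) = J a f (u x)) -> (forall x, u (zi x) = zi (u x)) ->
  u (sugawara_op A v) = sugawara_op A (u v).
Proof.
move=> uL uJ uz; have uD : {morph u : x y / x + y}.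
  by move=> x y; have := uL 1 x y; rewrite !scale1r.
have u0 : u 0 = 0 by apply: (addrI (u 0)); rewrite -uD !addr0.
rewrite /sugawara_op -scaleNr -[- half *: _]addr0 uL u0 addr0 uz quadratic_sum_comm //.
by rewrite scaleNr.
Qed.

Lemma sugawara_op_casimir A v p q : sugawara_op A (casimir v p q) =
  casimir (sugawara_op A v) p q + casimir v (A * ddt p) q + casimir v p (A * ddt q).
Proof.
rewrite /casimir (big_morph _ (sugawara_opD A) (sugawara_op0 A)) -!big_split; apply: eq_bigr => a _ /=.
by rewrite sugawara_op_J sugawara_op_J J_D addrAC.
Qed.

(** On modes the operator acts as the derivation A d/dt. Differentiating t^(-l-1) and t^l inside the
    kernel produces the weights that [contract_tderiv] collects into double contractions. *)
Lemma sugawara_op_contract A v u w : sugawara_op A (contract (casimir v) u w) =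
  contract (casimir (sugawara_op A v)) u w
  + (contract (casimir v) (A * ddt u) w + contract (casimir v) u (A * ddt w))
  + (contract1 (casimir v) u (A * w) - contract1 (casimir v) (A * u) w).
Proof.
have csk := casimir_smooth.
have f1 := kernel_finite (fun l => 't^(- l - 1) * u) w (csk v).
rewrite -(contract_tderiv u w A (csk v)) {1}/contract (tsum_morph (sugawara_op0 A) (sugawara_opD A)) //.
have f0 := kernel_finite (fun l => 't^(- l - 1) * u) w (csk (sugawara_op A v)).
have f2 := kernel_finite (fun l => 't^(- l - 1) * (A * ddt u)) w (csk v).
have f3 := kernel_finite (fun l => 't^(- l - 1) * u) (A * ddt w) (csk v).
have f4 := kernel_finite_Mz (fun l => 't^(- l - 1 - 1) * (A * u)) w (fun l => - l - 1) (csk v).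
have f5 := kernel_finite_shift (fun l => 't^(- l - 1) * u) (-1) (A * w) id (csk v).
rewrite -[X in _ + X + _]tsumD // -tsumD; [|by []|exact: finite_aboveD].
rewrite -tsumD; [|by apply: finite_aboveD => //; exact: finite_aboveD|exact: finite_aboveD].
apply: eq_tsum => l; rewrite sugawara_op_casimir.
have D m f : A * ddt ('t^m * f) = ('t^(m - 1) * (A * f)) *~ m + 't^m * (A * ddt f).
  by rewrite ddtM ddt_tpow mulrDr mulrzAl mulrzAr !(mulrCA A).
rewrite !D (linear_funD (kernel_linr (csk v) _)) (linear_funMz (kernel_linr (csk v) _)).
rewrite (linear_funD (kernel_contl (csk v) _).1) (linear_funMz (kernel_contl (csk v) _).1).
by rewrite !addrA [LHS](ACl (1 * (3 * 5) * (2 * 4)))%AC /= !addrA.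
Qed.

(** This is the hypothesis of [contract_anomaly] with K = n c v: every index a contributes the same
    central term. *)
Lemma casimir_symm v p q :
  casimir v p q - casimir v q p = - (res (p * ddt q) *: (n%:R *: c v)).
Proof.
rewrite /casimir -sumrB.
under eq_bigr => a _.
  rewrite J_comm eqxx scale1r big1 ?addr0 => [|e _]; last by rewrite C_diag scale0r.
  rewrite addrC addKr.
  over.
rewrite sumr_const card_ord -scaler_nat scalerA mulrC -scalerA -scaleNr; congr (_ *: _).
by apply/eqP; rewrite -addr_eq0 -resD [q * _]mulrC -ddtM res_ddt.
Qed.

Lemma sugawara_op_quadratic_sum A B v : sugawara_op A (quadratic_sum B v) = quadratic_sum B (sugawara_op A v)
  + (quadratic_sum (A * ddt B - B * ddt A) v
     - (sixth * res (ddt (ddt (ddt A)) * B)) *: (n%:R *: c v)).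
Proof.
have ddt1 : ddt 1 = 0 by rewrite -(tpow0 phi) ddt_tpow mulr0z.
have := contract_anomaly (casimir_smooth v) (casimir_symm v) A B.
(* [X] gathers the double contractions and [Y] is the quadratic sum of B A'; the anomaly formula
   makes [X] equal to - [Y] up to a central term. *)
set X := _ - contract1 _ (B * A) 1 + _; set Y := contract _ (B * ddt A) 1 + _.
rewrite -scalerA; set Z := _ *: (n%:R *: _) => /eqP; rewrite addr_eq0 => /eqP XY.
have {}XY : X + Y = - (sixth *: Z) by rewrite -scalerN -XY (sixthK k0).
rewrite {1}/quadratic_sum sugawara_opD !sugawara_op_contract ddt1 mulr0 !mulr1.
rewrite (linear_fun0 (contlin_contract_l _ (casimir_smooth v)).1).
rewrite (linear_fun0 (contlin_contract_r _ (casimir_smooth v)).1) add0r addr0.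
rewrite (linear_funB (contlin_quadratic_sum v).1) -XY /quadratic_sum -/Y.
rewrite (addrC X) [X in _ = _ + X]addrA subrK /X (mulrC B A).
by rewrite !addrA [RHS](ACl (1 * 3 * 7 * 6 * 2 * 4 * 5 * 8))%AC.
Qed.

(** Only the operator of B is expanded into modes; that of A acts on them as a derivation. The
    constant 1/12 is the 1/2 in T times the 1/6 of the boundary sum. *)
Lemma sugawara_op_bracket A B v : sugawara_op A (sugawara_op B v) - sugawara_op B (sugawara_op A v) =
  sugawara_op (A * ddt B - B * ddt A) v
  + (twelfth * res (ddt (ddt (ddt A)) * B)) *: (n%:R *: c (zi v)).
Proof.
have zi_sugawara_op x : zi (sugawara_op A x) = sugawara_op A (zi x).
  by apply: sugawara_op_comm => // r y y'; exact: linearP.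
have half_sugawara_op x : sugawara_op A (- (half *: x)) = - (half *: sugawara_op A x).
  by rewrite -!scaleNr -[_ *: x]addr0 sugawara_op_linear sugawara_op0 addr0.
have -> : sugawara_op A (sugawara_op B v) = - (half *: zi (sugawara_op A (quadratic_sum B v))).
  by rewrite zi_sugawara_op -half_sugawara_op.
have -> : sugawara_op B (sugawara_op A v) = - (half *: zi (quadratic_sum B (sugawara_op A v))) by [].
rewrite sugawara_op_quadratic_sum linearD scalerDr opprD opprK addrAC addNr add0r.
rewrite linearB scalerBr opprB addrC; congr (_ + _).
rewrite !linearZ /= zi_c -half_sixth !scalerA; congr (_ *: _); ring.
Qed.

Definition normal_casimir A l v : F := let f := 't^(- l - 1) * A in
  \sum_a (J a (trunc_le phi l f) (J a 't^l v) + J a 't^l (J a (f - trunc_le phi l f) v)).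

(** In [casimir] only the coefficient of f at t^(-l) fails to commute with t^l. For l >= 0 its
    exponent is at most l, for l < 0 it exceeds l, so it already stands on the side shown, and the
    other part of f may be moved there. *)
Lemma normal_casimirE A l v : normal_casimir A l v =
  if 0 <= l then casimir v ('t^(- l - 1) * A) 't^l else casimir v 't^l ('t^(- l - 1) * A).
Proof.
rewrite /normal_casimir; set f := _ * A; set f' := trunc_le phi l f.
have JD a g g' x : J a (g + g') x = J a g x + J a g' x := linear_funD (J_linear a x) g g'.
rewrite big_split /= -/(casimir v f' 't^l) -/(casimir v 't^l (f - f')).
have swap p : res (p * 't^(l - 1)) *~ l = 0 -> casimir v p 't^l = casimir v 't^l p.
  move=> p0; apply/eqP; rewrite -subr_eq0 casimir_symm ddt_tpow mulrzAr resMz p0.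
  by rewrite scale0r oppr0.
have DL p p' q : casimir v (p + p') q = casimir v p q + casimir v p' q.
  by rewrite (linear_funD (kernel_contl (casimir_smooth v) q).1).
have DR p p' q : casimir v q (p + p') = casimir v q p + casimir v q p'.
  by rewrite (linear_funD (kernel_linr (casimir_smooth v) q)).
have shift p : res (p * 't^(l - 1)) = coef phi p (- l).
  by rewrite mulrC /Defs.res coef_tpowM; congr (coef phi p _); lia.
case: leP => l0.
  rewrite -swap -?DL ?(addrC f') ?subrK //.
  rewrite shift coef_tD coef_tN coef_trunc_le.
  have [|ll] := leP (- l) l; first by rewrite subrr mul0rz.
  by rewrite (_ : l = 0) ?mulr0z //; lia.
rewrite swap -?DR ?(addrC f') ?subrK //.
by rewrite shift coef_trunc_le ifF ?mul0rz //; lia.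
Qed.

Lemma normal_casimir_sum A v : exists n0 : nat, forall m p : nat,
  (n0 <= m)%N -> (n0 <= p)%N ->
  \sum_(i < (m + p)%N.+1) normal_casimir A (i%:Z - m%:Z) v = quadratic_sum A v.
Proof.
have csk := casimir_smooth v.
have /finite_aboveP[N1 H1] := kernel_finite (fun l => 't^(- l - 1) * A) 1 csk.
have /finite_aboveP[N2 H2] := kernel_finite (fun l => 't^(- l - 1) * 1) A csk.
exists (maxn N1 N2) => m p; rewrite !geq_max => /andP[_ m2] /andP[p1 _].
rewrite /quadratic_sum /contract (tsumE (H1 p.+1 _)) ?(leqW p1) // (tsumE (H2 m m2)).
rewrite -addnS big_split_ord /= addrC; congr (_ + _).
  apply: eq_bigr => i _; rewrite normal_casimirE PoszD addrC addKr /= mulr1 //.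
(* The negative indices l = - i - 1, read downwards from -1, form the second contraction. *)
rewrite (reindex_inj rev_ord_inj) /=; apply: eq_bigr => i _.
rewrite (_ : (m - i.+1)%N%:Z - m%:Z = - i%:Z - 1); last by have := ltn_ord i; lia.
rewrite normal_casimirE ifF ?mulr1; last lia.
by congr (casimir v _ ('t^_ * _)); lia.
Qed.

Section ExtendedRepresentation.
Implicit Types (d e : R -> R).
Local Notation nabla := (nabla phi).
Local Notation anchor := (anchor phi).
Local Notation is_der := (@is_k_derivation_of_R k R).

(** On a given v both contractions are finite sums of products of two modes, so algebraic closure
    properties of M suffice. *)
Lemma sugawara_op_closed (M : F -> Prop) A v : M 0 -> (forall x y, M x -> M y -> M (x + y)) ->
  (forall a f x, M x -> M (J a f x)) -> (forall x, M x -> M (zi x)) ->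
  (forall r x, M x -> M (r *: x)) -> M v -> M (sugawara_op A v).
Proof.
move=> M0 MD MJ Mz MZ Mv; rewrite /sugawara_op -scaleNr; apply/MZ/Mz.
have MC p q : M (casimir v p q).
  by rewrite /casimir; elim/big_ind: _ => // a _; exact/MJ/MJ.
have MT u u' : M (contract (casimir v) u u').
  have csk := casimir_smooth v.
  have /finite_aboveP[N /(_ _ (leqnn N)) fN] :=
    kernel_finite (fun l => 't^(- l - 1) * u) u' csk.
  by rewrite /contract (tsumE fN); elim/big_ind: _ => // i _; exact: MC.
exact: MD.
Qed.

Variable N : (R -> R) -> F -> F.
Hypothesis N_D : forall d, is_der d -> {morph N d : v w / v + w}.
Hypothesis N_Z : forall d, is_der d -> forall r v, N d (r *: v) = d r *: v + r *: N d v.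
Hypothesis N_J : forall d, is_der d -> forall a f v,
  N d (J a f v) = J a (nabla d f) v + J a f (N d v).
Hypothesis N_c : forall d, is_der d -> forall v, N d (c v) = c (N d v).
Hypothesis N_zi : forall d, is_der d -> forall v, N d (zi v) = zi (N d v).
Hypothesis N_linear : forall r d e v, is_der d -> is_der e ->
  N (fun s => r * d s + e s) v = r *: N d v + N e v.
Hypothesis N_commutator : forall d e v, is_der d -> is_der e ->
  N (fun s => d (e s) - e (d s)) v = N d (N e v) - N e (N d v).

Lemma N0 d : is_der d -> N d 0 = 0.
Proof. by move=> dP; apply: (addrI (N d 0)); rewrite -N_D // !addr0. Qed.
Lemma N_zero v : N (fun=> 0) v = 0.
Proof.
have := N_linear (-1) v (der_zero R) (der_zero R); rewrite scaleN1r addNr => <-.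
by congr (N _ v); apply/funext=> s; rewrite mulr0 addr0.
Qed.

(** The powers of t are horizontal and d kills 1/2, so inside the sum d reaches only A. *)
Lemma N_sugawara_op d A v : is_der d ->
  N d (sugawara_op A v) = sugawara_op (nabla d A) v + sugawara_op A (N d v).
Proof.
move=> dP.
have NC p q : N d (casimir v p q) = casimir v (nabla d p) q
    + casimir v p (nabla d q) + casimir (N d v) p q.
  rewrite /casimir (big_morph _ (N_D dP) (N0 dP)) -!big_split; apply: eq_bigr => a _ /=.
  by rewrite !N_J // linearD addrA.
have csk := casimir_smooth.
have NT u u' : N d (contract (casimir v) u u') =
    contract (casimir v) (nabla d u) u' + contract (casimir v) u (nabla d u')
    + contract (casimir (N d v)) u u'.
  have f1 := kernel_finite (fun l => 't^(- l - 1) * nabla d u) u' (csk v).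
  have f2 := kernel_finite (fun l => 't^(- l - 1) * u) (nabla d u') (csk v).
  have f3 := kernel_finite (fun l => 't^(- l - 1) * u) u' (csk (N d v)).
  rewrite /contract (tsum_morph (N0 dP) (N_D dP)); last exact: kernel_finite.
  rewrite -!tsumD //; last exact: finite_aboveD.
  by apply: eq_tsum => l; rewrite NC !nabla_tpowM.
have n1 : nabla d 1 = 0 by rewrite -(tpow0 phi) nabla_tpow.
rewrite /sugawara_op -!scaleNr N_Z // (_ : d _ = 0); last first.
  exact: (derA dP).
rewrite scale0r add0r -scalerDr N_zi // -linearD; congr (_ *: zi _).
rewrite /quadratic_sum N_D // !NT n1.
rewrite (linear_fun0 (contlin_contract_l _ (csk v)).1).
rewrite (linear_fun0 (contlin_contract_r _ (csk v)).1).
by rewrite addr0 add0r addrACA.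
Qed.

Definition central_charge v : F := n%:R *: c (zi v).
Local Notation kappa := central_charge.

Lemma kappa_linear r v w : kappa (r *: v + w) = r *: kappa v + kappa w.
Proof. by rewrite /central_charge (linearP zi) (linearP c) scalerDr !scalerA mulrC. Qed.
Lemma kappa_J a f v : kappa (J a f v) = J a f (kappa v).
Proof. by rewrite /central_charge zi_J c_J linearZ. Qed.
Lemma kappa_sugawara_op A v : kappa (sugawara_op A v) = sugawara_op A (kappa v).
Proof.
apply: sugawara_op_comm => // [r x y|a f x|x]; first exact: kappa_linear.
  exact: kappa_J.
by rewrite /central_charge -zi_c linearZ.
Qed.
Lemma kappa_N d v : is_der d -> kappa (N d v) = N d (kappa v).
Proof.
move=> dP; rewrite /central_charge N_Z // N_c // N_zi // (_ : d n%:R = 0) ?scale0r ?add0r //.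
by rewrite pmulrn (derMz dP) (der1 dP) mul0rz.
Qed.

Local Notation ext := (theta_hat_LR phi k0).

Definition ext_rep (x : ext) v : F :=
  sugawara_op (ext_proj_fun x 't^1) v + N (anchor (ext_proj_fun x)) v + x.2 *: kappa v.

Lemma kappa_D r : {morph (fun v => r *: kappa v) : v w / v + w}.
Proof.
by move=> v w; have := kappa_linear 1 v w; rewrite !scale1r => ->; rewrite scalerDr.
Qed.

Lemma sugawara_opZ A r v : sugawara_op A (r *: v) = r *: sugawara_op A v.
Proof. by have := sugawara_op_linear A r v 0; rewrite sugawara_op0 !addr0. Qed.
Lemma kappaZ r v : kappa (r *: v) = r *: kappa v.
Proof.
have k00 : kappa 0 = 0 by rewrite /central_charge !linear0.
by have := kappa_linear r v 0; rewrite k00 !addr0.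
Qed.

Lemma ext_rep_is_representation : is_representation ext_rep.
Proof.
split.
- move=> r [D a] [E b] v; rewrite /ext_rep /ext_proj_fun /=.
  rewrite (contlin_sugawara_op v).1 anchor_linear.
  rewrite N_linear; try exact: anchor_der.
  rewrite scalerDl -scalerA !scalerDr.
  by rewrite !addrA [LHS](ACl (1 * 3 * 5 * 2 * 4 * 6))%AC /=.
- move=> [D a] v w; rewrite /ext_rep /ext_proj_fun /=.
  rewrite sugawara_opD (N_D (anchor_der D)) kappa_D.
  by rewrite !addrA [LHS](ACl (1 * 3 * 5 * 2 * 4 * 6))%AC /=.
- move=> [D a] b v; rewrite /ext_rep /ext_proj_fun /= sugawara_opZ kappaZ (N_Z (anchor_der D)).
  by rewrite (derA (anchor_der D)) scale0r add0r !scalerDr !(scalerA _ _ (kappa v)) [a * _]mulrC.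
move=> [D a] [E b] v.
have dP := anchor_der D; have eP := anchor_der E.
have nD u u' : sugawara_op (u - u') v = sugawara_op u v - sugawara_op u' v.
  by rewrite (linear_funB (contlin_sugawara_op v).1).
have nS u u' : sugawara_op (u + u') v = sugawara_op u v + sugawara_op u' v.
  by rewrite (linear_funD (contlin_sugawara_op v).1).
transitivity (opcomm (ext_rep (D, a)) (ext_rep (E, b)) v); last by [].
(* Vertical operators bracket to the anomaly formula, horizontal with vertical applies nabla to D t
   or E t, two horizontal ones give N of the commutator, and horizontal with central differentiates
   the coefficient of kappa. The remaining commutators vanish. *)
rewrite opcomm_expand; try exact: sugawara_opD; try exact: N_D; try exact: kappa_D.
have oc d A : is_der d -> opcomm (N d) (fun x => sugawara_op A x) v = sugawara_op (nabla d A) v.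
  by move=> d_der; rewrite /opcomm N_sugawara_op // addrK.
have ok d r : is_der d -> opcomm (N d) (fun x => r *: kappa x) v = d r *: kappa v.
  by move=> d_der; rewrite /opcomm N_Z // kappa_N // addrK.
have okT r A : opcomm (fun x => sugawara_op A x) (fun x => r *: kappa x) v = 0.
  by rewrite /opcomm sugawara_opZ kappa_sugawara_op subrr.
have okT' r A : opcomm (fun x => r *: kappa x) (fun x => sugawara_op A x) v = 0.
  by rewrite /opcomm sugawara_opZ kappa_sugawara_op subrr.
have okk : opcomm (fun x => a *: kappa x) (fun x => b *: kappa x) v = 0.
  by rewrite /opcomm !kappaZ (scaler_swap a b) subrr.
rewrite !oc ?ok ?okT ?okT' ?okk // !addr0.
rewrite {1}/opcomm sugawara_op_bracket.
rewrite /opcomm -N_commutator //.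
set A := D 't^1; set B := E 't^1.
transitivity (sugawara_op (theta_LR_bracket D E 't^1) v + N (anchor (theta_LR_bracket D E)) v
   + (twelfth * res (ddt (ddt (ddt A)) * B) + (anchor D b - anchor E a)) *: kappa v); first by [].
rewrite (bracket_t D E) anchor_bracket nS !nD -/A -/B.
rewrite scalerDl scalerBl /ext_proj_fun /= -/(kappa v).
by rewrite !addrA [RHS](ACl (1 * 2 * 4 * 5 * 6 * 3 * 7 * 8))%AC.
Qed.

Lemma ext_rep_theta (D : theta phi) v :
  ext_rep (ext_incl ext (D, 0)) v = sugawara_op (D 't^1) v.
Proof.
change (sugawara_op (D 't^1) v + N (anchor D) v + 0 *: kappa v = sugawara_op (D 't^1) v).
by rewrite anchor_theta N_zero scale0r !addr0.
Qed.

Lemma ext_rep_c0 v : ext_rep (ext_c0 ext) v = kappa v.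
Proof.
change (sugawara_op 0 v + N (anchor (0 : theta_LR phi)) v + 1 *: kappa v = kappa v).
rewrite (linear_fun0 (contlin_sugawara_op v).1) scale1r add0r (_ : anchor _ = fun=> 0).
  by rewrite N_zero add0r.
by apply/funext=> r; rewrite /Defs.anchor coef_t0.
Qed.

(** The vertical operator contributes (D t) f' and the horizontal one nabla f; by [thetaE] they add
    up to D f. *)
Lemma ext_rep_J (x : ext) a f v :
  ext_rep x (J a f v) - J a f (ext_rep x v) = J a (ext_proj ext x f) v.
Proof.
case: x => D r.
transitivity (J a (D f) v); last by [].
rewrite /ext_rep /ext_proj_fun /= sugawara_op_J (N_J (anchor_der D)) kappa_J !J_D (J_Z a f r).
rewrite (thetaE D f) (linear_funD (J_linear a v)) !opprD !addrA.
rewrite [LHS](ACl ((2 * 3) * (1 * 6) * (4 * 7) * (5 * 8)))%AC /=.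
by rewrite !subrr !addr0.
Qed.

Lemma ext_rep_Z (x : ext) r v :
  ext_rep x (r *: v) - r *: ext_rep x v = anchor (ext_proj ext x) r *: v.
Proof.
case: x => D a; transitivity (anchor D r *: v); last by [].
rewrite /ext_rep /ext_proj_fun /= sugawara_opZ kappaZ (N_Z (anchor_der D)) !scalerDr.
rewrite (scaler_swap a r).
rewrite !opprD !addrA [LHS](ACl (2 * (1 * 5) * (3 * 6) * (4 * 7)))%AC /=.
by rewrite !subrr !addr0.
Qed.

Lemma ext_rep_closed (M : F -> Prop) (x : ext) v :
  M 0 -> (forall x y, M x -> M y -> M (x + y)) ->
  (forall a f x, M x -> M (J a f x)) -> (forall x, M x -> M (c x)) ->
  (forall x, M x -> M (zi x)) -> (forall r x, M x -> M (r *: x)) ->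
  (forall v, M v -> M (N (anchor (ext_proj ext x)) v)) -> M v -> M (ext_rep x v).
Proof.
move=> M0 MD MJ Mc Mz MZ MN Mv; rewrite /ext_rep /central_charge.
apply: (MD); last exact/MZ/MZ/Mc/Mz.
by apply: (MD); [exact: sugawara_op_closed|exact: MN].
Qed.

End ExtendedRepresentation.
End Sugawara.

(** * Dependence of the derivations of the enveloping algebra on d *)

Section EnvelopingDerivationFamilies.
Variables (k : fieldType) (R : comAlgType k) (V : lmodType R) (br : V -> V -> V).
Local Notation is_der := (@is_k_derivation_of_R k R).

Local Notation uder := (@uder k R V br).

Definition lie_der (d : R -> R) (D : V -> V) : Prop :=
  [/\ is_der d, forall v w, D (v + w) = D v + D w,
      forall r v, D (r *: v) = d r *: v + r *: D v &
      forall v w, D (br v w) = br (D v) w + br v (D w)].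

Lemma lie_uder_gen d D v : lie_der d D -> uder d D (ugen br v) = ugen br (D v).
Proof. by case=> *; exact: uder_gen. Qed.
Lemma lie_uder_cst d D r : lie_der d D -> uder d D r%:A = (d r)%:A :> uea br.
Proof. by case=> *; exact: uder_cst. Qed.
Lemma lie_uderD d D u w : lie_der d D -> uder d D (u + w) = uder d D u + uder d D w.
Proof. by case=> *; exact: uderD. Qed.
Lemma lie_uderM d D u w :
  lie_der d D -> uder d D (u * w) = uder d D u * w + u * uder d D w.
Proof. by case=> *; exact: uderM. Qed.
Lemma lie_uderZ d D r u :
  lie_der d D -> uder d D (r *: u) = d r *: u + r *: uder d D u.
Proof. by case=> *; exact: uderZ. Qed.

Lemma uder_linear d D e E d' D' r u : lie_der d D -> lie_der e E -> lie_der d' D' ->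
  (forall s, d' s = r * d s + e s) -> (forall v, D' v = r *: D v + E v) ->
  uder d' D' u = r *: uder d D u + uder e E u.
Proof.
move=> dP eP dP' dE DE; elim/uea_ind: u => [v|s|x y Hx Hy|x y Hx Hy].
- by rewrite !lie_uder_gen // DE linearP.
- by rewrite !lie_uder_cst // dE scalerDl scalerA.
- by rewrite !lie_uderD // Hx Hy scalerDr addrACA.
- by rewrite !lie_uderM // Hx Hy mulrDl mulrDr -!scalerAl -!scalerAr scalerDr addrACA.
Qed.

Lemma uder_commutator d D e E d' D' u : lie_der d D -> lie_der e E -> lie_der d' D' ->
  (forall s, d' s = d (e s) - e (d s)) -> (forall v, D' v = D (E v) - E (D v)) ->
  uder d' D' u = uder d D (uder e E u) - uder e E (uder d D u).
Proof.
move=> dP eP dP' dE DE; elim/uea_ind: u => [v|s|x y Hx Hy|x y Hx Hy].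
- by rewrite !lie_uder_gen // DE linearB.
- by rewrite !lie_uder_cst // dE scalerBl.
- by rewrite !lie_uderD // Hx Hy opprD addrACA.
- rewrite !(lie_uderM _ _ dP') Hx Hy !(lie_uderM _ _ dP, lie_uderM _ _ eP).
  rewrite !(lie_uderD _ _ dP, lie_uderD _ _ eP) !(lie_uderM _ _ dP, lie_uderM _ _ eP).
  rewrite mulrBl mulrBr !opprD !addrA.
  rewrite [RHS](ACl (1 * 5 * 4 * 8 * (2 * 7) * (3 * 6)))%AC /=.
  by rewrite !subrr !addr0.
Qed.
End EnvelopingDerivationFamilies.

(** * Fock modules *)

Section Fock.
Variables (k : fieldType) (k0 : [pchar k] =i pred0).
Variables (R : comAlgType k) (L : comAlgType R) (phi : coordinate L).
Local Notation "'t^ n" := (tpow phi n) (at level 2, n at level 2, format "''t^' n").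
Local Notation mpow := (mpow phi).
Local Notation res := (res phi).
Local Notation ddt := (ddt phi).
Local Notation nabla := (nabla phi).
Local Notation anchor := (anchor phi).
Local Notation is_der := (@is_k_derivation_of_R k R).
Local Notation ext := (theta_hat_LR phi k0).

Variables (V : lmodType R) (br : V -> V -> V) (cc : V).
Local Notation U := (uea br).
Local Notation uder := (@uder k R V br).
Local Notation gen := (ugen br).
Local Notation c := (gen cc).
Hypothesis br_cc : forall x, br x cc = 0.

Variables (S : U -> Prop) (hk : k) (z : U) (deep : int -> V -> Prop).
Local Notation h := (hk%:A : R).
Hypothesis zE : z = c + h%:A.
Hypothesis SE : forall u, S u <-> exists2 x, deep 1 x & u = gen x.
Hypothesis deepW : forall M N x, M <= N -> deep N x -> deep M x.
Hypothesis deep_br : forall x M, exists N, forall y, deep N y -> deep M (br y x).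

Variable nabV : (R -> R) -> V -> V.
Hypothesis nabV_lie_der : forall d, is_der d -> lie_der br d (nabV d).
Hypothesis nabV_linear : forall r d e x, is_der d -> is_der e ->
  nabV (fun s => r * d s + e s) x = r *: nabV d x + nabV e x.
Hypothesis nabV_commutator : forall d e x, is_der d -> is_der e ->
  nabV (fun s => d (e s) - e (d s)) x = nabV d (nabV e x) - nabV e (nabV d x).
Hypothesis nabV_cc : forall d, is_der d -> nabV d cc = 0.
Hypothesis nabV_deep : forall d x, is_der d -> deep 1 x -> deep 1 (nabV d x).

Local Notation F := (fracmod S z).
Local Notation act := (@act R U S z).
Local Notation divz := (@Defs.divz R U S z).

Lemma c_central (u : U) : u * c = c * u.
Proof.
elim/uea_ind: u => [v|r|x y Hx Hy|x y Hx Hy].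
- apply/eqP; rewrite -subr_eq0 ugenB br_cc; apply/eqP.
  exact: raddf0.
- by rewrite -scalerAl -scalerAr mul1r mulr1.
- by rewrite mulrDl mulrDr Hx Hy.
- by rewrite -mulrA Hy mulrA Hx mulrA.
Qed.

Lemma z_central (u : U) : u * z = z * u.
Proof. by rewrite zE mulrDl mulrDr c_central -scalerAl -scalerAr mul1r mulr1. Qed.

Definition fock_nabla d : F -> F := @fder R U S z (uder d (nabV d)).

Section FockNabla.
Variable d : R -> R.
Hypothesis dP : is_der d.
Let ldP := nabV_lie_der dP.

Lemma nabV_gen x : uder d (nabV d) (gen x) = gen (nabV d x).
Proof. exact: lie_uder_gen. Qed.
Lemma nabV_c : uder d (nabV d) c = 0.
Proof. by rewrite nabV_gen nabV_cc //; exact: raddf0. Qed.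
Lemma nabV_z : uder d (nabV d) z = 0.
Proof. by rewrite zE lie_uderD // nabV_c lie_uder_cst // (derA dP) scale0r addr0. Qed.
Lemma nabV_S u : S u -> S (uder d (nabV d) u).
Proof.
move=> /SE [w w1 ->]; apply/SE; exists (nabV d w); last exact: nabV_gen.
exact: nabV_deep.
Qed.
Lemma nabV_1 : uder d (nabV d) 1 = 0.
Proof. by rewrite -(scale1r 1) lie_uder_cst // (der1 dP) scale0r. Qed.

Lemma fock_nablaE u n :
  fock_nabla d (Defs.frac S z u n) = Defs.frac S z (uder d (nabV d) u) n.
Proof.
apply: fderE; [by move=> *; exact: lie_uderD|by move=> *; exact: lie_uderM
  |exact: nabV_z|exact: nabV_S].
Qed.
Lemma fock_nablaD : {morph fock_nabla d : v w / v + w}.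
Proof.
by apply: fderD; [by move=> *; exact: lie_uderD|by move=> *; exact: lie_uderM
  |exact: nabV_z|exact: nabV_S].
Qed.
Lemma fock_nablaZ r v : fock_nabla d (r *: v) = d r *: v + r *: fock_nabla d v.
Proof.
apply: fderZ; [by move=> *; exact: lie_uderD|by move=> *; exact: lie_uderM| |exact: nabV_z|exact: nabV_S].
by move=> *; exact: lie_uderZ.
Qed.
Lemma fock_nabla_vac : fock_nabla d (vac S z) = 0.
Proof.
by apply: fder_vac; [by move=> *; exact: lie_uderD|by move=> *; exact: lie_uderM
  |exact: nabV_1|exact: nabV_z|exact: nabV_S].
Qed.
Lemma fock_nabla_act a v :
  fock_nabla d (act a v) = act (uder d (nabV d) a) v + act a (fock_nabla d v).
Proof.
apply: fder_act; [exact: z_central|by move=> *; exact: lie_uderD|by move=> *; exact: lie_uderM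
  |exact: nabV_z|exact: nabV_S].
Qed.
Lemma fock_nabla_gen w v :
  fock_nabla d (act (gen w) v) = act (gen (nabV d w)) v + act (gen w) (fock_nabla d v).
Proof. by rewrite fock_nabla_act nabV_gen. Qed.
Lemma fock_nabla_c v : fock_nabla d (act c v) = act c (fock_nabla d v).
Proof.
rewrite fock_nabla_act nabV_c -[X in X + _](_ : 0 = _) ?add0r //.
by rewrite -(scale0r (0 : U)) (actZl z_central) scale0r.
Qed.
Lemma fock_nabla_divz v : fock_nabla d (divz v) = divz (fock_nabla d v).
Proof.
by apply: fder_divz; [by move=> *; exact: lie_uderD|by move=> *; exact: lie_uderM
  |exact: nabV_z|exact: nabV_S].
Qed.
End FockNabla.

Lemma fock_nabla_linear r d e v : is_der d -> is_der e ->
  fock_nabla (fun s => r * d s + e s) v = r *: fock_nabla d v + fock_nabla e v.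
Proof.
move=> dP eP; have fP := der_linear r dP eP.
elim/fracW: v => u n; rewrite !fock_nablaE // -fracZ -fracD; congr (Defs.frac _ _ _ _).
apply: uder_linear; try exact: nabV_lie_der; first by [].
by move=> x; exact: nabV_linear.
Qed.

Lemma fock_nabla_commutator d e v : is_der d -> is_der e ->
  fock_nabla (fun s => d (e s) - e (d s)) v
  = fock_nabla d (fock_nabla e v) - fock_nabla e (fock_nabla d v).
Proof.
move=> dP eP; have fP := der_commutator dP eP.
elim/fracW: v => u n; rewrite !fock_nablaE // -[X in _ + X]scaleN1r -fracZ scaleN1r -fracD.
congr (Defs.frac _ _ _ _); apply: uder_commutator; try exact: nabV_lie_der; first by [].
by move=> x; exact: nabV_commutator.
Qed.

Lemma gen_smooth v : exists N, forall w, deep N w -> act (gen w) v = 0.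
Proof.
apply: (fock_smooth deepW deep_br); first exact: z_central.
by move=> w w1; apply/SE; exists w.
Qed.

Variables (n : nat) (j : 'I_n -> L -> V) (C : 'I_n -> 'I_n -> 'I_n -> R).
Implicit Types (a b i : 'I_n) (f g : L) (v w : F) (d : R -> R).
Hypothesis j_linear : forall a r f g, j a (r *: f + g) = r *: j a f + j a g.
Hypothesis j_br : forall a b f g, br (j a f) (j b g) =
  \sum_i C a b i *: j i (f * g) + (a == b)%:R *: (res (g * ddt f) *: cc).
Hypothesis j_deep : forall a f N, mpow N f -> deep N (j a f).
Hypothesis j_nabla : forall d a f, is_der d -> nabV d (j a f) = j a (nabla d f).
Hypothesis C_rot : forall a b i, C i b a = - C a b i.
Hypothesis C_diag : forall a b, C a a b = 0.
Hypothesis C_diag13 : forall a b, C a b a = 0.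
Hypothesis C_casimir : forall b i,
  \sum_a \sum_e C a b e * C a e i = (b == i)%:R * (2 * h).

Definition gen_j a f : U := gen (j a f).
Definition mode a f v : F := act (gen_j a f) v.
Definition charge v : F := act c v.
Fact mode_is_linear a f : linear (mode a f).
Proof. by move=> r v w; exact: (act_linear z_central). Qed.
HB.instance Definition _ a f := GRing.isLinear.Build R F F _ (mode a f) (mode_is_linear a f).
Fact charge_is_linear : linear charge.
Proof. by move=> r v w; exact: (act_linear z_central). Qed.
HB.instance Definition _ := GRing.isLinear.Build R F F _ charge charge_is_linear.
Definition inv_z v : F := divz v.
Fact inv_z_is_linear : linear inv_z.
Proof. by move=> r v w; exact: divz_linear. Qed.
HB.instance Definition _ := GRing.isLinear.Build R F F _ inv_z inv_z_is_linear.

Lemma gen_act_linear r x y v :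
  act (gen (r *: x + y)) v = r *: act (gen x) v + act (gen y) v.
Proof. by rewrite linearP (actDl z_central) (actZl z_central). Qed.
Lemma gen_actD x y v : act (gen (x + y)) v = act (gen x) v + act (gen y) v.
Proof. by have := gen_act_linear 1 x y v; rewrite !scale1r. Qed.
Lemma gen_act0 v : act (gen 0) v = 0.
Proof. by apply: (addrI (act (gen 0) v)); rewrite -gen_actD !addr0. Qed.
Lemma gen_actZ r x v : act (gen (r *: x)) v = r *: act (gen x) v.
Proof. by rewrite -[r *: x]addr0 gen_act_linear gen_act0 addr0. Qed.
Lemma gen_act_sum (I : Type) (s : seq I) (G : I -> V) v :
  act (gen (\sum_(i <- s) G i)) v = \sum_(i <- s) act (gen (G i)) v.
Proof. exact: (big_morph (fun x => act (gen x) v) (fun x y => gen_actD x y v) (gen_act0 v)). Qed.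

Lemma gen_act_comm x y v :
  act (gen x) (act (gen y) v) = act (gen y) (act (gen x) v) + act (gen (br x y)) v.
Proof.
rewrite -!(actM z_central) addrC -(actDl z_central); congr act.
by apply/eqP; rewrite -subr_eq ugenB.
Qed.

Lemma mode_linear a v : linear_fun (fun f => mode a f v).
Proof.
by move=> r f g; rewrite /mode /gen_j j_linear gen_act_linear.
Qed.

Lemma mode_comm a b f g v : mode a f (mode b g v) =
  mode b g (mode a f v) + \sum_i C a b i *: mode i (f * g) v
    + (a == b)%:R *: (res (g * ddt f) *: charge v).
Proof.
rewrite /mode gen_act_comm j_br gen_actD !gen_actZ gen_act_sum addrA; congr (_ + _ + _).
by apply: eq_bigr => i _; rewrite gen_actZ.
Qed.

Lemma mode_smooth v : exists N, forall a f, mpow N f -> mode a f v = 0.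
Proof. by case: (gen_smooth v) => N HN; exists N => a f fN; apply/HN/j_deep. Qed.
Lemma charge_J a f v : charge (mode a f v) = mode a f (charge v).
Proof. by rewrite /charge /mode -!(actM z_central) c_central. Qed.
Lemma inv_z_J a f v : inv_z (mode a f v) = mode a f (inv_z v).
Proof. by rewrite /inv_z /mode (act_divz z_central). Qed.
Lemma inv_z_charge v : inv_z (charge v) = charge (inv_z v).
Proof. by rewrite /inv_z /charge (act_divz z_central). Qed.
Lemma inv_zK v : inv_z (charge v + h *: v) = v.
Proof.
rewrite -{2}(act1 z_central v) -(actZl z_central) -(actDl z_central) -zE.
by rewrite /inv_z -(act_divz z_central) (divzK z_central).
Qed.

Lemma fock_nabla_J d a f v : is_der d ->
  fock_nabla d (mode a f v) = mode a (nabla d f) v + mode a f (fock_nabla d v).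
Proof. by move=> dP; rewrite /mode fock_nabla_gen // j_nabla. Qed.

Definition fock_rep : ext -> F -> F :=
  @ext_rep k k0 R L phi F n mode charge inv_z fock_nabla.

Lemma fock_rep_is_representation : is_representation fock_rep.
Proof.
apply: (ext_rep_is_representation k0 mode_linear mode_comm mode_smooth charge_J inv_z_J
  inv_z_charge inv_zK C_rot C_diag C_diag13 C_casimir fock_nablaD fock_nablaZ
  _ fock_nabla_c fock_nabla_divz fock_nabla_linear fock_nabla_commutator).
by move=> d dP a f v; exact: fock_nabla_J.
Qed.

Lemma fock_rep_theta (D : theta phi) v : exists2 v',
  sum_acts (fun l => \sum_a quadratic_term phi (gen_j a) D l) v v'
  & fock_rep (ext_incl ext (D, 0)) v = - (half R *: divz v').
Proof.
exists (quadratic_sum phi mode (D 't^1) v); last first.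
  rewrite /fock_rep ext_rep_theta //.
  exact: fock_nabla_linear.
have [n0 H] := normal_casimir_sum mode_linear mode_comm mode_smooth C_diag (D 't^1) v.
exists n0 => m p mn pn; rewrite -(H m p mn pn) (act_sum z_central).
apply: eq_bigr => i _; rewrite (act_sum z_central) /normal_casimir; apply: eq_bigr => a _.
rewrite /quadratic_term /normal_order /pairing (actDl z_central) !(actM z_central).
by [].
Qed.

Lemma fock_rep_c0 v : fock_rep (ext_c0 ext) v = n%:R *: act c (divz v).
Proof. exact: (ext_rep_c0 k0 charge inv_z mode_linear mode_smooth fock_nabla_linear). Qed.

Lemma fock_rep_J (x : ext) a f v :
  fock_rep x (act (gen_j a f) v) - act (gen_j a f) (fock_rep x v)
  = act (gen_j a (ext_proj ext x f)) v.
Proof.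
apply: (ext_rep_J mode_linear mode_comm mode_smooth charge_J inv_z_J inv_zK C_rot C_diag13 C_casimir).
by move=> d dP b g w; exact: fock_nabla_J.
Qed.

Lemma fock_rep_Z (x : ext) r v :
  fock_rep x (r *: v) - r *: fock_rep x v = anchor (ext_proj ext x) r *: v.
Proof. exact: (ext_rep_Z charge inv_z mode_linear mode_smooth fock_nablaZ). Qed.

Lemma fock_rep_closed (x : ext) (M : F -> Prop) : is_submodule M ->
  (forall v, M v -> M (fock_nabla (anchor (ext_proj ext x)) v)) ->
  forall v, M v -> M (fock_rep x v).
Proof.
move=> MM MN v Mv; have [M0 MD Ma Mz] := MM.
apply: (ext_rep_closed mode_linear mode_smooth) => // [a f w|w|r w]; try exact: Ma.
Qed.

Lemma fock_rep_closed_theta (y : theta_hat phi) (M : F -> Prop) : is_submodule M ->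
  forall v, M v -> M (fock_rep (ext_incl ext y) v).
Proof.
move=> MM; apply: fock_rep_closed => // v Mv; have [M0 _ _ _] := MM.
(* Over theta the anchor is 0, so the horizontal operator is 0 and stability is automatic. *)
rewrite (_ : anchor _ = fun=> 0); last exact: (anchor_theta y.1).
by rewrite (N_zero fock_nabla_linear).
Qed.

(** A common form of the two horizontality conditions, with the lift of d to the Lie algebra in
    place of the coefficientwise relation between series. The stability condition is applied only to
    [fock_nabla]. *)
Definition fock_horizontal (d : R -> R) (N : F -> F) : Prop :=
  [/\ forall v w, N (v + w) = N v + N w,
      forall r v, N (r *: v) = d r *: v + r *: N v,
      N (vac S z) = 0,
      forall x v, N (act (gen x) v) = act (gen (nabV d x)) v + act (gen x) (N v) &
      (forall v, N (act c v) = act c (N v)) /\ forall v, N (divz v) = divz (N v)].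

Lemma fock_nabla_horizontal d : is_der d -> fock_horizontal d (fock_nabla d).
Proof.
move=> dP; split; [exact: fock_nablaD|exact: fock_nablaZ|exact: fock_nabla_vac| |].
  exact: fock_nabla_gen.
by split; [exact: fock_nabla_c|exact: fock_nabla_divz].
Qed.

Lemma fock_representation : exists T : ext -> F -> F,
  is_representation T /\
  (forall (D : theta phi) v, exists2 v',
     sum_acts (fun l => \sum_a quadratic_term phi (gen_j a) D l) v v'
     & T (ext_incl ext (D, 0)) v = - (half R *: divz v')) /\
  (forall v, T (ext_c0 ext) v = n%:R *: act c (divz v)) /\
  (forall (y : theta_hat phi) M, is_submodule M ->
     forall v, M v -> M (T (ext_incl ext y) v)) /\
  (forall (x : ext) M, is_submodule M ->
     (forall N, fock_horizontal (anchor (ext_proj ext x)) N -> forall v, M v -> M (N v)) ->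
     forall v, M v -> M (T x v)) /\
  (forall (x : ext) a f v, T x (act (gen_j a f) v) - act (gen_j a f) (T x v)
     = act (gen_j a (ext_proj ext x f)) v) /\
  (forall (x : ext) r v, T x (r *: v) - r *: T x v = anchor (ext_proj ext x) r *: v).
Proof.
exists fock_rep; split; first exact: fock_rep_is_representation.
split; first exact: fock_rep_theta.
split; first exact: fock_rep_c0.
split; first exact: fock_rep_closed_theta.
split.
  move=> x M MM MN; apply: fock_rep_closed => // v; apply: MN.
  exact/fock_nabla_horizontal/anchor_der.
by split; [exact: fock_rep_J|exact: fock_rep_Z].
Qed.
End Fock.

(** * The oscillator algebra and its representation *)

Section OscillatorRepresentation.
Variables (k : fieldType) (k0 : [pchar k] =i pred0).
Variables (R : comAlgType k) (L : comAlgType R) (phi : coordinate L).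
Local Notation ext := (theta_hat_LR phi k0).
Local Notation is_der := (@is_k_derivation_of_R k R).

Definition osc_nabla (d : R -> R) (x : osc L) : osc L := (nabla phi d x.1, d x.2).
Definition osc_deep (N : int) (x : osc L) : Prop := mpow phi N x.1 /\ x.2 = 0.
Definition osc_j (a : 'I_1) (f : L) : osc L := (f, 0).

Lemma osc_nabla_lie_der d : is_der d -> lie_der (osc_bracket phi) d (osc_nabla d).
Proof.
move=> dP; split=> //.
- by move=> [f r] [g s]; congr pair; [exact: nablaD|exact: derD].
- by move=> a [f r]; congr pair; [exact: nablaZ|exact: derM].
- move=> [f r] [g s]; congr pair; first by rewrite /= nabla0 // addr0.
  by rewrite /= (nabla_res phi dP) (nablaM phi dP) resD nabla_ddt // addrC.
Qed.

Lemma osc_representation : exists T : ext -> osc_fock phi -> osc_fock phi,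
  is_representation T /\
  (forall (D : theta phi) v, osc_rep D v (T (ext_incl ext (D, 0)) v)) /\
  (forall v, T (ext_c0 ext) v = v) /\
  (forall (y : theta_hat phi) M, is_submodule M ->
     forall v, M v -> M (T (ext_incl ext y) v)) /\
  (forall (x : ext) M, is_submodule M ->
     osc_stable (anchor phi (ext_proj ext x)) M -> forall v, M v -> M (T x v)) /\
  (forall (x : ext) (f : L) v,
     T x (osc_act (osc_in phi f) v) - osc_act (osc_in phi f) (T x v)
     = osc_act (osc_in phi (ext_proj ext x f)) v) /\
  (forall (x : ext) (r : R) v,
     T x (r *: v) - r *: T x v = anchor phi (ext_proj ext x) r *: v).
Proof.
have br_cc (x : osc L) : osc_bracket phi x (0, 1) = 0.
  by rewrite /osc_bracket mul0r /Defs.res coef_t0.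
have hbarE : hbar phi = ugen (osc_bracket phi) (0, 1) + ((0 : k)%:A : R)%:A.
  by rewrite !scale0r addr0.
have SE u : osc_m u <-> exists2 x, osc_deep 1 x & u = ugen (osc_bracket phi) x.
  split=> [[f f1 ->]|[[f r] [/= f1 ->] ->]]; first by exists (f, 0).
  by exists f.
have deepW M N x : M <= N -> osc_deep N x -> osc_deep M x.
  by move=> MN [x1 x2]; split=> //; exact: mpowW x1.
have deep_br x M : exists N, forall y, osc_deep N y -> osc_deep M (osc_bracket phi y x).
  case: (mpow_bound phi x.1) => b xb; exists (1 - b) => y [yN _]; split.
    exact: mpow0.
  by rewrite /= (res_eq0 (mpowM xb (mpow_ddt yN))) //; lia.
have nabV_linear r d e x : is_der d -> is_der e ->
    osc_nabla (fun s => r * d s + e s) x = r *: osc_nabla d x + osc_nabla e x.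
  by move=> dP eP; congr pair; exact: nabla_linear.
have nabV_comm d e x : is_der d -> is_der e ->
    osc_nabla (fun s => d (e s) - e (d s)) x
    = osc_nabla d (osc_nabla e x) - osc_nabla e (osc_nabla d x).
  by move=> dP eP; congr pair; exact: nabla_commutator.
have nabV_cc d : is_der d -> osc_nabla d (0, 1) = 0.
  by move=> dP; congr pair; [exact: nabla0|exact: der1].
have nabV_deep d x : is_der d -> osc_deep 1 x -> osc_deep 1 (osc_nabla d x).
  by move=> dP [x1 x2]; split; [exact: mpow_nabla|rewrite /= x2 der0].
have jL (a : 'I_1) (r : R) f g : osc_j a (r *: f + g) = r *: osc_j a f + osc_j a g.
  by congr pair; rewrite /= scaler0 addr0.
have j_br (a b : 'I_1) f g : osc_bracket phi (osc_j a f) (osc_j b g) =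
    \sum_(i < 1) (0 : R) *: osc_j i (f * g)
    + (a == b)%:R *: (res phi (g * ddt phi f) *: ((0, 1) : osc L)).
  rewrite big_ord1 scale0r add0r !ord1 eqxx scale1r.
  congr pair; first by rewrite /= scaler0.
  by change (res phi (g * ddt phi f) = res phi (g * ddt phi f) * 1); rewrite mulr1.
have j_deep (a : 'I_1) f N : mpow phi N f -> osc_deep N (osc_j a f) by [].
have j_nabla d (a : 'I_1) f : is_der d -> osc_nabla d (osc_j a f) = osc_j a (nabla phi d f).
  by move=> dP; congr pair; exact: der0.
have [||||T [Trep [Tth [Tc0 [Tinc [Tst [TJ TZ]]]]]]] := fock_representation k0 br_cc hbarE SE deepW deep_br
  osc_nabla_lie_der nabV_linear nabV_comm nabV_cc nabV_deep jL j_br j_deep j_nabla.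
- by move=> *; rewrite oppr0.
- by [].
- by [].
- by move=> b i; rewrite !big_ord1 scale0r !mulr0.
exists T; split; first exact: Trep.
split.
  move=> D v; have [v' Hv' E] := Tth D v; exists v' => //.
  case: Hv' => n0 H; exists n0 => m n mn nn; rewrite -(H m n mn nn); congr act.
  by apply: eq_bigr => i _; rewrite big_ord1.
split.
  (* There is one mode, and the charge is hbar / hbar = 1. *)
  by move=> v; rewrite Tc0 scale1r; exact: (divzK (z_central br_cc hbarE)).
split; first exact: Tinc.
split; last by split; [move=> x; exact: (TJ x ord0)|exact: TZ].
move=> x M MM MS; apply: Tst => // N [ND NZ Nv Ng [Nc Nd]]; apply: MS; split=> //.
move=> f f' v ff'; have dP := anchor_der (ext_proj ext x).
(* The coefficientwise relation determines f' as nabla f. *)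
suff E : osc_nabla (anchor phi (ext_proj ext x)) (f, 0) = (f', 0) by rewrite Ng E.
congr pair; last exact: der0.
by apply: (coef_inj (phi := phi)) => n; rewrite coef_nabla // ff'.
Qed.
End OscillatorRepresentation.

(** * Structure constants in an orthonormal basis *)

Section OrthonormalBasis.
Variables (k : fieldType) (g : vectType k) (br : g -> g -> g) (B : g -> g -> k).
Variables (X : (\dim {:g}).-tuple g) (h : k).
Local Notation I := 'I_(\dim {:g}).
Hypothesis brP : is_lie_bracket br.
Hypothesis BP : is_invariant_form br B.
Hypothesis XP : is_orthonormal_basis B X.
Hypothesis cas : forall y, \sum_i br (tnth X i) (br (tnth X i) y) = (2%:R * h) *: y.
Implicit Types (x y u v : g) (a b e : I).

Lemma br_linl (c : k) x y u : br (c *: x + y) u = c *: br x u + br y u.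
Proof. by case: brP. Qed.
Lemma br_linr (c : k) x y u : br u (c *: x + y) = c *: br u x + br u y.
Proof. by case: brP. Qed.
Lemma brxx x : br x x = 0. Proof. by case: brP. Qed.
Lemma brDl x y u : br (x + y) u = br x u + br y u.
Proof. by have := br_linl 1 x y u; rewrite !scale1r. Qed.
Lemma brDr x y u : br u (x + y) = br u x + br u y.
Proof. by have := br_linr 1 x y u; rewrite !scale1r. Qed.
Lemma br0l u : br 0 u = 0.
Proof. by apply: (addrI (br 0 u)); rewrite -brDl !addr0. Qed.
Lemma br0r u : br u 0 = 0.
Proof. by apply: (addrI (br u 0)); rewrite -brDr !addr0. Qed.
Lemma brZl c x u : br (c *: x) u = c *: br x u.
Proof. by rewrite -[c *: x]addr0 br_linl br0l addr0. Qed.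
Lemma brZr c x u : br u (c *: x) = c *: br u x.
Proof. by rewrite -[c *: x]addr0 br_linr br0r addr0. Qed.
Lemma br_anti x y : br y x = - br x y.
Proof.
apply/eqP; rewrite -addr_eq0; have := brxx (x + y).
by rewrite brDl !brDr !brxx addr0 add0r addrC => ->.
Qed.

Lemma B_lin (c : k) x y u : B (c *: x + y) u = c * B x u + B y u.
Proof. by case: BP. Qed.
Lemma B_sym x y : B x y = B y x. Proof. by case: BP. Qed.
Lemma BDl x y u : B (x + y) u = B x u + B y u.
Proof. by have := B_lin 1 x y u; rewrite scale1r mul1r. Qed.
Lemma B0l u : B 0 u = 0.
Proof. by apply: (addrI (B 0 u)); rewrite -BDl !addr0. Qed.
Lemma BZl c x u : B (c *: x) u = c * B x u.
Proof. by rewrite -[c *: x]addr0 B_lin B0l addr0. Qed.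
Lemma BNl x u : B (- x) u = - B x u.
Proof. by rewrite -scaleN1r BZl mulN1r. Qed.
Lemma B_suml (J : Type) (s : seq J) (G : J -> g) u :
  B (\sum_(i <- s) G i) u = \sum_(i <- s) B (G i) u.
Proof. exact: (big_morph (fun x => B x u) (fun x y => BDl x y u) (B0l u)). Qed.

Lemma orthonormal_expand y : y = \sum_a B y (tnth X a) *: tnth X a.
Proof.
case: XP => Xb XB; rewrite {1}(coord_basis Xb (memvf y)); apply: eq_bigr => a _.
congr (_ *: _); last by rewrite (tnth_nth 0).
rewrite {2}(coord_basis Xb (memvf y)) B_suml (bigD1 a) //= big1 => [|b ba].
  by rewrite BZl -tnth_nth XB eqxx mulr1 addr0.
by rewrite BZl -tnth_nth XB (negbTE ba) mulr0.
Qed.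

Definition structure_constant a b e : k := B (br (tnth X a) (tnth X b)) (tnth X e).
Local Notation C := structure_constant.

Lemma structure_constant_anti a b e : C b a e = - C a b e.
Proof. by rewrite /C br_anti BNl. Qed.
Lemma structure_constant_cycle a b e : C b e a = C a b e.
Proof. by case: BP => _ _ Binv; rewrite /C [in RHS]Binv B_sym. Qed.
Lemma structure_constant_rot a b e : C e b a = - C a b e.
Proof. by rewrite structure_constant_anti structure_constant_cycle. Qed.
Lemma structure_constant_diag a b : C a a b = 0.
Proof. by rewrite /C brxx B0l. Qed.
Lemma structure_constant_diag13 a b : C a b a = 0.
Proof. by rewrite -structure_constant_cycle -structure_constant_cycle structure_constant_diag. Qed.

Lemma structure_constant_expand a b :
  br (tnth X a) (tnth X b) = \sum_e C a b e *: tnth X e.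
Proof. exact: orthonormal_expand. Qed.

(** The Casimir identity at X_b, paired with X_i after expanding the inner bracket. *)
Lemma structure_constant_casimir b i :
  \sum_a \sum_e C a b e * C a e i = (b == i)%:R * (2%:R * h).
Proof.
have := congr1 (B^~ (tnth X i)) (cas (tnth X b)); rewrite BZl (XP.2 b i) mulrC => <-.
rewrite B_suml; apply: eq_bigr => a _.
rewrite [br _ (tnth X b)]structure_constant_expand.
rewrite (big_morph _ (fun x y => brDr x y _) (br0r _)) B_suml.
by apply: eq_bigr => e _; rewrite brZr BZl.
Qed.
End OrthonormalBasis.

(** * The affine algebra and the Sugawara representation *)

Section AffineRepresentation.
Variables (k : fieldType) (k0 : [pchar k] =i pred0).
Variables (R : comAlgType k) (L : comAlgType R) (phi : coordinate L).
Variables (g : vectType k) (br : g -> g -> g) (B : g -> g -> k).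
Hypothesis brP : is_lie_bracket br.
Hypothesis BP : is_invariant_form br B.
Local Notation ext := (theta_hat_LR phi k0).
Local Notation is_der := (@is_k_derivation_of_R k R).
Local Notation res := (res phi).
Local Notation ddt := (ddt phi).
Local Notation I := 'I_(\dim {:g}).
Local Notation loop := (loop L g).
Local Notation affine := (affine L g).
Local Notation tens := (@tens k R L g).
Local Notation b_ := (@loop_basis k g).
Implicit Types (x y : g) (f : L) (d : R -> R) (i j : I).

Lemma tens_linl (c : k) x y f : tens (c *: x + y) f = (c%:A : R) *: tens x f + tens y f.
Proof.
apply/ffunP => i; rewrite !ffunE linearP scalerDl scalerDl; congr (_ + _).
by rewrite [in RHS]scalerA -scalerAl mul1r scalerA.
Qed.
Lemma tensDl x y f : tens (x + y) f = tens x f + tens y f.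
Proof. by have := tens_linl 1 x y f; rewrite !scale1r. Qed.
Lemma tens0l f : tens 0 f = 0.
Proof. by apply: (addrI (tens 0 f)); rewrite -tensDl !addr0. Qed.
Lemma tensZl (c : k) x f : tens (c *: x) f = (c%:A : R) *: tens x f.
Proof. by rewrite -[c *: x]addr0 tens_linl tens0l addr0. Qed.
Lemma tens_suml (J : Type) (s : seq J) (G : J -> g) f :
  tens (\sum_(i <- s) G i) f = \sum_(i <- s) tens (G i) f.
Proof. exact: (big_morph (fun x => tens x f) (fun x y => tensDl x y f) (tens0l f)). Qed.
Lemma tens_linr (r : R) x f f' : tens x (r *: f + f') = r *: tens x f + tens x f'.
Proof.
apply/ffunP => i; rewrite !ffunE scalerDr; congr (_ + _).
by rewrite !scalerA mulrC.
Qed.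
Lemma tensDr x f f' : tens x (f + f') = tens x f + tens x f'.
Proof. by have := tens_linr 1 x f f'; rewrite !scale1r. Qed.
Lemma tens0r x : tens x 0 = 0.
Proof. by apply: (addrI (tens x 0)); rewrite -tensDr !addr0. Qed.
Lemma tensZr (r : R) x f : tens x (r *: f) = r *: tens x f.
Proof. by rewrite -[r *: f]addr0 tens_linr tens0r addr0. Qed.

Lemma vbasis_expand x : x = \sum_i coord (vbasis {:g}) i x *: b_ i.
Proof. exact/coord_vbasis/memvf. Qed.

(** The loop bracket is defined through the basis [vbasis]; on pure tensors bilinearity removes the
    basis, so that the orthonormal one can be used for the modes. *)
Lemma loop_bracket_tens x y f f' :
  loop_bracket br (tens x f) (tens y f') = tens (br x y) (f * f').
Proof.
rewrite [in RHS](vbasis_expand x) [in RHS](vbasis_expand y).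
rewrite (big_morph (br^~ _) (fun x y => brDl brP x y _) (br0l brP _)) tens_suml.
apply: eq_bigr => i _.
rewrite (big_morph (br _) (fun x y => brDr brP x y _) (br0r brP _)) tens_suml.
apply: eq_bigr => j _; rewrite !ffunE -scalerAl -scalerAr !tensZr.
by rewrite brZl // brZr // !tensZl.
Qed.

Lemma res_Zk (c : k) f : res ((c%:A : R) *: f) = c *: res f.
Proof. by rewrite resZ mulr_algl. Qed.

Lemma loop_cocycle_tens x y f f' :
  loop_cocycle phi B (tens x f) (tens y f') = B x y *: res (f' * ddt f).
Proof.
rewrite [in RHS](vbasis_expand x) (B_suml BP) scaler_suml; apply: eq_bigr => i _.
rewrite (BZl BP) [in RHS](vbasis_expand y) (B_sym BP (b_ i)) (B_suml BP).
rewrite mulr_sumr scaler_suml; apply: eq_bigr => j _.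
rewrite !ffunE linearZ /= -scalerAl -scalerAr !res_Zk (BZl BP) !scalerA.
by congr (_ *: _); rewrite (B_sym BP (b_ j)); ring.
Qed.

Definition loop_nabla d (u : loop) : loop := [ffun i => nabla phi d (u i)].
Definition affine_nabla d (x : affine) : affine := (loop_nabla d x.1, d x.2).
Definition affine_deep (N : int) (x : affine) : Prop :=
  (forall i, mpow phi N (x.1 i)) /\ x.2 = 0.

Section LoopNabla.
Variable d : R -> R.
Hypothesis dP : is_der d.

Lemma loop_nablaD u v : loop_nabla d (u + v) = loop_nabla d u + loop_nabla d v.
Proof. by apply/ffunP => i; rewrite !ffunE nablaD. Qed.
Lemma loop_nabla0 : loop_nabla d 0 = 0.
Proof. by apply/ffunP => i; rewrite !ffunE nabla0. Qed.
Lemma loop_nablaZ (r : R) u : loop_nabla d (r *: u) = d r *: u + r *: loop_nabla d u.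
Proof. by apply/ffunP => i; rewrite !ffunE nablaZ. Qed.
Lemma loop_nabla_tens x f : loop_nabla d (tens x f) = tens x (nabla phi d f).
Proof. by apply/ffunP => i; rewrite !ffunE nablaZ // (derA dP) scale0r add0r. Qed.

Lemma loop_nabla_bracket u v : loop_nabla d (loop_bracket br u v)
  = loop_bracket br (loop_nabla d u) v + loop_bracket br u (loop_nabla d v).
Proof.
rewrite /loop_bracket (big_morph _ loop_nablaD loop_nabla0) -big_split.
apply: eq_bigr => i _; rewrite (big_morph _ loop_nablaD loop_nabla0) -big_split.
by apply: eq_bigr => j _; rewrite loop_nabla_tens nablaM // tensDr !ffunE.
Qed.

Lemma loop_nabla_cocycle u v : d (loop_cocycle phi B u v)
  = loop_cocycle phi B (loop_nabla d u) v + loop_cocycle phi B u (loop_nabla d v).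
Proof.
rewrite /loop_cocycle (big_morph _ (derD dP) (der0 dP)) -big_split.
apply: eq_bigr => i _; rewrite (big_morph _ (derD dP) (der0 dP)) -big_split.
apply: eq_bigr => j _; rewrite (derZ dP) (nabla_res phi dP) nablaM // resD scalerDr.
by rewrite !ffunE nabla_ddt // addrC.
Qed.
End LoopNabla.

Lemma affine_nabla_lie_der d :
  is_der d -> lie_der (affine_bracket phi br B) d (affine_nabla d).
Proof.
move=> dP; split=> //.
- by move=> [u r] [v s]; congr pair; [exact: loop_nablaD|exact: derD].
- by move=> a [u r]; congr pair; [exact: loop_nablaZ|exact: derM].
- by move=> [u r] [v s]; congr pair; [exact: loop_nabla_bracket|exact: loop_nabla_cocycle].
Qed.

Lemma affine_deep_bracket (x : affine) (M : int) :
  exists N, forall y : affine,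
    affine_deep N y -> affine_deep M (affine_bracket phi br B y x).
Proof.
have /choice [b bP] : forall j, exists b, mpow phi b (x.1 j).
  by move=> j; exact: mpow_bound.
(* A common lower bound for the orders of the components of x. *)
pose b0 : int := - (\max_j `|b j|%N)%:Z.
have xb j : mpow phi b0 (x.1 j).
  apply: mpowW (bP j); have := leq_bigmax (F := fun j => `|b j|%N) j; rewrite /b0; lia.
(* The first bound puts the products in m^M. Under the second the derivatives of the components of y
   have order at least - b0, so the residues in the cocycle vanish. *)
exists (Num.max (M - b0) (1 - b0)) => y [yN _].
have y1 i : mpow phi (M - b0) (y.1 i) by apply: mpowW (yN i); rewrite le_max lexx.
have y2 i : mpow phi (1 - b0) (y.1 i) by apply: mpowW (yN i); rewrite le_max lexx orbT.
split=> [i|] /=.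
  rewrite /loop_bracket sum_ffunE; elim/big_ind: _ => [|? ? ? ?|j _]; first exact: mpow0.
    exact: mpowD.
  rewrite sum_ffunE; elim/big_ind: _ => [|? ? ? ?|e _]; first exact: mpow0.
    exact: mpowD.
  rewrite ffunE -(subrK b0 M); apply/mpowZ/mpowM; [exact: y1|exact: xb].
rewrite /loop_cocycle big1 // => i _; rewrite big1 // => j _.
by rewrite (res_eq0 (mpowM (xb j) (mpow_ddt (y2 i)))) ?scaler0 //; lia.
Qed.

Variables (X : (\dim {:g}).-tuple g) (h : k).
Hypothesis XP : is_orthonormal_basis B X.
Hypothesis cas : forall y, \sum_i br (tnth X i) (br (tnth X i) y) = (2%:R * h) *: y.

Definition affine_j (a : I) f : affine := (tens (tnth X a) f, 0).
Definition affine_constant (a b i : I) : R := (structure_constant br B X a b i)%:A.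

Lemma affine_j_bracket (a b : I) f f' :
  affine_bracket phi br B (affine_j a f) (affine_j b f') =
  \sum_i affine_constant a b i *: affine_j i (f * f')
    + (a == b)%:R *: (res (f' * ddt f) *: ((0, 1) : affine)).
Proof.
have sumE (G : I -> loop) : \sum_i ((G i, 0) : affine) = (\sum_i G i, 0).
  by elim/big_rec2: _ => [//|i y1 y2 _ ->]; congr pair; rewrite /= addr0.
have -> : \sum_i affine_constant a b i *: affine_j i (f * f')
    = (tens (br (tnth X a) (tnth X b)) (f * f'), 0).
  rewrite (structure_constant_expand BP XP) tens_suml -sumE; apply: eq_bigr => i _.
  by rewrite tensZl; congr pair; rewrite /= scaler0.
congr pair; first by rewrite /= loop_bracket_tens !scaler0 addr0.
rewrite /= loop_cocycle_tens XP.2 add0r; case: eqP => _; last by rewrite !scale0r.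
by rewrite !scale1r [RHS]mulr1.
Qed.

(** The modes of the abstract Fock module belong to the X_a; this carries the commutation relation
    over to an arbitrary element of g. *)
Lemma aff_in_expand x f : aff_in phi br B x f =
  \sum_a ((B x (tnth X a))%:A : R) *: aff_in phi br B (tnth X a) f.
Proof.
rewrite {1}(orthonormal_expand BP XP x) /aff_in tens_suml.
have -> : ((\sum_a tens (B x (tnth X a) *: tnth X a) f, 0) : affine)
    = \sum_a ((B x (tnth X a))%:A : R) *: affine_j a f.
  elim/big_rec2: _ => [//|a y1 y2 _ <-]; congr pair; last by rewrite /= scaler0 addr0.
  by rewrite /= tensZl.
by rewrite raddf_sum; apply: eq_bigr => a _; rewrite /= linearZ.
Qed.

Lemma affine_representation : exists T : ext -> aff_fock phi br B h -> aff_fock phi br B h,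
  is_representation T /\
  (forall (D : theta phi) v, sugawara_rep X D v (T (ext_incl ext (D, 0)) v)) /\
  (forall v, T (ext_c0 ext) v
     = (\dim {:g})%:R *: aff_act (aff_c phi br B) (div_ch v)) /\
  (forall (y : theta_hat phi) M, is_submodule M ->
     forall v, M v -> M (T (ext_incl ext y) v)) /\
  (forall (x : ext) M, is_submodule M ->
     aff_stable (anchor phi (ext_proj ext x)) M ->
     forall v, M v -> M (T x v)) /\
  (forall (x : ext) (Y : g) (f : L) v,
     T x (aff_act (aff_in phi br B Y f) v)
       - aff_act (aff_in phi br B Y f) (T x v)
     = aff_act (aff_in phi br B Y (ext_proj ext x f)) v) /\
  (forall (x : ext) (r : R) v,
     T x (r *: v) - r *: T x v = anchor phi (ext_proj ext x) r *: v).
Proof.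
have br_cc (x : affine) : affine_bracket phi br B x (0, 1) = 0.
  congr pair.
    rewrite /= /loop_bracket big1 // => i _; rewrite big1 // => j _.
    by rewrite ffunE mulr0 tens0r.
  rewrite /= /loop_cocycle big1 // => i _; rewrite big1 // => j _.
  by rewrite ffunE mul0r /Defs.res coef_t0 scaler0.
have chE : aff_ch phi br B h = ugen (affine_bracket phi br B) (0, 1) + (h%:A : R)%:A by [].
have SE w : aff_F1 w <->
    exists2 x, affine_deep 1 x & w = ugen (affine_bracket phi br B) x.
  split=> [[u u1 ->]|[[u r] [/= u1 ->] ->]]; first by exists (u, 0).
  by exists u.
have deepW M N (x : affine) : M <= N -> affine_deep N x -> affine_deep M x.
  by move=> MN [x1 x2]; split=> // i; exact: mpowW (x1 i).
have nabV_linear r d e (x : affine) : is_der d -> is_der e ->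
    affine_nabla (fun s => r * d s + e s) x = r *: affine_nabla d x + affine_nabla e x.
  by move=> dP eP; congr pair; apply/ffunP => i; rewrite !ffunE nabla_linear.
have nabV_comm d e (x : affine) : is_der d -> is_der e ->
    affine_nabla (fun s => d (e s) - e (d s)) x
    = affine_nabla d (affine_nabla e x) - affine_nabla e (affine_nabla d x).
  by move=> dP eP; congr pair; apply/ffunP => i; rewrite !ffunE nabla_commutator.
have nabV_cc d : is_der d -> affine_nabla d (0, 1) = 0.
  by move=> dP; congr pair; [exact: loop_nabla0|exact: der1].
have nabV_deep d (x : affine) : is_der d -> affine_deep 1 x -> affine_deep 1 (affine_nabla d x).
  move=> dP [x1 x2]; split; last by rewrite /= x2 der0.
  by move=> i; rewrite ffunE; exact: mpow_nabla.
have jL (a : I) (r : R) f f' :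
    affine_j a (r *: f + f') = r *: affine_j a f + affine_j a f'.
  by congr pair; [exact: tens_linr|rewrite /= scaler0 addr0].
have j_deep (a : I) f N : mpow phi N f -> affine_deep N (affine_j a f).
  by move=> fN; split=> // i; rewrite ffunE; exact: mpowZ.
have j_nabla d (a : I) f :
    is_der d -> affine_nabla d (affine_j a f) = affine_j a (nabla phi d f).
  by move=> dP; congr pair; [exact: loop_nabla_tens|exact: der0].
have [||||T [Trep [Tth [Tc0 [Tinc [Tst [TJ TZ]]]]]]] := fock_representation k0 br_cc chE
  SE deepW affine_deep_bracket affine_nabla_lie_der nabV_linear nabV_comm nabV_cc
  nabV_deep jL affine_j_bracket j_deep j_nabla.
- by move=> a b i; rewrite /affine_constant (structure_constant_rot X brP BP) scaleNr.
- by move=> a b; rewrite /affine_constant (structure_constant_diag X brP BP) scale0r.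
- by move=> a b; rewrite /affine_constant (structure_constant_diag13 X brP BP) scale0r.
- move=> b i; rewrite /affine_constant.
  transitivity ((\sum_a \sum_e
      structure_constant br B X a b e * structure_constant br B X a e i)%:A : R).
    rewrite scaler_suml; apply: eq_bigr => a _; rewrite scaler_suml; apply: eq_bigr => e _.
    by rewrite -scalerAl mul1r scalerA.
  rewrite (structure_constant_casimir brP BP XP cas).
  by case: eqP => _; rewrite ?mul0r ?scale0r // !mul1r -scalerA scaler_nat mulr_natl.
exists T; split; first exact: Trep.
split; first exact: Tth.
split; first exact: Tc0.
split; first exact: Tinc.
split.
  move=> x M MM MS; apply: Tst => // N [ND NZ Nv Ng [Nc Nd]]; apply: MS; split=> //.
  move=> y f f' v ff'; have dP := anchor_der (ext_proj ext x).
  suff E : affine_nabla (anchor phi (ext_proj ext x)) (tens y f, 0) = (tens y f', 0).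
    by rewrite Ng E.
  congr pair; last exact: der0.
  rewrite [LHS]loop_nabla_tens //; congr tens.
  by apply: (coef_inj (phi := phi)) => n; rewrite coef_nabla // ff'.
split; last exact: TZ.
move=> x y f v; have [_ TD TZk _] := Trep.
have zC := z_central br_cc chE.
have E f' (w : aff_fock phi br B h) : aff_act (aff_in phi br B y f') w =
    \sum_a ((B y (tnth X a))%:A : R) *: aff_act (aff_in phi br B (tnth X a) f') w.
  rewrite aff_in_expand.
  apply: (eq_trans (act_sum zC _ _ _)); apply: eq_bigr => a _.
  exact: (actZl zC).
have T0 : T x 0 = 0 by apply: (addrI (T x 0)); rewrite -TD !addr0.
rewrite !E (big_morph _ (TD x) T0) -sumrB; apply: eq_bigr => a _.
(* The coefficients come from k, so T passes them without a Leibniz term. *)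
rewrite TZk -scalerBr; congr (_ *: _).
exact: TJ.
Qed.
End AffineRepresentation.

Theorem corollary2p4 (k : fieldType) (k0 : [pchar k] =i pred0)
    (R : comAlgType k) (L : comAlgType R) (phi : coordinate L) :
  exists E : theta_hat_LR_extension phi,
  [/\ extension_quotient E,
      (* the Sugawara representation *)
      forall (g : vectType k) (br : g -> g -> g) (B : g -> g -> k)
        (cartan : {vspace g}) (X : (\dim {:g}).-tuple g) (h : k),
        is_lie_bracket br -> is_simple_lie br ->
        is_split_cartan br cartan -> is_normalized_form br cartan B ->
        is_orthonormal_basis B X ->
        (forall y : g,
          \sum_i br (tnth X i) (br (tnth X i) y) = (2%:R * h) *: y) ->
        exists T : E -> aff_fock phi br B h -> aff_fock phi br B h,
          is_representation T /\
          (forall (D : theta phi) v, sugawara_rep X D v (T (ext_incl E (D, 0)) v)) /\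
          (forall v, T (ext_c0 E) v
             = (\dim {:g})%:R *: aff_act (aff_c phi br B) (div_ch v)) /\
          (forall (y : theta_hat phi) M, is_submodule M ->
             forall v, M v -> M (T (ext_incl E y) v)) /\
          (forall (x : E) M, is_submodule M ->
             aff_stable (anchor phi (ext_proj E x)) M ->
             forall v, M v -> M (T x v)) /\
          (forall (x : E) (Y : g) (f : L) v,
             T x (aff_act (aff_in phi br B Y f) v)
               - aff_act (aff_in phi br B Y f) (T x v)
             = aff_act (aff_in phi br B Y (ext_proj E x f)) v) /\
          (forall (x : E) (r : R) v,
             T x (r *: v) - r *: T x v = anchor phi (ext_proj E x) r *: v) &
      (* the oscillator representation *)
      exists T : E -> osc_fock phi -> osc_fock phi,
        is_representation T /\
        (forall (D : theta phi) v, osc_rep D v (T (ext_incl E (D, 0)) v)) /\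
        (forall v, T (ext_c0 E) v = v) /\
        (forall (y : theta_hat phi) M, is_submodule M ->
           forall v, M v -> M (T (ext_incl E y) v)) /\
        (forall (x : E) M, is_submodule M ->
           osc_stable (anchor phi (ext_proj E x)) M ->
           forall v, M v -> M (T x v)) /\
        (forall (x : E) (f : L) v,
           T x (osc_act (osc_in phi f) v) - osc_act (osc_in phi f) (T x v)
           = osc_act (osc_in phi (ext_proj E x f)) v) /\
        (forall (x : E) (r : R) v,
           T x (r *: v) - r *: T x v = anchor phi (ext_proj E x) r *: v)].
Proof.
exists (theta_hat_LR phi k0); split.
- exact: theta_hat_LR_quotient.
- move=> g br B cartan X h brP _ _ [BP _] XP cas.
  exact: (affine_representation k0 phi brP BP XP cas).
- exact: (osc_representation k0 phi).
Qed.
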